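(* Let $G=\langle g_\lambda:\lambda\in\Lambda\rangle\in\mathcal{G}_{dis}$, let $A=\bigcup_{\lambda\in\Lambda}J(g_\lambda)$, and let $M'$ and $M''$ be the minimal and maximal connected components of $\overline A$ with respect to the surrounding order (these exist). Then $J_{\min}\supset M'$ and $J_{\max}\supset M''$; in particular $J_{\min}\cap\overline A\neq\emptyset$ and $J_{\max}\cap\overline A\ne\emptyset$. Furthermore: (1) if $J_{\min}\cap A=\emptyset$, then $J_{\min}=M'$ and $J_{\min}$ is the boundary of the unbounded component of $\mathbb{C}\setminus J_{\min}$; (2) if $J_{\max}\cap A=\emptyset$, then $J_{\max}=M''$ and $J_{\max}$ is the boundary of the bounded component of $\mathbb{C}\setminus J_{\max}$ which contains $J_{\min}$.
   Context: A polynomial semigroup is a semigroup of non-constant complex polynomials (self-maps of $\hat{\mathbb{C}}$) under composition; $\langle g_\lambda\rangle$ is the semigroup generated by the $g_\lambda$. $F(G)$ is the set of points having a neighborhood on which $G$ is normal, $J(G)=\hat{\mathbb{C}}\setminus F(G)$, $J(g)=J(\langle g\rangle)$. $P(G)$ is the closure of the set of all critical values of all $g\in G$, $P^*(G)=P(G)\setminus\{\infty\}$. $\mathcal{G}$: polynomial semigroups all of whose elements have degree $\ge2$ and with $P^*(G)$ bounded in $\mathbb{C}$; $\mathcal{G}_{dis}$: those with $J(G)$ disconnected. $\mathcal{J}$ is the set of connected components of $J(G)$ not containing $\infty$. $\hat K(G)=\{z\in\mathbb{C}:\{g(z):g\in G\}\text{ bounded}\}$. For $G\in\mathcal{G}_{dis}$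 it is known that $\infty\in F(G)$; $J_{\min}=J_{\min}(G)$ is the unique element of $\mathcal{J}$ meeting $\partial\hat K(G)$ and $J_{\max}=J_{\max}(G)$ is the unique element of $\mathcal{J}$ meeting $\partial U_\infty$, $U_\infty$ the component of $F(G)$ containing $\infty$. Surrounding order: for connected $K_1,K_2\subset\mathbb{C}$, $K_1\le K_2$ means $K_1=K_2$ or $K_1$ lies in a bounded component of $\mathbb{C}\setminus K_2$. *)

(* Defs.v *)
From HB Require Import structures.
From mathcomp Require Import all_boot all_order all_algebra.
From mathcomp Require Import all_classical all_reals all_analysis.
From mathcomp Require Import complex.
Import numFieldNormedType.Exports.
Import Order.TTheory GRing.Theory Num.Theory.

Set Implicit Arguments.
Unset Strict Implicit.
Unset Printing Implicit Defensive.

Local Open Scope classical_set_scope.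
Local Open Scope ring_scope.

Definition Cplx (R : realType) : numFieldType := (R[i])^o.
Definition Chat (R : realType) : topologicalType :=
  one_point_compactification (Cplx R).

Section PolySemigroups.
Variable R : realType.
Local Notation C := (Cplx R).
Local Notation Ĉ := (Chat R).

(** A polynomial viewed as a self-map of the Riemann sphere (infinity = None). *)
Definition ext (p : {poly C}) (x : Ĉ) : Ĉ :=
  match x with Some z => Some p.[z] | None => None end.

(** Squared chordal (spherical) distance on the Riemann sphere. *)
Definition chord2 (x y : Ĉ) : C :=
  match x, y with
  | Some z, Some w => 4 * `|z - w| ^+ 2 / ((1 + `|z| ^+ 2) * (1 + `|w| ^+ 2))
  | Some z, None | None, Some z => 4 / (1 + `|z| ^+ 2)
  | None, None => 0
  end.

Inductive gen_by (I : Type) (g : I -> {poly C}) : {poly C} -> Prop :=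
| gen_base i : gen_by g (g i)
| gen_comp p q : gen_by g p -> gen_by g q -> gen_by g (p \Po q).

Definition cyclic_sg (p : {poly C}) : set {poly C} := gen_by (fun _ : unit => p).

Definition normal_on (F : set {poly C}) (U : set Ĉ) : Prop :=
  forall f : nat -> {poly C}, (forall n, F (f n)) ->
  exists phi : nat -> nat, (forall m n, (m < n)%N -> (phi m < phi n)%N) /\
  exists h : Ĉ -> Ĉ, forall x, U x ->
    exists V, nbhs x V /\
      forall eps : C, 0 < eps -> exists N, forall n, (N <= n)%N ->
        forall y, V y -> U y -> chord2 (ext (f (phi n)) y) (h y) < eps.

Definition Fatou (G : set {poly C}) : set Ĉ :=
  [set x | exists U, [/\ open U, U x & normal_on G U]].
Definition Julia (G : set {poly C}) : set Ĉ := ~` Fatou G.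

Definition fin (S : set Ĉ) : set C := [set z | S (Some z)].

(** P(G): closure of all critical values of all elements of G (as maps of the
    sphere; infinity is a critical value of every polynomial of degree >= 2). *)
Definition critvals (G : set {poly C}) : set Ĉ :=
  [set None] `|`
  [set x | exists p c, [/\ G p, p^`().[c] = 0 & x = Some p.[c]]].
Definition Pset (G : set {poly C}) : set Ĉ := closure (critvals G).
Definition Pstar (G : set {poly C}) : set C := fin (Pset G).

Definition in_calG (I : Type) (g : I -> {poly C}) : Prop :=
  (forall p, gen_by g p -> (2 < size p)%N) /\ bounded_set (Pstar (gen_by g)).
Definition in_calG_dis (I : Type) (g : I -> {poly C}) : Prop :=
  in_calG g /\ ~ connected (Julia (gen_by g)).

Definition is_component (T : topologicalType) (A K : set T) : Prop :=
  exists2 x, A x & K = connected_component A x.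

Definition bdry (T : topologicalType) (A : set T) : set T :=
  closure A `\` interior A.

Definition calJ (G : set {poly C}) (K : set C) : Prop :=
  exists2 x : C, Julia G (Some x) &
    ~ connected_component (Julia G) (Some x) None /\
    K = fin (connected_component (Julia G) (Some x)).

Definition Khat (G : set {poly C}) : set C :=
  [set z | bounded_set [set p.[z] | p in G]].

Definition Uinf (G : set {poly C}) : set Ĉ := connected_component (Fatou G) None.

Definition is_Jmin (G : set {poly C}) (K : set C) : Prop :=
  calJ G K /\ K `&` bdry (Khat G) !=set0.
Definition is_Jmax (G : set {poly C}) (K : set C) : Prop :=
  calJ G K /\ K `&` fin (bdry (Uinf G)) !=set0.

Definition surr (K1 K2 : set C) : Prop :=
  K1 = K2 \/ exists B, [/\ is_component (~` K2) B, bounded_set B & K1 `<=` B].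

Definition unionJ (I : Type) (g : I -> {poly C}) : set C :=
  \bigcup_(i in [set: I]) fin (Julia (cyclic_sg (g i))).

Definition minimal_comp (A M : set C) : Prop :=
  is_component A M /\ forall K, is_component A K -> surr K M -> K = M.
Definition maximal_comp (A M : set C) : Prop :=
  is_component A M /\ forall K, is_component A K -> surr M K -> K = M.

End PolySemigroups.

(* Main.v *)
(** Fix a generator h with filled Julia set K(h) and put E(p) = p^-1(K(h)) for p in G. Bounded
   postcritical set makes every E(p) a full continuum, and the boundaries of the E(p) are dense
   in the finite part S of J(G): on a disc missing all of them either every p in G has bounded
   values, or every p omits K(h) and Harnack's inequality for ln|h^n p| makes G normal.
   For a relatively clopen piece F of S, every boundary of an E(p) lies in F or misses it.

   S is bounded: otherwise there are elements p of arbitrarily large degree with E(p) in a fixed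
   compact set, although each is of the form q h p' with E(q) long; a long connected E(q) forces
   a small leading coefficient of q (capacity), whereas p grows exponentially in its degree
   just to the right of all the E(p).

   If J_min missed the closure of A, a clopen F around J_min would miss it as well. Whenever
   E(p) contains the part V of the plane cut off around J_min by S \ F, so does E(p g_l): otherwise
   E(p g_l) is a compact subset of the interior of K(g_l) which is invariant under inverse
   branches of g_l, which is absurd. So all E(p) contain V, contradicting density. The other
   clauses are variations on this: if J_min misses A then g_l maps the filled set of J_min into
   itself, which puts its interior into the Fatou set, and if J_max misses A the same holds for
   the complement of the component of C \ J_max around J_min. *)
Require Import Defs.
From HB Require Import structures.
From mathcomp Require Import all_boot all_order all_algebra.
From mathcomp Require Import all_classical all_reals all_analysis.
From mathcomp Require Import complex separable cyclotomic cyclic.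
From mathcomp Require Import ring lra zify.
Import numFieldNormedType.Exports.
Import Order.TTheory GRing.Theory Num.Theory.
Set Implicit Arguments.
Unset Strict Implicit.
Unset Printing Implicit Defensive.
Local Open Scope classical_set_scope.
Local Open Scope ring_scope.

(** * Metric topology of the plane *)

Section Metric.
Variable R : realType.
Local Notation C := (Cplx R).

(** Normality has to come from estimates on polynomials: averaging over roots of unity bounds
    coefficients on a circle, [ln |p|] is approximated by real parts of polynomials, and Harnack's
    inequality stands in for Montel's theorem on omitted values. That a boundary cannot straddle a
    clopen piece requires the boundary of a full continuum to be connected, whence the unicoherence
    of the plane.

    Invariance of a compact set under inverse branches is absurd for the following reason. At its
    rightmost point x, the preimages of a value w under all iterates lie to the left, so a step t to
    the right multiplies the distance of the value from w by a factor exponential in the degree; yet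
    x + t has a bounded orbit if the set lies in the interior of the filled Julia set. Two values w
    are kept at hand, since the value at x may be close to one of them.

    A critical value of h belongs to every E(p), as the postcritical set is bounded. This common
    point lies in the filling of every component, both of S and of the closure of A, and so makes
    the surrounding order total on each. *)

Definition nrm (z : C) : R := Normc.normc z.
Definition cr (x : R) : C := (x%:C)%C.
Definition dsk (z : C) (e : R) : set C := [set w | nrm (w - z) < e].

Lemma nrmE (z : C) : `|z| = cr (nrm z).
Proof. by []. Qed.

Lemma nrm0 : nrm 0 = 0. Proof. exact: Normc.normc0. Qed.
Lemma nrm1 : nrm 1 = 1. Proof. exact: Normc.normc1. Qed.
Lemma nrmM (z w : C) : nrm (z * w) = nrm z * nrm w.
Proof. exact: Normc.normcM. Qed.
Lemma nrmV (z : C) : nrm z^-1 = (nrm z)^-1.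
Proof. exact: Normc.normcV. Qed.
Lemma nrmN (z : C) : nrm (- z) = nrm z. Proof. exact: normcN. Qed.
Lemma nrmB (z w : C) : nrm (z - w) = nrm (w - z).
Proof. by rewrite -nrmN opprB. Qed.
Lemma nrm_ge0 (z : C) : 0 <= nrm z.
Proof. by rewrite /nrm; case: z => a b; exact: sqrtr_ge0. Qed.
Lemma nrmD (z w : C) : nrm (z + w) <= nrm z + nrm w.
Proof. exact: le_normcD. Qed.
Lemma nrm_tri (a b c : C) : nrm (a - c) <= nrm (a - b) + nrm (b - c).
Proof.
have -> : a - c = (a - b) + (b - c) by ring.
exact: nrmD.
Qed.
Lemma nrm_sub (z w : C) : nrm z - nrm w <= nrm (z - w).
Proof. by have := nrmD (z - w) w; rewrite subrK; lra. Qed.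
Lemma nrm_eq0 (z : C) : (nrm z == 0) = (z == 0).
Proof.
apply/eqP/eqP => [/Normc.eq0_normc //|->]; exact: nrm0.
Qed.
Lemma nrm_gt0 (z : C) : (0 < nrm z) = (z != 0).
Proof. by rewrite lt0r nrm_ge0 andbT nrm_eq0. Qed.
Lemma nrmX (z : C) n : nrm (z ^+ n) = nrm z ^+ n.
Proof. by elim: n => [|n IH]; rewrite ?expr0 ?nrm1 // !exprS nrmM IH. Qed.
Lemma nrm_cr (x : R) : nrm (cr x) = `|x|.
Proof. by rewrite /nrm /= expr0n addr0 sqrtr_sqr. Qed.
Lemma nrm_sqr (z : C) : nrm z ^+ 2 = complex.Re z ^+ 2 + complex.Im z ^+ 2.
Proof.
by rewrite /nrm; case: z => a b /=; rewrite sqr_sqrtr // addr_ge0 ?sqr_ge0.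
Qed.
Lemma nrm_sum I (r : seq I) (P : pred I) (F : I -> C) :
  nrm (\sum_(i <- r | P i) F i) <= \sum_(i <- r | P i) nrm (F i).
Proof.
elim/big_rec2: _ => [|i y x _ h]; first by rewrite nrm0.
by apply: (le_trans (nrmD _ _)); rewrite lerD2l.
Qed.
Lemma nrm_prod I (r : seq I) (P : pred I) (F : I -> C) :
  nrm (\prod_(i <- r | P i) F i) = \prod_(i <- r | P i) nrm (F i).
Proof. by apply: (big_morph nrm nrmM nrm1). Qed.
Lemma nrm_nat n : nrm (n%:R : C) = n%:R.
Proof.
have -> : (n%:R : C) = cr n%:R by rewrite /cr rmorph_nat.
by rewrite nrm_cr ger0_norm.
Qed.
Lemma Re_nrm (z : C) : `|complex.Re z| <= nrm z.
Proof.
rewrite -(@ler_pXn2r _ 2) ?nnegrE ?nrm_ge0 // nrm_sqr real_normK ?num_real //.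
by rewrite lerDl sqr_ge0.
Qed.
Lemma Im_nrm (z : C) : `|complex.Im z| <= nrm z.
Proof.
rewrite -(@ler_pXn2r _ 2) ?nnegrE ?nrm_ge0 // nrm_sqr real_normK ?num_real //.
by rewrite lerDr sqr_ge0.
Qed.
Lemma ReB (z w : C) : complex.Re (z - w) = complex.Re z - complex.Re w.
Proof. by case: z; case: w. Qed.
Lemma ImB (z w : C) : complex.Im (z - w) = complex.Im z - complex.Im w.
Proof. by case: z; case: w. Qed.
Lemma nrm_le_ReIm (z : C) : nrm z <= `|complex.Re z| + `|complex.Im z|.
Proof.
rewrite -(@ler_pXn2r _ 2) ?nnegrE ?nrm_ge0 ?addr_ge0 //.
rewrite nrm_sqr -(real_normK (num_real (complex.Re z))).
rewrite -(real_normK (num_real (complex.Im z))).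
have := normr_ge0 (complex.Re z); have := normr_ge0 (complex.Im z).
by move: `|complex.Re z| `|complex.Im z| => a b; nra.
Qed.
Lemma cr_gt0 (x : R) : (0 < cr x) = (0 < x).
Proof. by rewrite ltcR. Qed.
Lemma cr_le (x y : R) : (cr x <= cr y) = (x <= y).
Proof. exact: lecR. Qed.
Lemma cr_lt (x y : R) : (cr x < cr y) = (x < y).
Proof. exact: ltcR. Qed.
Lemma posC (e : C) : 0 < e -> exists2 x : R, 0 < x & e = cr x.
Proof.
case: e => a b; rewrite ltcE /= => /andP[/eqP -> h]; by exists a.
Qed.

Lemma ballE (z : C) (x : R) : ball z (cr x) = dsk z x.
Proof.
by apply/seteqP; split => w; rewrite -ball_normE /ball_ /= /dsk /= distrC nrmE ltcR.
Qed.

Lemma dsk_nbhs (z : C) (A : set C) :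
  nbhs z A <-> exists2 e : R, 0 < e & dsk z e `<=` A.
Proof.
split.
  move=> /nbhs_ballP[e /= /posC[x x0 ->]]; rewrite ballE => h; by exists x.
move=> [e e0 h]; apply/nbhs_ballP; exists (cr e) => /=; first by rewrite cr_gt0.
by rewrite ballE.
Qed.

Lemma openCP (A : set C) :
  open A <-> forall z, A z -> exists2 e : R, 0 < e & dsk z e `<=` A.
Proof.
rewrite openE; split => h z Az; first by apply/dsk_nbhs; exact: h.
by apply/dsk_nbhs; exact: h.
Qed.

Lemma closureCP (A : set C) z :
  closure A z <-> forall e : R, 0 < e -> exists2 w, A w & nrm (w - z) < e.
Proof.
split=> h.
  move=> e e0; have [|w [Aw zw]] := h (dsk z e); last by exists w.
  by apply/dsk_nbhs; exists e.
by move=> B /dsk_nbhs[e e0 sB]; have [w Aw zw] := h e e0; exists w; split=> //; exact: sB.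
Qed.

Lemma closedCP (A : set C) :
  closed A <->
  forall z, (forall e : R, 0 < e -> exists2 w, A w & nrm (w - z) < e) -> A z.
Proof.
by split=> h z hz; apply: h; apply/closureCP.
Qed.

Lemma dsk_open z e : open (dsk z e).
Proof.
apply/openCP => w zw; exists (e - nrm (w - z)); first by rewrite subr_gt0.
by move=> v; rewrite /dsk /= => vw; have := nrm_tri v w z; lra.
Qed.

Lemma notin_closed (A : set C) z : closed A -> ~ A z ->
  exists2 e : R, 0 < e & dsk z e `<=` ~` A.
Proof.
move=> cA nz; have /openCP := closed_openC cA; exact.
Qed.

Lemma bdryCP (A : set C) z : bdry A z <-> forall e : R, 0 < e ->
   (exists2 w, A w & nrm (w - z) < e) /\ (exists2 w, ~ A w & nrm (w - z) < e).
Proof.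
split=> [[/closureCP cA niA] e e0|h].
  split; first exact: cA.
  apply: contrapT => h; apply: niA; apply/dsk_nbhs; exists e => // w wz.
  by apply: contrapT => nA; apply: h; exists w.
split; first by apply/closureCP => e /h[].
move=> /dsk_nbhs[e e0 sA]; have [_ [w nA wz]] := h e e0; exact/nA/sA.
Qed.

Lemma bdry_closed (A : set C) : closed (bdry A).
Proof.
rewrite /bdry setDE; apply: closedI; first exact: closed_closure.
exact: open_closedC (open_interior _).
Qed.

Lemma closed_bdry (A : set C) : closed A -> bdry A `<=` A.
Proof. by move=> /closure_id cA z []; rewrite -cA. Qed.

Lemma interiorCP (A : set C) z :
  A^° z <-> exists2 e : R, 0 < e & dsk z e `<=` A.
Proof. exact: dsk_nbhs. Qed.

Definition bnd (A : set C) := exists M : R, forall z, A z -> nrm z <= M.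
(** The Heine-Borel form reduces compactness to a closedness and a bound in [R]. It agrees with
    [compact] by [compact_cpt] and [cpt_compact], which serve to describe the neighbourhoods of
    infinity. *)
Definition cpt (A : set C) := closed A /\ bnd A.

Lemma cpt_bigdsk (A : set C) : bnd A ->
  exists2 M : R, 0 < M & forall z, A z -> nrm z < M.
Proof.
move=> [M hM]; exists (`|M| + 1); first by rewrite ltr_wpDl.
by move=> z /hM; have := ler_norm M; lra.
Qed.

Lemma bnd_sub (A B : set C) : A `<=` B -> bnd B -> bnd A.
Proof. by move=> AB [M hM]; exists M => z /AB /hM. Qed.

Lemma ultra_fmap_cvg (I : Type) (T : topologicalType) (F : set_system I) (f : I -> T) (A : set T) :
  UltraFilter F -> compact A -> F (f @^-1` A) ->
  exists2 l, A l & forall B, nbhs l B -> F (f @^-1` B).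
Proof.
move=> FU cA FA; have FF : ProperFilter F by exact: ultra_proper.
have [l [Al cl]] := cA (f @ F) _ FA.
exists l => // B lB.
have [//|nB] := in_ultra_setVsetC (f @^-1` B) FU.
by have [x [/= nBx Bx]] := cl (~` B) B nB lB.
Qed.

Lemma ultra_limR (F : set_system nat) (u : nat -> R) (M : R) : UltraFilter F ->
  (forall n, `|u n| <= M) ->
  exists l : R, forall e : R, 0 < e -> F [set n | `|u n - l| < e].
Proof.
move=> FU uM.
have FF : ProperFilter F by exact: ultra_proper.
have [|l _ Fl] := ultra_fmap_cvg FU (@segment_compact R (- M) M) (f := u).
  by apply: filterS (@filterT _ F _) => n _; rewrite /= in_itv /= -ler_norml.
exists l => e e0; have /= := Fl (ball l e) (nbhsx_ballx _ _ e0).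
by apply: filterS => n; rewrite -ball_normE /ball_ /= distrC.
Qed.

Lemma ultra_lim (F : set_system nat) (u : nat -> C) (M : R) : UltraFilter F ->
  (forall n, nrm (u n) <= M) ->
  exists l : C, forall e : R, 0 < e -> F [set n | nrm (u n - l) < e].
Proof.
move=> FU uM; have FF : ProperFilter F by exact: ultra_proper.
have [a ha] := ultra_limR FU (fun n => le_trans (Re_nrm (u n)) (uM n)).
have [b hb] := ultra_limR FU (fun n => le_trans (Im_nrm (u n)) (uM n)).
exists (a +i* b)%C => e e0; have e2 : 0 < e / 2 by rewrite divr_gt0.
apply: filterS2 (ha _ e2) (hb _ e2) => n /= h1 h2.
apply: (le_lt_trans (nrm_le_ReIm _)); rewrite ReB ImB [ltRHS]splitr; exact: ltrD.
Qed.

(** An ultrafilter finer than the cofinite filter gives limits to all bounded sequences at once,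
    which spares the diagonal extraction in [montel]. *)
Lemma ultra_nat : exists F : set_system nat,
  UltraFilter F /\ forall N, F [set n | (N <= n)%N].
Proof.
have [F [FU sF]] := @ultraFilterLemma nat \oo _.
by exists F; split => // N; apply: sF; exists N.
Qed.

Lemma bounded_cluster (u : nat -> C) (M : R) : (forall n, nrm (u n) <= M) ->
  exists l, forall e : R, 0 < e -> forall N, exists2 n, (N <= n)%N & nrm (u n - l) < e.
Proof.
move=> uM; have [F [FU hF]] := ultra_nat; have [l hl] := ultra_lim FU uM.
exists l => e e0 N; have FF : ProperFilter F by exact: ultra_proper.
by have [n [/= ? ?]] := filter_ex (filterI (hF N) (hl _ e0)); exists n.
Qed.

Lemma cpt_seq (A : set C) (u : nat -> C) : cpt A -> (forall n, A (u n)) ->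
  exists2 l, A l & forall e : R, 0 < e -> forall N,
     exists2 n, (N <= n)%N & nrm (u n - l) < e.
Proof.
move=> [/closedCP cA [M hM]] uA.
have [l hl] := bounded_cluster (fun n => hM _ (uA n)).
by exists l => //; apply: cA => e e0; have [n _ h] := hl e e0 0%N; exists (u n).
Qed.

Lemma inv_small (e : R) : 0 < e -> exists N, forall n, (N <= n)%N -> n.+1%:R^-1 < e.
Proof.
move=> e0; exists (Num.trunc e^-1) => n Nn.
rewrite invf_plt ?posrE ?ltr0Sn //.
by apply: (lt_le_trans (truncnS_gt _)); rewrite ler_nat.
Qed.

Definition cont_on (A : set C) (f : C -> R) := forall z, A z -> forall e : R, 0 < e ->
  exists2 d : R, 0 < d & forall w, A w -> nrm (w - z) < d -> `|f w - f z| < e.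

Lemma cpt_min (A : set C) (f : C -> R) : cpt A -> A !=set0 -> cont_on A f ->
  exists2 z, A z & forall w, A w -> f z <= f w.
Proof.
move=> cA [a Aa] cf.
have lb : has_lbound (f @` A).
  apply: contrapT => nlb.
  have /choice[u hu] : forall n : nat, exists z, A z /\ f z < - n%:R.
    move=> n; apply: contrapT => h; apply: nlb; exists (- n%:R) => _ [z Az <-].
    by rewrite leNgt; apply/negP => ?; apply: h; exists z.
  have [l Al hl] := cpt_seq cA (fun n => (hu n).1).
  have [d d0 hd] := cf _ Al _ ltr01.
  have [n Nn /(hd _ (hu n).1)] := hl d d0 (Num.trunc (`|f l| + 1)).+1.
  have : (Num.trunc (`|f l| + 1)).+1%:R <= n%:R :> R by rewrite ler_nat.
  have := truncnS_gt (`|f l| + 1); have := (hu n).2.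
  have := ler_norm (- f l); rewrite normrN ltr_norml => ? ? ? ? /andP[]; lra.
have hs : has_inf (f @` A) by split=> //; exists (f a), a.
have /choice[u hu] : forall n : nat, exists z, A z /\ f z < inf (f @` A) + n.+1%:R^-1.
  move=> n; have n0 : 0 < n.+1%:R^-1 :> R by rewrite invr_gt0 ltr0Sn.
  by have [_ [z Az <-] h] := inf_adherent n0 hs; exists z.
have [l Al hl] := cpt_seq cA (fun n => (hu n).1).
exists l => // w Aw; rewrite leNgt; apply/negP => fwl.
have e0 : 0 < (f l - f w) / 2 by lra.
have [d d0 hd] := cf _ Al _ e0; have [N hN] := inv_small e0.
have [n Nn /(hd _ (hu n).1)] := hl d d0 N; rewrite ltr_norml => /andP[h1 _].
have h2 := hN n Nn; have h3 := (hu n).2.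
have h4 : inf (f @` A) <= f w by apply: ge_inf => //; exists w.
move: (inf _) h4 h3 => I h4 h3; move: (n.+1%:R^-1) h2 h3 => t h2 h3; lra.
Qed.

Lemma cpt_max (A : set C) (f : C -> R) : cpt A -> A !=set0 -> cont_on A f ->
  exists2 z, A z & forall w, A w -> f w <= f z.
Proof.
move=> cA A0 cf; have [|z Az hz] := @cpt_min A (fun z => - f z) cA A0.
  move=> z Az e e0; have [d d0 hd] := cf z Az e e0; exists d => // w Aw wz.
  by rewrite -opprD normrN; exact: hd.
by exists z => // w /hz; rewrite lerN2.
Qed.

Lemma cont_nrmB (A : set C) c : cont_on A (fun z => nrm (z - c)).
Proof.
move=> z _ e e0; exists e => // w _ wz.
have := nrm_tri w z c; have := nrm_tri z w c; rewrite (nrmB z w) ltr_norml; lra.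
Qed.

Lemma cont_Re (A : set C) : cont_on A (fun z => complex.Re z).
Proof.
move=> z _ e e0; exists e => // w _; apply: le_lt_trans.
by rewrite -ReB; exact: Re_nrm.
Qed.

Lemma cpt_dist (A : set C) z : cpt A -> ~ A z ->
  exists2 e : R, 0 < e & forall w, A w -> e <= nrm (w - z).
Proof.
move=> [cA _] nz; have [e e0 h] := notin_closed cA nz; exists e => // w Aw.
by rewrite leNgt; apply/negP => /h.
Qed.

Lemma cpt_sep (A B : set C) : cpt A -> cpt B -> A `&` B = set0 ->
  exists2 e : R, 0 < e & forall a b, A a -> B b -> e <= nrm (a - b).
Proof.
move=> cA cB AB; apply: contrapT => h.
have /choice[u hu] : forall n : nat, exists p : C * C,
    [/\ A p.1, B p.2 & nrm (p.1 - p.2) < n.+1%:R^-1].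
  move=> n; apply: contrapT => h'; apply: h; exists n.+1%:R^-1 => [|a b Aa Bb].
    by rewrite invr_gt0 ltr0Sn.
  by rewrite leNgt; apply/negP => ?; apply: h'; exists (a, b).
have [l Al hl] : exists2 l, A l & forall e : R, 0 < e -> forall N,
     exists2 n, (N <= n)%N & nrm ((u n).1 - l) < e.
  by apply: (cpt_seq cA) => n; case: (hu n).
have Bl : B l.
  case: cB => /closedCP cB _; apply: cB => e e0.
  have e2 : 0 < e / 2 by lra.
  have [N hN] := inv_small e2; have [n Nn h1] := hl _ e2 N.
  have [_ Bn h2] := hu n; exists (u n).2 => //.
  have := nrm_tri (u n).2 (u n).1 l; have := hN n Nn; move: h1 h2; rewrite (nrmB (u n).2 (u n).1).
  by move: (n.+1%:R^-1) => t; lra.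
have : (A `&` B) l by []. by rewrite AB.
Qed.

Lemma cpt_closed_sub (A B : set C) : A `<=` B -> closed A -> cpt B -> cpt A.
Proof. by move=> AB cA [_ bB]; split => //; exact: bnd_sub bB. Qed.

Lemma cptU (A B : set C) : cpt A -> cpt B -> cpt (A `|` B).
Proof.
move=> [cA [M hM]] [cB [N hN]]; split; first exact: closedU.
by exists (Num.max M N) => z [/hM|/hN] h; rewrite le_max h ?orbT.
Qed.

Lemma closed_dsk_cpt z r : cpt [set w | nrm (w - z) <= r].
Proof.
split; last by exists (r + nrm z) => w /=; have := nrm_sub w z; lra.
apply/closedCP => w h /=; rewrite leNgt; apply/negP => rw.
have e0 : 0 < nrm (w - z) - r by lra.
by have [v /= vr vw] := h _ e0; have := nrm_tri w v z; rewrite (nrmB w v); lra.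
Qed.

Lemma compact_cpt (A : set C) : compact A -> closed A -> cpt A.
Proof.
move=> cA clA; split=> //; apply: contrapT => nb.
have /choice[u hu] : forall n : nat, exists z, A z /\ n%:R < nrm z.
  move=> n; apply: contrapT => h'; apply: nb; exists n%:R => z Az.
  by rewrite leNgt; apply/negP => ?; apply: h'; exists z.
have [F [FU hF]] := ultra_nat; have FF : ProperFilter F by exact: ultra_proper.
have [|l _ Fl] := ultra_fmap_cvg FU cA (f := u).
  by apply: filterS (@filterT _ F _) => n _ /=; case: (hu n).
have /Fl /= h : nbhs l (dsk l 1) by apply/dsk_nbhs; exists 1.
have [n [/= h1 h2]] := filter_ex (filterI (hF (Num.trunc (nrm l + 1)).+1) h).
have := (hu n).2; have := truncnS_gt (nrm l + 1).
have : (Num.trunc (nrm l + 1)).+1%:R <= n%:R :> R by rewrite ler_nat.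
have := nrm_sub (u n) l; move: h2; rewrite /dsk /=; lra.
Qed.

Lemma cpt_compact (A : set C) : cpt A -> compact A.
Proof.
move=> [clA [M hM]]; rewrite compact_ultra => G GU GA.
have FG : ProperFilter G by exact: ultra_proper.
have lim (f : C -> R) : (forall z, `|f z| <= nrm z) ->
    exists l, forall e : R, 0 < e -> G [set z | `|f z - l| < e].
  move=> hf.
  have [|l _ Fl] := ultra_fmap_cvg GU (@segment_compact R (- M) M) (f := f).
    apply: filterS GA => z /hM zM; rewrite /= in_itv /= -ler_norml.
    exact: le_trans (hf z) zM.
  exists l => e e0; have /= := Fl (ball l e) (nbhsx_ballx _ _ e0).
  by apply: filterS => n; rewrite -ball_normE /ball_ /= distrC.
have [a ha] := lim _ Re_nrm; have [b hb] := lim _ Im_nrm.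
have Gl : forall e : R, 0 < e -> G (dsk (a +i* b)%C e).
  move=> e e0; have e2 : 0 < e / 2 by rewrite divr_gt0.
  apply: filterS2 (ha _ e2) (hb _ e2) => z; rewrite /dsk /= => h1 h2.
  apply: (le_lt_trans (nrm_le_ReIm _)); rewrite ReB ImB [ltRHS]splitr; exact: ltrD.
exists (a +i* b)%C; split; last first.
  by move=> B /dsk_nbhs[e e0 sB]; exact: filterS sB (Gl e e0).
move/closedCP: clA; apply=> e e0.
by have [z [/= ? ?]] := filter_ex (filterI GA (Gl e e0)); exists z.
Qed.

End Metric.
Arguments nrm : simpl never.
Arguments cr : simpl never.

(** * Connectedness *)

Section Connectivity.
Variable R : realType.
Local Notation C := (Cplx R).

(** Connectedness as constancy of locally constant predicates. Proofs then amount to choosing [P]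
    and checking that it is locally constant on [X]. *)
Definition conn (X : set C) := forall P : C -> Prop,
  (forall z, X z -> exists2 e : R, 0 < e &
     forall w, X w -> nrm (w - z) < e -> (P z <-> P w)) ->
  forall x y, X x -> X y -> P x -> P y.

Lemma connP (X : set C) : connected X <-> conn X.
Proof.
split=> [cX P lP x y Xx Xy Px|cX B [b Bb] [U oU BU] [D cD BD]].
  pose U Q := [set w : C | exists z (e : R), [/\ X z, Q z, nrm (w - z) < e &
     forall w, X w -> nrm (w - z) < e -> (P z <-> P w)]].
  have oU Q : open (U Q).
    apply/openCP => w [z [e [Xz Qz wz h]]]; exists (e - nrm (w - z)); first by lra.
    move=> v; rewrite /dsk /= => vw; exists z, e; split => //.
    by have := nrm_tri v w z; lra.
  have UQ (Q : C -> Prop) z : X z -> Q z -> U Q z.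
    by move=> Xz Qz; have [e e0 h] := lP z Xz; exists z, e; rewrite subrr nrm0.
  have : X `&` U P = X.
    apply: cX; first by exists x; split=> //; exact: UQ.
      by exists (U P).
    exists (~` U (fun z => ~ P z)); first exact: open_closedC.
    apply/seteqP; split => z [Xz Uz]; split => //.
      move: Uz => [v [e [_ Pv zv h]]] [v' [e' [_ Pv' zv' h']]].
      by apply: Pv'; apply/(h' z) => //; apply/(h z).
    by apply: (UQ) => //; apply: contrapT => nPz; apply: Uz; exact: UQ.
  move=> XU; have [_ [v [e [_ Pv yv h]]]] : (X `&` U P) y by rewrite XU.
  by apply/(h y).
have BX z : B z -> X z by rewrite BU => -[].
apply/seteqP; split => // y Xy; apply: (cX B _ b y) => //; last exact: BX.
move=> z Xz; have [Bz|nBz] := pselect (B z).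
  have /openCP hU := oU; have [|e e0 h] := hU z; first by move: Bz; rewrite BU => -[].
  by exists e => // w Xw /h Uw; split=> // _; rewrite BU.
have nDz : ~ D z by move=> Dz; apply: nBz; rewrite BD.
have [e e0 h] := notin_closed cD nDz; exists e => // w Xw /h nDw; split=> //.
by rewrite BD => -[].
Qed.

Lemma conn_pts (X : set C) (x : C) :
  (forall z, X z -> exists Y, [/\ conn Y, Y `<=` X, Y x & Y z]) -> conn X.
Proof.
move=> h P lP y z Xy Xz Py.
have [Y [cY YX Yx Yy]] := h y Xy; have [Z [cZ ZX Zx Zz]] := h z Xz.
have l (W : set C) : W `<=` X -> forall z, W z -> exists2 e : R, 0 < e &
     forall w, W w -> nrm (w - z) < e -> (P z <-> P w).
  move=> WX v /WX Xv; have [e e0 hv] := lP v Xv; exists e => // w /WX; exact: hv.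
by apply: (cZ P (l _ ZX) x z Zx Zz); apply: (cY P (l _ YX) y x Yy Yx).
Qed.

Lemma connU (X Y : set C) x : conn X -> conn Y -> X x -> Y x -> conn (X `|` Y).
Proof.
move=> cX cY Xx Yx; apply: (@conn_pts _ x) => z [Xz|Yz].
  by exists X; split => // w ?; left.
by exists Y; split => // w ?; right.
Qed.

Definition ccont_on (A : set C) (f : C -> C) := forall z, A z ->
  forall e : R, 0 < e ->
  exists2 d : R, 0 < d & forall w, A w -> nrm (w - z) < d -> nrm (f w - f z) < e.

Lemma conn_image (X : set C) (f : C -> C) : ccont_on X f -> conn X -> conn (f @` X).
Proof.
move=> cf cX P lP _ _ [x Xx <-] [y Xy <-].
apply: (cX (fun z => P (f z))) => // z Xz.
have [|e e0 h] := lP (f z); first by exists z.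
have [d d0 hd] := cf z Xz e e0; exists d => // w Xw wz.
by apply: h; [exists w|exact: hd].
Qed.

Lemma conn_closure (X Y : set C) : conn X -> X `<=` Y -> Y `<=` closure X -> conn Y.
Proof.
move=> cX XY YX P lP x y Yx Yy Px.
have l z : X z -> exists2 e : R, 0 < e &
     forall w, X w -> nrm (w - z) < e -> (P z <-> P w).
  move=> /XY Xz; have [e e0 h] := lP z Xz; exists e => // w /XY; exact: h.
have [e e0 he] := lP x Yx; have [d d0 hd] := lP y Yy.
have /closureCP/(_ e e0)[x' Xx' h1] := YX x Yx.
have /closureCP/(_ d d0)[y' Xy' h2] := YX y Yy.
have Px' : P x' by apply/(he x') => //; exact: XY.
by apply/(hd y') => //; [exact: XY|exact: (cX P l x' y')].
Qed.

Lemma conn_segment (a b : C) :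
  conn [set z | exists2 t : R, 0 <= t <= 1 & z = a + cr t * (b - a)].
Proof.
have -> : [set z | exists2 t : R, 0 <= t <= 1 & z = a + cr t * (b - a)] =
    (fun t : R => a + cr t * (b - a)) @` `[0, 1].
  by apply/seteqP; split => z [t ht]; [move=> ->|move=> <-]; exists t => //;
    move: ht; rewrite /= in_itv.
apply/connP; apply: connected_continuous_connected.
  by apply/connected_intervalP; exact: interval_is_interval.
apply: continuous_subspaceT => t B /dsk_nbhs[e e0 sB].
have d0 : 0 < e / (nrm (b - a) + 1) by rewrite divr_gt0 // ltr_wpDl ?nrm_ge0.
apply/nbhs_ballP; exists (e / (nrm (b - a) + 1)) => // s.
rewrite -ball_normE /= => st; apply: sB; rewrite /dsk /=.
have -> : a + cr s * (b - a) - (a + cr t * (b - a)) = cr (s - t) * (b - a).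
  rewrite /cr rmorphB /=; ring.
rewrite nrmM nrm_cr distrC.
move: st; rewrite ltr_pdivlMr ?ltr_wpDl ?nrm_ge0 //.
have := normr_ge0 (t - s); have := nrm_ge0 (b - a); nra.
Qed.

Lemma conn_convex (X : set C) :
  (forall a b (t : R), X a -> X b -> 0 <= t <= 1 -> X (a + cr t * (b - a))) -> conn X.
Proof.
move=> h P lP x y Xx Xy Px.
suff /(_ P lP x y Xx Xy Px) : conn X by [].
apply: (@conn_pts _ x) => z Xz.
exists [set w | exists2 t : R, 0 <= t <= 1 & w = x + cr t * (z - x)]; split.
- exact: conn_segment.
- by move=> _ [t ht ->]; exact: h.
- by exists 0; rewrite ?lexx ?ler01 // /cr rmorph0 mul0r addr0.
- by exists 1; rewrite ?lexx ?ler01 // /cr rmorph1 mul1r addrC subrK.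
Qed.

Lemma nrm_convex (a b c : C) (t : R) : 0 <= t <= 1 ->
  nrm (a + cr t * (b - a) - c) <= (1 - t) * nrm (a - c) + t * nrm (b - c).
Proof.
move=> /andP[t0 t1].
have -> : a + cr t * (b - a) - c = cr (1 - t) * (a - c) + cr t * (b - c).
  rewrite /cr rmorphB rmorph1 /=; ring.
by apply: (le_trans (nrmD _ _)); rewrite !nrmM !nrm_cr !ger0_norm // subr_ge0.
Qed.

Lemma conn_dsk z (r : R) : conn (dsk z r).
Proof.
apply: conn_convex => a b t; rewrite /dsk /= => ha hb ht.
apply: (le_lt_trans (nrm_convex _ _ _ ht)); case/andP: ht => t0 t1.
have [->|tn0] := eqVneq t 0; first by rewrite subr0 mul1r mul0r addr0.
have tp : 0 < t by rewrite lt0r tn0.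
by nra.
Qed.

Lemma conn_closed_dsk z (r : R) : conn [set w | nrm (w - z) <= r].
Proof.
apply: conn_convex => a b t /= ha hb ht.
apply: (le_trans (nrm_convex _ _ _ ht)); case/andP: ht => t0 t1; nra.
Qed.

Lemma connT : conn setT.
Proof. by apply: conn_convex. Qed.

Lemma conn_ray (z : C) : conn [set w | exists2 s : R, 1 <= s & w = cr s * z].
Proof.
apply: conn_convex => _ _ t [s s1 ->] [s' s1' ->] /andP[t0 t1].
exists (s + t * (s' - s)); first by nra.
by rewrite /cr rmorphD rmorphM rmorphB /=; ring.
Qed.

Lemma ray_bigger (z : C) (M : R) : z != 0 ->
  exists2 w, (exists2 s : R, 1 <= s & w = cr s * z) & M < nrm w.
Proof.
rewrite -nrm_gt0 => z0; exists (cr (1 + `|M| / nrm z) * z).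
  by exists (1 + `|M| / nrm z) => //; rewrite lerDl divr_ge0 ?nrm_ge0.
rewrite nrmM nrm_cr ger0_norm ?addr_ge0 ?divr_ge0 ?nrm_ge0 //.
rewrite mulrDl mul1r divfK ?gt_eqF //; have := ler_norm M; lra.
Qed.

(* [outer_conn] moves through the half planes [Re (w * a^* ) > M], [|a| = 1]. *)
Let dotc (z w : C) : R := complex.Re z * complex.Re w + complex.Im z * complex.Im w.
Let H (M : R) (a : C) := [set w : C | M < dotc w a].

Local Lemma dotcD a b c : dotc (a + b) c = dotc a c + dotc b c.
Proof. by rewrite /dotc; case: a; case: b; case: c => * /=; ring. Qed.
Local Lemma dotcZ t b c : dotc (cr t * b) c = t * dotc b c.
Proof. by rewrite /dotc; case: b; case: c => * /=; ring. Qed.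
Local Lemma dotcC a b : dotc a b = dotc b a.
Proof. by rewrite /dotc; ring. Qed.

Local Lemma dotc_le w a : nrm a = 1 -> dotc w a <= nrm w.
Proof.
move=> a1; apply: (le_trans (ler_norm _)).
rewrite -(@ler_pXn2r _ 2) ?nnegrE ?nrm_ge0 // real_normK ?num_real //.
have := nrm_sqr a; rewrite a1 expr1n nrm_sqr /dotc.
case: w => x y; case: a {a1} => u v /= uv.
have -> : x ^+ 2 + y ^+ 2 = (x * u + y * v) ^+ 2 + (x * v - y * u) ^+ 2.
  by rewrite -[LHS]mulr1 uv; ring.
by rewrite lerDl sqr_ge0.
Qed.

Local Lemma H_conn M a : conn (H M a).
Proof.
apply: conn_convex => x y t; rewrite /H /= => hx hy /andP[t0 t1].
have -> : x + cr t * (y - x) = cr (1 - t) * x + cr t * y.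
  rewrite /cr rmorphB rmorph1 /=; ring.
rewrite dotcD !dotcZ.
have [->|tn0] := eqVneq t 0; first by rewrite subr0 mul1r mul0r addr0.
have tp : 0 < t by rewrite lt0r tn0.
by nra.
Qed.

(** A large multiple of [a + b] lies in both half planes: its product with either normal is a
    multiple of [1 + dotc a b], which is positive unless the normals are opposite. *)
Local Lemma H_meet M a b : nrm a = 1 -> nrm b = 1 -> dotc a b != -1 ->
  exists w, H M a w /\ H M b w.
Proof.
move=> a1 b1 ab.
have ab1 : 0 < 1 + dotc a b.
  have : - dotc a b <= nrm a.
    by rewrite -mulN1r -dotcZ (le_trans (dotc_le _ b1)) // nrmM nrm_cr normrN1 mul1r.
  by move: ab; rewrite -subr_eq0 opprK => ab h; rewrite lt0r addrC ab; lra.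
have aa : dotc a a = 1 by rewrite /dotc -!expr2 -nrm_sqr a1 expr1n.
have bb : dotc b b = 1 by rewrite /dotc -!expr2 -nrm_sqr b1 expr1n.
have key : M < (`|M| + 1) / (1 + dotc a b) * (1 + dotc a b).
  by rewrite divfK ?gt_eqF //; have := ler_norm M; lra.
exists (cr ((`|M| + 1) / (1 + dotc a b)) * (a + b)).
by rewrite /H /= !dotcZ !dotcD aa bb (dotcC b a) [dotc a b + 1]addrC.
Qed.

Lemma outer_conn (M : R) : 0 <= M -> conn [set z | M < nrm z].
Proof.
move=> M0.
pose ii : C := ('i)%C.
have ii1 : nrm ii = 1 by rewrite /nrm /= expr0n expr1n add0r sqrtr1.
have HX a : nrm a = 1 -> H M a `<=` [set z | M < nrm z].
  by move=> a1 w; rewrite /H /= => h; exact: lt_le_trans (dotc_le _ a1).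
have Hp a : nrm a = 1 -> H M a (cr (M + 1) * a).
  move=> a1; rewrite /H /= dotcZ.
  by have -> : dotc a a = 1; [rewrite /dotc -!expr2 -nrm_sqr a1 expr1n|lra].
have HU a b x : nrm a = 1 -> nrm b = 1 -> H M a x -> dotc a b != -1 ->
    exists Y, [/\ conn Y, Y `<=` [set z | M < nrm z], Y x & H M b `<=` Y].
  move=> a1 b1 ax ab; have [w [aw bw]] := H_meet M a1 b1 ab.
  exists (H M a `|` H M b); split; last by right.
  - by apply: connU aw bw; exact: H_conn.
  - by move=> v [|]; exact: HX.
  - by left.
apply: (@conn_pts _ (cr (M + 1) * ii)) => z Mz.
have z0 : 0 < nrm z by exact: le_lt_trans Mz.
pose a : C := cr (nrm z)^-1 * z.
have a1 : nrm a = 1.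
  by rewrite nrmM nrm_cr ger0_norm ?invr_ge0 ?nrm_ge0 // mulVf ?gt_eqF.
have za : z = cr (nrm z) * a.
  by rewrite /a mulrA /cr -rmorphM /= divff ?gt_eqF // rmorph1 mul1r.
have az : H M a z.
  by rewrite /H /= za dotcZ /dotc -!expr2 -nrm_sqr a1 expr1n mulr1.
(* The half planes with normals [a] and [i] meet unless [a = -i]; in that case the one with normal 1
   meets both. *)
have [ai|ai] := eqVneq (dotc a ii) (-1); last first.
  by have [Y [? ? Yz hY]] := HU _ _ _ a1 ii1 az ai; exists Y; split => //; apply/hY/Hp.
have a1' : dotc a 1 != -1.
  apply/eqP => a1'; have := nrm_sqr a; rewrite a1 expr1n.
  by move: ai a1'; case: (a) => u v; rewrite /dotc /= => ai a1'; nra.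
have i1 : dotc 1 ii != -1.
  by rewrite /dotc /= mulr0 mul0r addr0 eq_sym oppr_eq0 oner_eq0.
have [Y [cY YX Yz hY]] := HU _ _ _ a1 (nrm1 R) az a1'.
have [Z [cZ ZX Z1 hZ]] := HU _ _ _ (nrm1 R) ii1 (Hp _ (nrm1 R)) i1.
exists (Y `|` Z); split.
- by apply: connU Z1 => //; apply/hY/Hp/nrm1.
- by move=> v [/YX|/ZX].
- by right; apply/hZ/Hp.
- by left.
Qed.

(** Off the boundary of [B], membership in [B] is locally constant. This is the tool by which a set
    that avoids the boundary of a filled set is absorbed by its interior. *)
Lemma conn_bdry (X B : set C) x : conn X -> X x -> B x ->
  X `&` bdry B = set0 -> X `<=` B^°.
Proof.
move=> cX Xx Bx XB y Xy.
have nb z : X z -> ~ bdry B z by move=> Xz bz; have : (X `&` bdry B) z by []; rewrite XB.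
have intB z : X z -> B z -> B^° z.
  by move=> Xz Bz; apply: contrapT => ni; apply: (nb z Xz); split => //; exact: subset_closure.
apply: (intB) => //; apply: (cX B _ x y) => // z Xz.
have [Bz|nBz] := pselect (B z).
  have /interiorCP[e e0 h] := intB z Xz Bz; exists e => // w Xw /h Bw; by split.
have nc : ~ closure B z by move=> cz; apply: (nb z Xz); split=> // /interior_subset.
have [e e0 h] := notin_closed (@closed_closure _ B) nc.
by exists e => // w Xw /h nw; split=> // /subset_closure.
Qed.

Lemma clopen_all (U : set C) x : open U -> closed U -> U x -> U = setT.
Proof.
move=> oU cU Ux; apply/seteqP; split=> // y _.
have sb : setT `&` bdry U = set0.
  apply/seteqP; split => // z [_] [cz]; apply; apply/interiorCP.
  by have /openCP := oU; apply; rewrite (closure_id U).1.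
exact: interior_subset (conn_bdry connT I Ux sb (I : setT y)).
Qed.

Definition cc (A : set C) (x : C) : set C := connected_component A x.

Lemma cc_conn A x : conn (cc A x).
Proof. exact/connP/component_connected. Qed.
Lemma cc_sub A x : cc A x `<=` A. Proof. exact: connected_component_sub. Qed.
Lemma cc_refl A x : A x -> cc A x x.
Proof. exact: connected_component_refl. Qed.
Lemma cc_max A (Y : set C) x : conn Y -> Y x -> Y `<=` A -> Y `<=` cc A x.
Proof. by move=> /connP cY Yx YA; exact: connected_component_max. Qed.
Lemma cc_eq A x y : cc A x y -> cc A x = cc A y.
Proof. exact: same_connected_component. Qed.

Lemma cc_open A x : open A -> open (cc A x).
Proof.
move=> /openCP oA; apply/openCP => z Az; have [e e0 h] := oA z (cc_sub Az).
exists e => //; rewrite (cc_eq Az); apply: cc_max => //; first exact: conn_dsk.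
by rewrite /dsk /= subrr nrm0.
Qed.

Lemma cc_closed A x : closed A -> closed (cc A x).
Proof. exact: component_closed. Qed.

Lemma conn_cc A (Y : set C) x y : conn Y -> Y `<=` A -> Y y -> cc A x y -> Y `<=` cc A x.
Proof. by move=> cY YA Yy h; rewrite (cc_eq h); exact: cc_max. Qed.

Lemma bdry_cc A x : open A -> bdry (cc A x) `<=` ~` A.
Proof.
move=> oA z [cz ni] Az; apply: ni; apply/interiorCP.
have /openCP/(_ z Az)[e e0 h] := oA; exists e => // w zw.
have /closureCP/(_ e e0)[v Av vz] := cz.
by apply: (conn_cc (@conn_dsk z e) h _ Av).
Qed.

End Connectivity.

(** * Filled sets and relatively clopen pieces *)

Section Fill.
Variable R : realType.
Local Notation C := (Cplx R).
Implicit Types (X Y S F M T : set C).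

(* [fill X] is [X] with the bounded components of its complement filled in, so that
   [surr X Y] becomes [X `<=` fill Y] for disjoint connected sets. *)
Definition unb (T : set C) := forall M : R, exists2 z, T z & M < nrm z.

Definition fill (X : set C) : set C :=
  [set z | forall T, conn T -> unb T -> T z -> X `&` T !=set0].

Lemma unb_sub T T' : T `<=` T' -> unb T -> unb T'.
Proof. by move=> s u M; have [z /s Tz Mz] := u M; exists z. Qed.

Lemma unb_bnd T : unb T -> ~ bnd T.
Proof. by move=> u [M hM]; have [z /hM h] := u M; rewrite ltNge h. Qed.

Lemma nbnd_unb T : ~ bnd T -> unb T.
Proof.
move=> nb M; apply: contrapT => h; apply: nb; exists M => z Tz.
by rewrite leNgt; apply/negP => Mz; apply: h; exists z.
Qed.

Lemma outer_unb (M : R) : unb [set z | M < nrm z].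
Proof.
move=> N; exists (cr (`|M| + `|N| + 1)); rewrite /= nrm_cr ger0_norm ?addr_ge0 //;
  have := ler_norm M; have := ler_norm N; have := normr_ge0 M; have := normr_ge0 N; lra.
Qed.

Lemma sub_fill X : X `<=` fill X.
Proof. by move=> z Xz T _ _ Tz; exists z. Qed.

Lemma fill_trans X Y : X `<=` fill Y -> fill X `<=` fill Y.
Proof. by move=> XY z hz T cT uT Tz; have [x [/XY hx Tx]] := hz T cT uT Tz; exact: hx. Qed.

Lemma fill_mono X Y : X `<=` Y -> fill X `<=` fill Y.
Proof. by move=> XY; apply: fill_trans => z /XY /sub_fill. Qed.

Lemma fill_idem X : fill (fill X) `<=` fill X.
Proof. exact: fill_trans. Qed.

(** The ray from [z] away from the origin is connected and unbounded, and meets the disc of radius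
    [nrm z] only at [z]. At the origin the whole plane takes the place of the ray. *)
Lemma far_notin_fill X z : (forall x, X x -> nrm x <= nrm z) -> ~ X z -> ~ fill X z.
Proof.
move=> h nX hz; have [z0|z0] := eqVneq z 0.
  have [||x [Xx _]] := hz setT (@connT R) => //.
    by apply: unb_sub (outer_unb 0).
  apply: nX; have := h x Xx.
  by rewrite z0 nrm0 le_eqVlt ltNge nrm_ge0 orbF nrm_eq0 => /eqP <-.
have [||x [Xx [s s1 ex]]] := hz _ (@conn_ray R z).
- by move=> M; have [w Tw Mw] := ray_bigger M z0; exists w.
- by exists 1; rewrite // /cr rmorph1 mul1r.
have := h _ Xx; rewrite ex nrmM nrm_cr => hs.
have s0 : `|s| <= 1 by rewrite -(ler_pM2r (_ : 0 < nrm z)) ?nrm_gt0 // mul1r.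
have s1' : s = 1 by have := ler_norm s; lra.
by apply: nX; move: Xx; rewrite ex s1' /cr rmorph1 mul1r.
Qed.

Lemma fill_le X (M : R) : (forall x, X x -> nrm x <= M) ->
  forall z, fill X z -> nrm z <= M.
Proof.
move=> h z hz; rewrite leNgt; apply/negP => Mz; move: hz.
by apply: far_notin_fill => [x /h|/h]; [lra|rewrite leNgt Mz].
Qed.

Lemma fill_bnd X : bnd X -> bnd (fill X).
Proof. by move=> [M hM]; exists M; exact: fill_le. Qed.

(** An escape route [T] starting on [Y] is extended by [Y] to one starting at [z]. It has to hit
    [X], and cannot do so along [Y]. *)
Lemma fill_cross X Y z : conn Y -> Y `&` X = set0 -> Y z -> fill X z -> Y `<=` fill X.
Proof.
move=> cY YX Yz hz y Yy T cT uT Ty.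
have [||x [Xx [Yx|Tx]]] := hz (Y `|` T) (@connU R _ _ _ cY cT Yy Ty).
- by apply: unb_sub uT => w; right.
- by left.
- by have : (Y `&` X) x by []; rewrite YX.
- by exists x.
Qed.

Lemma dsk_center (z : C) (e : R) : 0 < e -> dsk z e z.
Proof. by move=> e0; rewrite /dsk /= subrr nrm0. Qed.

Lemma dsk_disj X z (e : R) : dsk z e `<=` ~` X -> dsk z e `&` X = set0.
Proof. by move=> h; apply/seteqP; split => // w [/h]. Qed.

Lemma fill_open X : closed X -> open (fill X `\` X).
Proof.
move=> cX; apply/openCP => z [fz nz]; have [e e0 h] := notin_closed cX nz.
exists e => // w zw; split; last exact: h.
exact: (fill_cross (@conn_dsk _ z e) (dsk_disj h) (dsk_center z e0) fz).
Qed.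

Lemma fill_closed X : closed X -> closed (fill X).
Proof.
move=> cX; rewrite -[fill X]setCK; apply: open_closedC; apply/openCP => z nz.
have nX : ~ X z by move/sub_fill.
have [e e0 h] := notin_closed cX nX; exists e => // w zw fw; apply: nz.
exact: (fill_cross (@conn_dsk _ z e) (dsk_disj h) zw fw (dsk_center z e0)).
Qed.

Lemma fill_cpt X : cpt X -> cpt (fill X).
Proof. by move=> [cX bX]; split; [exact: fill_closed|exact: fill_bnd]. Qed.

Lemma fill_bdry X : closed X -> bdry (fill X) `<=` X.
Proof.
move=> cX z [cz ni]; apply: contrapT => nX; apply: ni.
have fz : fill X z by move: cz; rewrite -(closure_id _).1 //; exact: fill_closed.
have /openCP/(_ z)[|e e0 h] := fill_open cX; first by [].
by apply/interiorCP; exists e => // w /h[].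
Qed.

(** If neither set lies in the other's filling, each misses the other's filling by [fill_cross]. The
    intersection of the fillings is then open as well as closed, contains [z] and is bounded, which
    is impossible in the plane. *)
Lemma fill_nest X Y z : cpt X -> cpt Y -> conn X -> conn Y -> X `&` Y = set0 ->
  fill X z -> fill Y z -> X `<=` fill Y \/ Y `<=` fill X.
Proof.
move=> cX cY kX kY XY fX fY.
have [h|nX] := pselect (X `<=` fill Y); first by left.
have [h|nY] := pselect (Y `<=` fill X); first by right.
have YX : Y `&` X = set0 by rewrite setIC.
have X0 : X `&` fill Y = set0.
  apply/seteqP; split => // x [Xx fx]; apply: nX; exact: (fill_cross kX XY Xx fx).
have Y0 : Y `&` fill X = set0.
  apply/seteqP; split => // x [Xx fx]; apply: nY; exact: (fill_cross kY YX Xx fx).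
pose I := fill X `&` fill Y.
have oI : open I.
  have -> : I = (fill X `\` X) `&` (fill Y `\` Y).
    apply/seteqP; split => w [h1 h2]; split; try by case: h1; case: h2.
      by split => // Xw; have : (X `&` fill Y) w by []; rewrite X0.
    by split => // Yw; have : (Y `&` fill X) w by []; rewrite Y0.
  by apply: openI; apply: fill_open; [case: cX|case: cY].
have cI : closed I by apply: closedI; apply: fill_closed; [case: cX|case: cY].
have IT : I = setT by apply: (clopen_all oI cI (x := z)).
have [M hM] := fill_bnd cX.2; have [w _ Mw] := outer_unb 0 M.
have [/hM h _] : I w by rewrite IT.
by move: Mw h; rewrite ltNge => /negP.
Qed.

(** A point of the union farthest from the origin is not in the filling of the set that does not
    contain it. *)
Lemma fill_antisym X Y : cpt X -> cpt Y -> X !=set0 -> X `&` Y = set0 ->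
  X `<=` fill Y -> Y `<=` fill X -> False.
Proof.
move=> cX cY [a Xa] XY h1 h2.
have [|z XYz hz] := cpt_max (cptU cX cY) (f := fun z => nrm (z - 0)) _ (@cont_nrmB _ _ 0).
  by exists a; left.
have {}hz w : (X `|` Y) w -> nrm w <= nrm z by move=> /hz; rewrite !subr0.
case: XYz => Wz.
  apply: (@far_notin_fill Y z) (h1 z Wz) => [x Yx|Yz]; first by apply: hz; right.
  by have : (X `&` Y) z by []; rewrite XY.
apply: (@far_notin_fill X z) (h2 z Wz) => [x Yx|Yz]; first by apply: hz; left.
by have : (X `&` Y) z by []; rewrite XY.
Qed.

Lemma bounded_setP X : bounded_set X <-> bnd X.
Proof.
split.
  move=> [M [/complex_realP[m mE] h]]; exists (m + 1) => z Xz.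
  rewrite -cr_le -nrmE; apply: (h (cr (m + 1))) => //.
  by rewrite mE cr_lt; lra.
move=> [M hM]; exists (cr M); split; first by apply/complex_realP; exists M.
by move=> x Mx z /hM zM; apply/ltW; apply: le_lt_trans Mx; rewrite -[leLHS]/(cr (nrm z)) cr_le.
Qed.

Lemma surr_fill X Y : surr X Y -> X = Y \/ X `<=` fill Y.
Proof.
case=> [->|[B [[b nYb ->] /bounded_setP bB XB]]]; [by left|right].
move=> x /XB Bx T cT uT Tx; apply: contrapT => h; apply: (unb_bnd uT).
apply: bnd_sub bB; apply: (conn_cc cT _ Tx Bx) => w Tw Yw; apply: h; by exists w.
Qed.

Lemma fill_cc_bnd Y z : bnd Y -> ~ Y z -> fill Y z -> cc (~` Y) z `<=` fill Y.
Proof.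
move=> bY nz fz; apply: (fill_cross (@cc_conn _ _ _) _ _ fz); last exact: cc_refl.
by apply/seteqP; split => // w [/cc_sub].
Qed.

Lemma fill_surr X Y : conn X -> X !=set0 -> X `&` Y = set0 -> bnd Y ->
  X `<=` fill Y -> surr X Y.
Proof.
move=> cX [x Xx] XY bY XfY; right; exists (cc (~` Y) x).
have nY : X `<=` ~` Y by move=> w Xw Yw; have : (X `&` Y) w by []; rewrite XY.
split; first by exists x => //; exact: nY.
  apply/bounded_setP; apply: bnd_sub (fill_bnd bY); apply: fill_cc_bnd => //.
    exact: nY.
  exact: XfY.
exact: cc_max.
Qed.

Lemma conn_cptP X : cpt X ->
  (forall A B, cpt A -> cpt B -> A `&` B = set0 -> X = A `|` B ->
     A !=set0 -> B !=set0 -> False) -> conn X.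
Proof.
move=> [cX bX] h P lP x y Xx Xy Px; apply: contrapT => nPy.
have key (Q : C -> Prop) : (forall z, X z -> exists2 e : R, 0 < e &
     forall w, X w -> nrm (w - z) < e -> (Q z <-> Q w)) -> cpt [set z | X z /\ Q z].
  move=> lQ; split; last by apply: bnd_sub bX => z [].
  apply/closedCP => z hz.
  have Xz : X z by move/closedCP: cX; apply=> e /hz[w [? _] ?]; exists w.
  by split=> //; have [e e0 he] := lQ z Xz; have [w [Xw Qw] wz] := hz e e0; apply/(he w).
apply: (h _ _ (key P lP) (key (fun z => ~ P z) _)).
- move=> z Xz; have [e e0 he] := lP z Xz; exists e => // w Xw wz.
  by have := he w Xw wz; tauto.
- by apply/seteqP; split => // z [[_ ?] [_ ?]].
- apply/seteqP; split => z; last by move=> [[]|[]].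
  by move=> Xz; have [?|?] := pselect (P z); [left|right].
- by exists x.
- by exists y.
Qed.

Lemma cpt_nested (K : nat -> set C) : cpt (K 0%N) -> (forall n, closed (K n)) ->
  (forall n, K n.+1 `<=` K n) -> (forall n, K n !=set0) -> exists z, forall n, K n z.
Proof.
move=> c0 cK dK nK.
have le m n : (m <= n)%N -> K n `<=` K m.
  by move/subnK => <-; elim: (n - m)%N => [|k IH] //; rewrite addSn => z /dK /IH.
have [u hu] := choice nK.
have [l _ hl] := cpt_seq c0 (fun n => le _ _ (leq0n n) _ (hu n)).
exists l => n; have /closedCP := cK n; apply=> e e0.
by have [m nm h] := hl e e0 n; exists (u m) => //; exact: (le _ _ nm).
Qed.

(** If the intersection splits into [A] and [B] at distance [d], every [K n] crosses the boundary of
    the [d / 2]-neighbourhood of [A]. By compactness some point of that boundary belongs to the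
    intersection, although it is neither in [A] nor in [B]. *)
Lemma conn_nested (K : nat -> set C) : (forall n, cpt (K n)) ->
  (forall n, K n.+1 `<=` K n) -> (forall n, conn (K n)) ->
  conn [set z | forall n, K n z].
Proof.
move=> cK dK kK; apply: conn_cptP.
  split; last by apply: bnd_sub (cK 0%N).2 => z.
  apply/closedCP => z hz n; have /closedCP := (cK n).1; apply=> e /hz[w hw ?].
  by exists w.
move=> A B cA cB AB E [a Aa] [b Bb].
have inK c : (A `|` B) c -> forall n, K n c by move=> h; have : [set z | forall n, K n z] c by rewrite E.
have [d d0 hd] := cpt_sep cA cB AB.
pose N := [set z : C | exists2 a, A a & nrm (z - a) < d / 2].
have oN : open N.
  apply/openCP => z [a' Aa' h]; exists (d / 2 - nrm (z - a')); first by lra.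
  by move=> w; rewrite /dsk /= => wz; exists a' => //; have := nrm_tri w z a'; lra.
have nNB : forall z, B z -> ~ closure N z.
  move=> z Bz /closureCP/(_ (d / 2))[|w [a' Aa' h] wz]; first by lra.
  have := hd _ _ Aa' Bz; have := nrm_tri a' w z; move: h; rewrite (nrmB w a'); lra.
pose L n := K n `&` bdry N.
have [z hz] : exists z, forall n, L n z.
  apply: cpt_nested => [|n|n z [/dK]|n] //.
  - apply: (cpt_closed_sub (B := K 0%N)) (cK 0%N) => [z []//|].
    by apply: closedI; [case: (cK 0%N)|exact: bdry_closed].
  - by apply: closedI; [case: (cK n)|exact: bdry_closed].
  apply: contrapT => h.
  have KN : K n `&` bdry N = set0.
    by apply/seteqP; split=> // z hz; apply: h; exists z.
  have Na : N a by exists a => //; rewrite subrr nrm0; lra.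
  have /(_ b) := conn_bdry (kK n) (inK a (or_introl Aa) n) Na KN.
  move=> /(_ (inK b (or_intror Bb) n)) /interior_subset /(@subset_closure _ N).
  exact: nNB.
have : (A `|` B) z by rewrite -E => n; case: (hz n).
case=> [Az|Bz]; last by case: (hz 0%N) => _ [/(nNB _ Bz)].
have [_ [_ ni]] := hz 0%N; apply: ni; apply/interiorCP.
have /openCP := oN; apply; exists z => //; rewrite subrr nrm0; lra.
Qed.

Inductive chain S (e : R) (x : C) : C -> Prop :=
| chain_refl : chain S e x x
| chain_step y z : chain S e x y -> S z -> nrm (z - y) < e -> chain S e x z.

Lemma chain_mono S (e e' : R) x y : e <= e' -> chain S e x y -> chain S e' x y.
Proof.
move=> ee; elim=> [|y' z _ IH Sz h]; first exact: chain_refl.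
by apply: chain_step IH Sz _; exact: lt_le_trans ee.
Qed.

Lemma chain_in S (e : R) x y : S x -> chain S e x y -> S y.
Proof. by move=> Sx; case. Qed.

Lemma chain_exit S (e : R) x y (N : set C) : chain S e x y -> N x -> ~ N y ->
  exists y1 y2, [/\ N y1, ~ N y2, chain S e x y2 & nrm (y2 - y1) < e].
Proof.
elim=> [//|y' z c IH Sz h Nx nz]; have [Ny|/(IH Nx)//] := pselect (N y').
by exists y', z; split=> //; exact: chain_step h.
Qed.

Lemma chain_closed S (e : R) x z : 0 < e -> S z ->
  (forall d : R, 0 < d -> exists2 w, chain S e x w & nrm (w - z) < d) -> chain S e x z.
Proof.
move=> e0 Sz h; have [w cw wz] := h e e0.
by apply: chain_step cw Sz _; rewrite nrmB.
Qed.

(** For closed [S] this says that [F] is relatively clopen, expressed by two closed sets of the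
    plane. *)
Definition clo S F := [/\ F `<=` S, closed F & closed (S `\` F)].

Lemma clo_loc S F x : clo S F -> F x ->
  exists2 e : R, 0 < e & forall w, S w -> nrm (w - x) < e -> F w.
Proof.
move=> [FS cF cG] Fx; have [|e e0 h] := notin_closed cG (z := x); first by case.
exists e => // w Sw wx; apply: contrapT => nF; exact: (h w).
Qed.

Lemma clo_conn S F Y x : clo S F -> conn Y -> Y `<=` S -> Y x -> F x -> Y `<=` F.
Proof.
move=> cF cY YS Yx Fx y Yy; have [FS clF clG] := cF.
apply: (cY F _ x y) => // z Yz; have [Fz|nF] := pselect (F z).
  have [e e0 h] := clo_loc cF Fz; exists e => // w /YS Sw /(h w Sw); by split.
have [e e0 h] := notin_closed clF nF; exists e => // w _ /h; by split.
Qed.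

Lemma clo_compl S F : clo S F -> clo S (S `\` F).
Proof.
move=> [FS cF cG]; split => //.
suff -> : S `\` (S `\` F) = F by [].
apply/seteqP; split => x; last by move=> Fx; split; [exact: FS|move=> [_ nF]; exact: nF].
by move=> [Sx h]; apply: contrapT => nF; exact: h.
Qed.

Lemma chain_clo S (e : R) x : closed S -> S x -> 0 < e -> clo S [set y | chain S e x y].
Proof.
move=> cS Sx e0; split => [y||].
- exact: chain_in.
- apply/closedCP => z h; apply: chain_closed => //.
  apply: ((closedCP S).1 cS) => d /h[w cw ?]; exists w => //; exact: (chain_in Sx cw).
apply/closedCP => z h.
have Sz : S z by apply: ((closedCP S).1 cS) => d /h[w [Sw _] ?]; exists w.
split=> // cz; have [w [Sw nw] wz] := h e e0; apply: nw; exact: chain_step wz.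
Qed.

Lemma cc_cpt S x : cpt S -> cpt (cc S x).
Proof.
move=> cS; by apply: (cpt_closed_sub (@cc_sub _ S x) _ cS); apply: cc_closed; case: cS.
Qed.

(** In a compact set quasi-components are components. The points reachable from [x] by chains of
    every step size form a connected set [Q], hence lie in the component; as [K] misses it,
    compactness gives one step size whose chains already miss [K]. *)
Lemma sep_clopen S x K : cpt S -> S x -> cpt K -> K `&` cc S x = set0 ->
  exists F, [/\ clo S F, cc S x `<=` F & F `&` K = set0].
Proof.
move=> cS Sx cK KM.
pose F n := [set y | chain S n.+1%:R^-1 x y].
have n0 n : 0 < n.+1%:R^-1 :> R by rewrite invr_gt0 ltr0Sn.
have cF n : clo S (F n) by apply: chain_clo => //; exact: cS.1.
have Fle m n : (m <= n)%N -> F n `<=` F m.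
  move=> mn y; apply: chain_mono; rewrite lef_pV2 ?posrE ?ltr0Sn // ler_nat //.
pose Q := [set y | forall n, F n y].
have cQ : cpt Q.
  apply: (cpt_closed_sub (B := S)) cS => [y /(_ 0%N)|]; first by case: (cF 0%N) => h _ _ /h.
  apply/closedCP => z hz n; have [_ /closedCP cl _] := cF n; apply: cl => e /hz[w Qw ?].
  by exists w.
have kQ : conn Q.
  apply: conn_cptP => // A B.
  wlog Ax : A B / A x => [hw cA cB AB E a b|].
    have : (A `|` B) x by rewrite -E => n; exact: chain_refl.
    case=> [Ax|Bx]; first exact: (hw A B).
    by apply: (hw B A) => //; rewrite 1?setIC // setUC.
  move=> cA cB AB E _ [b Bb].
  have [d d0 hd] := cpt_sep cA cB AB.
  pose N := [set z : C | exists2 a, A a & nrm (z - a) < d / 2].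
  have Nx : N x by exists x => //; rewrite subrr nrm0; lra.
  have nNb : ~ N b.
    by move=> [a Aa h]; have := hd a b Aa Bb; rewrite nrmB; lra.
  have Qb : Q b by rewrite E; right.
  (* [u n] is the first point at which a chain of step [n.+1%:R^-1] leaves the neighbourhood [N] of
     [A]. A cluster point of these exits lies in [Q], but is too far from [A] to be in [A] and too
     close to be in [B]. *)
  have /choice[u hu] : forall n, exists y2, exists y1,
      [/\ N y1, ~ N y2, F n y2 & nrm (y2 - y1) < n.+1%:R^-1].
    by move=> n; have [y1 [y2 [? ? ? ?]]] := chain_exit (Qb n) Nx nNb; exists y2, y1.
  have [l Sl hl] := cpt_seq cS (fun n => chain_in Sx (let: ex_intro _ (And4 _ _ h _) := hu n in h)).
  have Ql : Q l.
    move=> n; have [_ /closedCP cl _] := cF n; apply: cl => e e0.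
    have [m nm h] := hl e e0 n; exists (u m) => //; apply: (Fle _ _ nm).
    by have [? []] := hu m.
  move: Ql; rewrite E => -[Al|Bl].
    have [|m _ h] := hl (d / 2) _ 0%N; first by lra.
    by have [y1 [_ nN _ _]] := hu m; apply: nN; exists l.
  have d4 : 0 < d / 4 by lra.
  have [k hk] := inv_small d4; have [m km h] := hl _ d4 k.
  have [y1 [[a Aa h1] _ _ h2]] := hu m; have h3 := hk m km; have h4 := hd a l Aa Bl.
  have h5 := nrm_tri a y1 l; have h6 := nrm_tri y1 (u m) l.
  rewrite (nrmB a y1) in h5; rewrite (nrmB y1 (u m)) in h6.
  by clear E AB KM; move: (m.+1%:R^-1 : R) h2 h3 => t h2 h3; lra.
have Qx : Q x by move=> n; exact: chain_refl.
have QM : Q `<=` cc S x by apply: cc_max => // y /(_ 0%N); case: (cF 0%N) => h _ _ /h.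
suff [n hn] : exists n, F n `&` K = set0.
  exists (F n); split => //; apply: (clo_conn (cF n) (@cc_conn _ S x)).
  - exact: cc_sub.
  - exact: cc_refl.
  - exact: chain_refl.
apply: contrapT => h.
have [z hz] : exists z, forall n, (F n `&` K) z.
  apply: cpt_nested => [|n|n z [h1 h2]|n].
  - apply: (cpt_closed_sub (B := K)) => //.
    by apply: closedI; [case: (cF 0%N)|case: cK].
  - by apply: closedI; [case: (cF n)|case: cK].
  - by split=> //; apply: Fle h1.
  - by apply: contrapT => h'; apply: h; exists n; apply/seteqP; split => // w hw; apply: h'; exists w.
have : (K `&` cc S x) z by split; [case: (hz 0%N)|apply: QM => n; case: (hz n)].
by rewrite KM.
Qed.

(** [sep_clopen] needs a compact set to avoid, and the open component of the complement is not one.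
    Joining [z] to [v] inside it by a compact connected [T] makes the separation possible. *)
Lemma link S x z v : cpt S -> S x -> cc (~` cc S x) z v ->
  exists F T, [/\ clo S F, cc S x `<=` F, conn T, T z /\ T v & T `&` F = set0].
Proof.
move=> cS Sx hv; set M := cc S x.
have zz : cc (~` M) z z by rewrite {1}(cc_eq hv); exact: connected_component_sym.
pose P v := exists T, [/\ conn T, cpt T, T z, T v & T `&` M = set0].
have [T [kT cT Tz Tv TM]] : P v.
  apply: (@cc_conn _ (~` M) z P _ z v zz hv) => [w hw|]; last first.
    have zE w : nrm (w - z) <= 0 -> w = z.
      by rewrite le_eqVlt ltNge nrm_ge0 orbF nrm_eq0 subr_eq0 => /eqP.
    have z0 : nrm (z - z) <= 0 by rewrite subrr nrm0.
    exists [set w | nrm (w - z) <= 0]; split=> //; first exact: conn_closed_dsk.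
      exact: closed_dsk_cpt.
    by apply/seteqP; split => // w [/zE -> /(cc_sub zz)].
  have oW : open (cc (~` M) z).
    by apply: cc_open; apply: closed_openC; case: (cc_cpt x cS).
  have /openCP/(_ w hw)[e e0 he] := oW; exists (e / 2); first by lra.
  have st w1 w2 : nrm (w1 - w) < e / 2 -> nrm (w2 - w) < e / 2 -> P w1 -> P w2.
    move=> h1 h2 [T [kT cT Tz Tw TM]]; exists (T `|` [set y | nrm (y - w) <= e / 2]).
    split; [|exact: cptU (closed_dsk_cpt _ _)|by left|by right; exact: ltW|].
      by apply: (connU kT (@conn_closed_dsk R _ _) Tw); exact: ltW.
    apply/seteqP; split => // y [[Ty|/= yw] My].
      by have : (T `&` M) y by []; rewrite TM.
    have /cc_sub : cc (~` M) z y by apply: he; rewrite /dsk /=; lra.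
    exact.
  have w0 : nrm (w - w) < e / 2 by rewrite subrr nrm0; lra.
  by move=> w' _ h'; split; exact: st.
have [F [cF MF FK]] := sep_clopen cS Sx cT TM.
by exists F, T; split=> //; rewrite setIC.
Qed.

(** An escape route from [z] is cut at a point outside a disc containing [S]. Its inner part is
    replaced by the compact set from [link], which avoids a clopen [F]; outside the disc nothing can
    block it. *)
Lemma fill_clopen S x z : cpt S -> S x -> ~ fill (cc S x) z ->
  exists F, [/\ clo S F, cc S x `<=` F & ~ fill F z].
Proof.
move=> cS Sx nz.
have [T [kT uT Tz TM]] : exists T, [/\ conn T, unb T, T z & T `&` cc S x = set0].
  apply: contrapT => h; apply: nz => T kT uT Tz; apply: contrapT => h'; apply: h.
  exists T; split=> //; apply/seteqP; split => // w [Tw Mw]; apply: h'; by exists w.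
have [M M0 hM] := cpt_bigdsk cS.2; have [v Tv Mv] := uT M.
have [|F [L [cF MF kL [Lz Lv] LF]]] := link cS Sx (z := z) (v := v).
  apply: (cc_max kT Tz _ Tv) => w Tw Mw.
  by have : (T `&` cc S x) w by []; rewrite TM.
exists F; split => // fz.
have kU : conn (L `|` [set w | M < nrm w]) by apply: connU kL (@outer_conn R _ (ltW M0)) Lv Mv.
have [||w [Fw [Lw|Mw]]] := fz _ kU.
- by apply: unb_sub (outer_unb M) => w; right.
- by left.
- by have : (L `&` F) w by []; rewrite LF.
have [FS _ _] := cF; have := hM w (FS w Fw); move: Mw => /=; lra.
Qed.

Lemma dense_clo S F (XX : set (set C)) x : clo S F -> F x ->
  (forall X, XX X -> conn X /\ X `<=` S) -> S `<=` closure (\bigcup_(X in XX) X) ->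
  exists2 X, XX X & X `<=` F /\ X !=set0.
Proof.
move=> cF Fx hX dX; have [FS _ _] := cF; have [e e0 he] := clo_loc cF Fx.
have /closureCP/(_ e e0)[w [X XX_ Xw] wx] := dX x (FS x Fx).
have [kX XS] := hX X XX_; exists X => //; split; last by exists w.
by apply: (clo_conn cF kX XS Xw); apply: he => //; exact: XS.
Qed.

(** If [z] escaped from the component, it would escape from a clopen piece around it. That piece
    contains one of the dense connected sets, and this set surrounds [z]. *)
Lemma comp_fill S (XX : set (set C)) x z : cpt S -> S x ->
  (forall X, XX X -> [/\ conn X, X `<=` S & fill X z]) ->
  S `<=` closure (\bigcup_(X in XX) X) -> fill (cc S x) z.
Proof.
move=> cS Sx hX dX; apply: contrapT => nz.
have [F [cF MF nF]] := fill_clopen cS Sx nz.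
have [|X XX_ [XF _]] := dense_clo (XX := XX) cF (MF x (cc_refl Sx)) _ dX.
  by move=> X /hX[].
by apply: nF; apply: (fill_mono XF); case: (hX X XX_).
Qed.

End Fill.

(** * Unicoherence of the plane *)

Section Unicoherence.
Variable R : realType.
Local Notation C := (Cplx R).

Lemma even_small (k : int) : `|2 * k%:~R| < 1 :> R -> k = 0.
Proof.
rewrite normrM ger0_norm // => h; apply/eqP; rewrite -absz_eq0 -leqn0 -ltnS -(ltr_nat R).
by rewrite natr_absz intr_norm; lra.
Qed.

Lemma cpt_lipschitz_sep (P Q : set C) (d : R) : P !=set0 -> 0 < d ->
  (forall p q, P p -> Q q -> d <= nrm (p - q)) ->
  exists v : C -> R, [/\ forall z, 0 <= v z <= 1, forall z, P z -> v z = 0,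
    forall z, Q z -> v z = 1 & forall z w, `|v z - v w| <= nrm (z - w) / d].
Proof.
move=> [p0 Pp0] d0 hd.
pose g z := inf [set nrm (z - p) | p in P].
have lb z : has_lbound [set nrm (z - p) | p in P].
  by exists 0 => _ [p _ <-]; exact: nrm_ge0.
have ge z (m : R) : (forall p, P p -> m <= nrm (z - p)) -> m <= g z.
  by move=> h; apply: lb_le_inf => [|_ [p Pp <-]]; [exists (nrm (z - p0)), p0|exact: h].
have le z p : P p -> g z <= nrm (z - p) by move=> Pp; apply: ge_inf => //; exists p.
have lip z w : g z <= g w + nrm (z - w).
  rewrite -lerBlDr; apply: ge => p Pp; have := le z p Pp; have := nrm_tri z w p; lra.
have g0 z : 0 <= g z by apply: ge => p _; exact: nrm_ge0.
exists (fun z => Num.min 1 (g z / d)); split=> [z|z Pz|z Qz|z w].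
- by rewrite le_min ler01 divr_ge0 ?(ltW d0) //= ge_min lexx.
- have -> : g z = 0; last by rewrite mul0r min_r.
  by apply/eqP; rewrite eq_le g0 andbT; have := le z z Pz; rewrite subrr nrm0.
- by rewrite min_l // ler_pdivlMr // mul1r; apply: ge => p Pp; rewrite nrmB hd.
have h1 := lip z w; have := lip w z; rewrite (nrmB w z) => h2.
have e1 : g z / d <= g w / d + nrm (z - w) / d by rewrite -mulrDl; apply: ler_wpM2r => //; rewrite invr_ge0 ltW.
have e2 : g w / d <= g z / d + nrm (z - w) / d by rewrite -mulrDl; apply: ler_wpM2r => //; rewrite invr_ge0 ltW.
have n0 : 0 <= nrm (z - w) / d by rewrite divr_ge0 ?nrm_ge0 ?ltW.
move: (g z / d) (g w / d) (_ / d) e1 e2 n0 => x y n e1 e2 n0.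
by rewrite ler_norml /Num.min; do 2 case: ltP => ?; apply/andP; split; lra.
Qed.

(** The formula is the radial retraction onto the closed disc of radius [r]: the maximum makes the
    factor 1 inside the disc. The constant 2 is crude but sufficient. *)
Lemma retract_lipschitz (r : R) (z w : C) : 0 < r ->
  nrm (cr (r / Num.max r (nrm w)) * w - cr (r / Num.max r (nrm z)) * z)
    <= 2 * nrm (w - z).
Proof.
move=> r0; set a := Num.max r (nrm w); set b := Num.max r (nrm z).
have a0 : r <= a by rewrite le_max lexx.
have b0 : r <= b by rewrite le_max lexx.
have zb : nrm z <= b by rewrite le_max lexx orbT.
have -> : cr (r / a) * w - cr (r / b) * z =
    cr (r / a) * (w - z) + cr (r / a - r / b) * z.
  by rewrite /cr rmorphB /=; ring.
apply: (le_trans (nrmD _ _)); rewrite !nrmM !nrm_cr.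
have ab : `|a - b| <= nrm (w - z).
  have h1 := nrm_sub w z; have := nrm_sub z w; rewrite nrmB => h2.
  have h3 := nrm_ge0 (w - z).
  by rewrite ler_norml /a /b /Num.max; do 2 case: ltP => ?; apply/andP; split; lra.
have ra : `|r / a| <= 1.
  rewrite ger0_norm ?divr_ge0 //; try lra.
  by rewrite ler_pdivrMr; lra.
have -> : r / a - r / b = r / a * ((b - a) / b).
  by field; rewrite !gt_eqF //; lra.
have ba : `|(b - a) / b| * nrm z <= nrm (w - z).
  rewrite normrM normfV (ger0_norm (_ : 0 <= b)); last by lra.
  rewrite distrC mulrAC ler_pdivrMr; last by lra.
  by have := nrm_ge0 z; have := normr_ge0 (a - b); have := nrm_ge0 (w - z); nra.
rewrite (normrM (r / a)) -mulrA.
have n0 := nrm_ge0 (w - z); have y0 := normr_ge0 (r / a).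
have x0 : 0 <= `|(b - a) / b| * nrm z by rewrite mulr_ge0 ?nrm_ge0.
have l1 := ler_piMl n0 ra; have l2 := ler_piMl x0 ra; lra.
Qed.

(** Suppose the intersection splits into [P] and [Q], and let [v] be 0 on [P] and 1 on [Q]. The
    function equal to [v] on [A] and to [- v] elsewhere is continuous modulo 2, since 1 and -1 agree
    there. On a disc it lifts to a real function; the lift minus [v] is constant on [A], the lift
    plus [v] is constant on [B], and comparing [p] with [q] gives 0 = 1. *)
Lemma unicoherent (A B : set C) : cpt A -> conn A -> closed B -> conn B ->
  A `|` B = setT -> conn (A `&` B).
Proof.
move=> cA kA cB kB AB; have cI : cpt (A `&` B).
  by apply: (cpt_closed_sub _ _ cA) => [z []//|]; apply: closedI => //; case: cA.
apply: conn_cptP => // P Q cP cQ PQ E [p Pp] [q Qq].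
have [d d0 hd] := cpt_sep cP cQ PQ.
have [v [v01 vP vQ lv]] := cpt_lipschitz_sep (ex_intro _ p Pp) d0 hd.
have [r r0 hr] := cpt_bigdsk cA.2.
(* The lift exists on the disc only, so [B] is cut down to it. The cut set is the image of [B] under
   the radial retraction, because the circle itself lies in [B]. *)
pose B' := B `&` [set z | nrm z <= r].
have nAB z : ~ A z -> B z by move=> nA; have : (A `|` B) z by [rewrite AB]; case.
have kB' : conn B'.
  pose f z := cr (r / Num.max r (nrm z)) * z.
  have fin z : nrm z <= r -> f z = z.
    by move=> h; rewrite /f max_l // divff ?gt_eqF // /cr rmorph1 mul1r.
  have fout z : r < nrm z -> nrm (f z) = r.
    move=> h; rewrite /f max_r ?ltW // nrmM nrm_cr ger0_norm ?divr_ge0 ?nrm_ge0 //; last exact: ltW.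
    by rewrite divfK // gt_eqF // (lt_trans r0).
  have <- : f @` B = B'.
    apply/seteqP; split => [_ [z Bz <-]|z [Bz /= zr]]; last by exists z => //; exact: fin.
    have [zr|zr] := leP (nrm z) r; first by rewrite fin.
    split; rewrite /= ?fout //; apply: nAB => /hr; rewrite fout // ltxx //.
  apply: conn_image kB => z _ e e0; exists (e / 2) => [|w _ wz]; first by lra.
  by apply: (le_lt_trans (retract_lipschitz _ _ r0)); lra.
pose f z := if `[< A z >] then v z else - v z.
(* [wr] reduces a difference of values of [f], which lies between -2 and 2, modulo 2 to the
   representative of least modulus. *)
pose wr (x : R) : R := if 1 < x then x - 2 else if x < -1 then x + 2 else x.
have wrE x : exists k : int, wr x = x + 2 * k%:~R.
  rewrite /wr; case: ifP => _; first by exists (-1); rewrite mulrN1z; ring.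
  by case: ifP => _; [exists 1|exists 0]; rewrite ?mulr1z ?mulr0z; ring.
have wrI x : `|x| < 1 / 4 \/ 7 / 4 < x <= 2 \/ 7 / 4 < - x <= 2 -> `|wr x| < 1 / 4.
  rewrite !ltr_norml /wr => hx; case: (ltP 1 x) => h1; last case: (ltP x (-1)) => h2;
    apply/andP; case: hx => [/andP[]|[/andP[]|/andP[]]] => u w; split; lra.
pose dl z w := wr (f w - f z).
pose eta := d / 8.
have eta0 : 0 < eta by rewrite /eta; lra.
have etad (x : R) : x < eta -> x / d < 1 / 8.
  by move=> xe; rewrite ltr_pdivrMr // mulrC; move: xe; rewrite /eta; lra.
have vz z w : nrm (z - w) < eta -> `|v z - v w| < 1 / 8.
  by move=> /etad; apply: le_lt_trans.
(* Between close points on different sides of [A] there is a point of the intersection, where [v] is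
   0 or 1. Hence [v z + v w] is close to 0 or to 2, that is, to 0 modulo 2. *)
have mid z w : A z -> ~ A w -> nrm (z - w) < eta ->
    exists2 y, A y /\ B y & nrm (z - y) < eta /\ nrm (w - y) < eta.
  move=> Az nAw zw.
  pose S := [set y | exists2 t : R, 0 <= t <= 1 & y = z + cr t * (w - z)].
  have [[y [[t /andP[t0 t1] ey] [cy ni]]]|no] := pselect (S `&` bdry A !=set0).
    exists y; first split.
    - by move: cy; rewrite -(closure_id A).1 //; case: cA.
    - rewrite (closure_id B).1 //; apply/closureCP => e e0; apply: contrapT => h.
      apply: ni; apply/interiorCP; exists e => // x xy; apply: contrapT => nAx.
      by apply: h; exists x => //; exact: nAB.
    have e1 : nrm (z - y) = t * nrm (z - w).
      have -> : z - y = cr t * (z - w) by rewrite ey; ring.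
      by rewrite nrmM nrm_cr ger0_norm.
    have e2 : nrm (w - y) = (1 - t) * nrm (z - w).
      have -> : w - y = cr (1 - t) * (w - z).
        by rewrite ey /cr rmorphB rmorph1 /=; ring.
      by rewrite nrmM nrm_cr ger0_norm ?subr_ge0 // nrmB.
    by rewrite e1 e2; have := nrm_ge0 (z - w); split; nra.
  have S0 : S `&` bdry A = set0 by apply/seteqP; split => // y hy; apply: no; exists y.
  exfalso; apply: nAw; apply: (@interior_subset _ A).
  apply: (conn_bdry (@conn_segment _ z w) _ Az S0).
    by exists 0; rewrite ?lexx ?ler01 // /cr rmorph0 mul0r addr0.
  by exists 1; rewrite ?lexx ?ler01 // /cr rmorph1 mul1r addrC subrK.
have dl_small z w : nrm (z - w) < eta -> `|dl z w| < 1 / 4.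
  have opp (x y : C) : A x -> ~ A y -> nrm (x - y) < eta ->
      v x + v y < 1 / 4 \/ 2 - 1 / 4 < v x + v y <= 2.
    move=> Ax nAy /(mid _ _ Ax nAy)[m [Am Bm] [/vz hx /vz hy]].
    have /andP[_ x1] := v01 x; have /andP[_ y1] := v01 y.
    move: hx hy; rewrite !ltr_norml => /andP[hx1 hx2] /andP[hy1 hy2].
    have : (P `|` Q) m by rewrite -E.
    case=> [/vP m0|/vQ m0]; rewrite m0 in hx1 hx2 hy1 hy2; [left|right; apply/andP; split]; lra.
  move=> zw; rewrite /dl /f; apply: wrI; have := vz _ _ zw.
  case: asboolP => [Aw|nAw]; case: asboolP => [Az|nAz]; rewrite !ltr_norml => /andP[h1 h2].
  - by left; apply/andP; split; lra.
  - have := opp _ _ Aw nAz; rewrite nrmB => /(_ zw) [h|/andP[h h']].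
      by left; have /andP[? _] := v01 z; have /andP[? _] := v01 w; apply/andP; split; lra.
    by right; left; apply/andP; split; lra.
  - have [h|/andP[h h']] := opp _ _ Az nAw zw.
      by left; have /andP[? _] := v01 z; have /andP[? _] := v01 w; apply/andP; split; lra.
    by right; right; apply/andP; split; lra.
  - by left; apply/andP; split; lra.
(* The defect of additivity is an even integer and is less than 3/4 in modulus, being made of three
   increments below 1/4. *)
have coc x y z : nrm (x - y) < eta -> nrm (y - z) < eta -> nrm (x - z) < eta ->
    dl x y + dl y z = dl x z.
  move=> /dl_small + /dl_small + /dl_small.
  rewrite !ltr_norml => /andP[a1 a2] /andP[b1 b2] /andP[c1 c2].
  have [k1 e1] := wrE (f y - f x); have [k2 e2] := wrE (f z - f y).
  have [k3 e3] := wrE (f z - f x).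
  have e : dl x y + dl y z - dl x z = 2 * (k1 + k2 - k3)%:~R.
    by rewrite /dl e1 e2 e3 rmorphB rmorphD /=; ring.
  have /even_small k0 : `|2 * (k1 + k2 - k3)%:~R| < 1 :> R.
    by rewrite -e ltr_norml; apply/andP; split; lra.
  by move: e; rewrite k0; lra.
have er0 : 0 < eta / 2 / r by rewrite !divr_gt0.
have [n hn] := inv_small er0.
have {}hn : r / n.+1%:R < eta / 2 by have := hn n (leqnn n); rewrite ltr_pdivlMr // mulrC.
(* The lift adds up the small increments along the radius to [z], in steps shorter than [eta / 2];
   by additivity on small triangles, neighbouring radii give compatible sums. *)
pose pt (i : nat) (z : C) := cr (i%:R / n.+1%:R) * z.
pose th z := \sum_(0 <= i < n.+1) dl (pt i z) (pt i.+1 z).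
have ptn z : pt n.+1 z = z.
  by rewrite /pt divff ?pnatr_eq0 // /cr rmorph1 mul1r.
have dl0 z : dl z z = 0.
  by rewrite /dl subrr /wr !ltNge ler01 lerN10.
have pt0 z : pt 0%N z = 0 by rewrite /pt mul0r /cr rmorph0 mul0r.
have thE z w : nrm z <= r -> nrm w <= r -> nrm (z - w) < eta / 2 ->
    th w - th z = dl z w.
  move=> zr wr' zw; rewrite /th -sumrB.
  have ptS (x : C) i : nrm x <= r -> nrm (pt i x - pt i.+1 x) < eta / 2.
    move=> xr; have -> : pt i x - pt i.+1 x = cr (- n.+1%:R^-1) * x.
      rewrite /pt -mulrBl /cr -rmorphB -mulrBl -natr1 opprD addNKr mulN1r //.
    rewrite nrmM nrm_cr normrN ger0_norm ?invr_ge0 //; apply: le_lt_trans hn.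
    by rewrite mulrC ler_pM2r ?invr_gt0 ?ltr0Sn.
  have ptd i : (i <= n.+1)%N -> nrm (pt i z - pt i w) < eta / 2.
    move=> ile; rewrite /pt -mulrBr nrmM nrm_cr ger0_norm ?divr_ge0 //.
    apply: le_lt_trans zw; rewrite -[leRHS]mul1r ler_wpM2r ?nrm_ge0 //.
    by rewrite ler_pdivrMr ?ltr0Sn // mul1r ler_nat.
  rewrite (eq_big_nat _ _ (F2 := fun i => dl (pt i.+1 z) (pt i.+1 w) - dl (pt i z) (pt i w))).
    by rewrite telescope_sumr // ptn ptn !pt0 dl0 subr0.
  move=> i /andP[_ ilt].
  have h1 := ptd i (ltnW ilt); have h2 := ptd i.+1 ilt.
  have h3 := ptS z i zr; have h4 := ptS w i wr'.
  have h5 := nrm_tri (pt i z) (pt i.+1 z) (pt i.+1 w).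
  have c1 := coc (pt i z) (pt i.+1 z) (pt i.+1 w).
  have c2 := coc (pt i z) (pt i w) (pt i.+1 w).
  have <- : dl (pt i z) (pt i.+1 z) + dl (pt i.+1 z) (pt i.+1 w) - dl (pt i z) (pt i w)
     = dl (pt i w) (pt i.+1 w) by rewrite c1 -?c2; lra.
  lra.
(* The lift [th] differs from [v] on [A], and from [- v] on [B], by a constant. *)
have lift (X : set C) (s : R) : `|s| = 1 -> conn X -> (forall z, X z -> nrm z <= r) ->
    (forall z, X z -> exists k : int, f z = s * v z + 2 * k%:~R) ->
    forall x y, X x -> X y -> th x - s * v x = th y - s * v y.
  move=> s1 kX Xr hX x y Xx Xy.
  apply: (kX (fun z => th x - s * v x = th z - s * v z) _ x y) => // z Xz.
  exists (eta / 2) => [|w Xw wz]; first by lra.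
  suff -> : th w - s * v w = th z - s * v z by [].
  have zw : nrm (z - w) < eta by rewrite nrmB; lra.
  have := thE z w (Xr _ Xz) (Xr _ Xw); rewrite nrmB => /(_ wz) e.
  have [k1 e1] := hX _ Xz; have [k2 e2] := hX _ Xw; have [k3 e3] := wrE (f w - f z).
  have e4 : dl z w - s * (v w - v z) = 2 * (k2 - k1 + k3)%:~R.
    by rewrite /dl e3 e1 e2 rmorphD rmorphB /=; ring.
  have /even_small k0 : `|2 * (k2 - k1 + k3)%:~R| < 1 :> R.
    rewrite -e4; apply: (le_lt_trans (ler_normB _ _)); rewrite normrM s1 mul1r.
    by have := dl_small _ _ zw; have := vz _ _ zw; rewrite (distrC (v w)); lra.
  by move: e4; rewrite k0; lra.
have IA z : (P `|` Q) z -> A z /\ B z by rewrite -E.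
have [Ap Bp] := IA p (or_introl Pp); have [Aq Bq] := IA q (or_intror Qq).
have h1 : th p - 1 * v p = th q - 1 * v q.
  apply: (lift A) => //; rewrite ?normr1 //; first by move=> z /hr /ltW.
  by move=> z Az; exists 0; rewrite /f asboolT // mulr0z; ring.
have h2 : th p - (-1) * v p = th q - (-1) * v q.
  apply: (lift B'); rewrite ?normrN1 //; [by move=> z []| |split=> //; exact/ltW/hr..].
  move=> z [Bz _]; rewrite /f; case: asboolP => [Az|_]; last by exists 0; rewrite mulr0z; ring.
  have : (P `|` Q) z by rewrite -E.
  by case=> [/vP ->|/vQ ->]; [exists 0|exists 1]; rewrite ?mulr0z ?mulr1z; ring.
by move: h1 h2; rewrite (vP p) // (vQ q) //; clear; lra.
Qed.

(** The purpose of unicoherence: the set and the closure of its complement are connected and cover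
    the plane, and they meet exactly in the boundary. *)
Lemma bdry_conn (E : set C) : cpt E -> conn E -> conn (~` E) -> conn (bdry E).
Proof.
move=> cE kE kC.
have -> : bdry E = E `&` closure (~` E).
  apply/seteqP; split => z.
    move=> bz; split; first by apply: closed_bdry bz; case: cE.
    by apply/closureCP => e e0; case: (bdryCP E z) => /(_ bz e e0)[].
  move=> [Ez /closureCP cz]; apply/bdryCP => e e0; split; last exact: cz.
  by exists z => //; rewrite subrr nrm0.
apply: unicoherent => //; first exact: closed_closure.
  by apply: conn_closure kC _ _ => //; exact: subset_closure.
apply/seteqP; split => // z _; have [|nE] := pselect (E z); first by left.
by right; apply: subset_closure.
Qed.

End Unicoherence.

(** * Polynomials and lemniscates *)

Section PolyBasics.
Variable R : realType.
Local Notation C := (Cplx R).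
Implicit Types (p q : {poly C}).

Lemma poly_factor p : exists2 rs : seq C, size rs = (size p).-1 &
  p = lead_coef p *: \prod_(z <- rs) ('X - z%:P).
Proof.
have [->|p0] := eqVneq p 0.
  by exists [::]; rewrite ?size_poly0 // lead_coef0 scale0r.
have [rs e] := @closed_field_poly_normal (R[i]) p; exists rs => //.
have /(congr1 (fun p => size p)) := e.
by rewrite size_scale ?lead_coef_eq0 // size_prod_XsubC => ->.
Qed.

Lemma nrm_lead_gt0 p : (1 < size p)%N -> 0 < nrm (lead_coef p).
Proof.
by move=> h; rewrite nrm_gt0 lead_coef_eq0 -size_poly_gt0; case: (size p) h.
Qed.

Lemma nrm_factor p : exists2 rs : seq C, size rs = (size p).-1 &
  (forall z, nrm p.[z] = nrm (lead_coef p) * \prod_(a <- rs) nrm (z - a)) /\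
  ((1 < size p)%N -> forall z, (z \in rs) = (p.[z] == 0)).
Proof.
have [rs srs e] := poly_factor p; exists rs => //.
have hE z : p.[z] = lead_coef p * \prod_(a <- rs) (z - a).
  rewrite {1}e hornerZ horner_prod; congr (_ * _).
  by apply: eq_bigr => a _; rewrite hornerXsubC.
split=> [z|sp z]; first by rewrite hE nrmM nrm_prod.
rewrite hE mulf_eq0 -nrm_eq0 gt_eqF ?nrm_lead_gt0 //=.
rewrite prodf_seq_eq0; apply/idP/hasP => [zr|[a ar /=]].
  by exists z => //=; rewrite subrr.
by rewrite subr_eq0 => /eqP ->.
Qed.

(** For the root of [q - w] nearest to [z], each linear factor of [q.[z] - w] is at least as large
    as the distance to that root. This quantitative openness is used in place of an inverse function
    theorem. *)
Lemma root_near q (z w : C) : (1 < size q)%N -> exists2 z', q.[z'] = w &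
  nrm (lead_coef q) * nrm (z - z') ^+ (size q).-1 <= nrm (q.[z] - w).
Proof.
move=> sq; pose p := q - w%:P.
have sp : size p = size q.
  by rewrite size_polyDl // size_polyN (leq_ltn_trans (size_polyC_leq1 w)).
have lp : lead_coef p = lead_coef q.
  by rewrite lead_coefDl // size_polyN (leq_ltn_trans (size_polyC_leq1 w)).
have pE x : p.[x] = q.[x] - w by rewrite /p !hornerE.
have [rs srs [hE hr]] := nrm_factor p; rewrite sp in srs hr.
have {}hr := hr sq.
have rs0 : (0 < size rs)%N by rewrite srs; case: (size q) sq => [|[]].
pose z' := nth 0 rs 0.
have [a ar ha] : exists2 a, a \in rs & forall b, b \in rs -> nrm (z - a) <= nrm (z - b).
  elim: (rs) rs0 => // b [|c s] IH _.
    by exists b; rewrite ?inE // => x; rewrite inE => /eqP ->.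
  have [//|a ar ha] := IH; have [h|h] := leP (nrm (z - a)) (nrm (z - b)).
    exists a; first by rewrite inE ar orbT.
    by move=> x; rewrite inE => /orP[/eqP ->//|/ha].
  exists b; first by rewrite inE eqxx.
  by move=> x; rewrite inE => /orP[/eqP ->//|/ha]; apply: le_trans; exact: ltW.
exists a; first by apply/eqP; rewrite -subr_eq0 -pE -hr.
rewrite -pE hE lp ler_wpM2l ?nrm_ge0 // -srs.
elim: (rs) ha => [|b s IH] ha; first by rewrite big_nil expr0.
rewrite big_cons exprS; apply: ler_pM; rewrite ?exprn_ge0 ?nrm_ge0 //.
  by apply: ha; rewrite inE eqxx.
by apply: IH => x xs; apply: ha; rewrite inE xs orbT.
Qed.

Lemma root_near_lt q (z w : C) (e : R) : (1 < size q)%N -> 0 <= e ->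
  nrm (q.[z] - w) <= nrm (lead_coef q) * e ^+ (size q).-1 ->
  exists2 z', q.[z'] = w & nrm (z - z') <= e.
Proof.
move=> sq e0 h; have [z' e1 h1] := root_near z w sq; exists z' => //.
have := le_trans h1 h; rewrite ler_pM2l ?nrm_lead_gt0 //.
by rewrite ler_pXn2r ?nnegrE ?nrm_ge0 //; case: (size q) sq => [|[]].
Qed.

Lemma poly_surj q (w : C) : (1 < size q)%N -> exists z, q.[z] = w.
Proof. by move=> sq; have [z ? _] := root_near 0 w sq; exists z. Qed.

Lemma poly_open q (z : C) (e : R) : (1 < size q)%N -> 0 < e ->
  exists2 d : R, 0 < d & forall w, nrm (w - q.[z]) < d ->
    exists2 z', q.[z'] = w & nrm (z' - z) < e.
Proof.
move=> sq e0; exists (nrm (lead_coef q) * (e / 2) ^+ (size q).-1).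
  by rewrite mulr_gt0 ?nrm_lead_gt0 // exprn_gt0 //; lra.
move=> w /ltW; rewrite nrmB => h; have e2 : 0 <= e / 2 by lra.
by have [z' ? h'] := root_near_lt sq e2 h; exists z' => //; rewrite nrmB; lra.
Qed.

Lemma poly_bnd q (M : R) : exists2 K : R, 0 < K & forall z, nrm z <= M -> nrm q.[z] <= K.
Proof.
elim/poly_ind: q => [|p c [K K0 hK]].
  by exists 1 => // z _; rewrite horner0 nrm0.
exists (K * (`|M| + 1) + nrm c + 1) => [|z zM].
  by rewrite ltr_wpDl ?addr_ge0 ?mulr_ge0 ?nrm_ge0 // ltW.
rewrite !hornerE; apply: (le_trans (nrmD _ _)); rewrite nrmM.
have h : nrm z <= `|M| + 1 by have := ler_norm M; lra.
have := ler_pM (nrm_ge0 _) (nrm_ge0 _) (hK z zM) h; lra.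
Qed.

Lemma poly_lip q (M : R) : exists2 L : R, 0 < L &
  forall z w, nrm z <= M -> nrm w <= M -> nrm (q.[z] - q.[w]) <= L * nrm (z - w).
Proof.
elim/poly_ind: q => [|p c [L L0 hL]].
  by exists 1 => // z w _ _; rewrite !horner0 subrr nrm0 mul1r nrm_ge0.
have [K K0 hK] := poly_bnd p M.
exists (L * (`|M| + 1) + K) => [|z w zM wM].
  by rewrite ltr_wpDl // mulr_ge0 ?addr_ge0 // ltW.
rewrite !hornerE.
have -> : p.[z] * z + c - (p.[w] * w + c) = (p.[z] - p.[w]) * w + p.[z] * (z - w) by ring.
apply: (le_trans (nrmD _ _)); rewrite !nrmM mulrDl; apply: lerD; last first.
  by rewrite ler_wpM2r ?nrm_ge0 // hK.
have h : nrm w <= `|M| + 1 by have := ler_norm M; lra.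
by rewrite mulrAC; apply: ler_pM; rewrite ?nrm_ge0 ?hL.
Qed.

Lemma poly_quad q (M : R) : exists2 K : R, 0 < K &
  forall z w, nrm z <= M -> nrm w <= M ->
    nrm (q.[z] - q.[w] - q^`().[w] * (z - w)) <= K * nrm (z - w) ^+ 2.
Proof.
elim/poly_ind: q => [|p c [L L0 hL]].
  by exists 1 => // z w _ _; rewrite deriv0 !horner0 mul0r !subr0 nrm0 mul1r exprn_ge0 ?nrm_ge0.
have [K K0 hK] := poly_bnd p^`() M.
exists (L * (`|M| + 1) + K) => [|z w zM wM].
  by rewrite ltr_wpDl // mulr_ge0 ?addr_ge0 // ltW.
have -> : (p * 'X + c%:P).[z] - (p * 'X + c%:P).[w] - (p * 'X + c%:P)^`().[w] * (z - w)
   = (p.[z] - p.[w] - p^`().[w] * (z - w)) * z + p^`().[w] * (z - w) ^+ 2.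
  rewrite derivD derivM derivX derivC addr0 mulr1 !(hornerD, hornerM, hornerX, hornerC).
  by ring.
have e2 : nrm (p^`().[w] * (z - w) ^+ 2) = nrm p^`().[w] * nrm (z - w) ^+ 2.
  by rewrite nrmM nrmX.
have n2 : 0 <= nrm (z - w) ^+ 2 by rewrite exprn_ge0 ?nrm_ge0.
have := hL z w zM wM; move: (nrm (z - w) ^+ 2) e2 n2 => N e2 n2 hN.
apply: (le_trans (nrmD _ _)); rewrite e2 (nrmM _ z) [leRHS]mulrDl; apply: lerD; last first.
  by rewrite ler_wpM2r // hK.
have h : nrm z <= `|M| + 1 by have := ler_norm M; lra.
by rewrite mulrAC; apply: ler_pM; rewrite ?nrm_ge0.
Qed.

Lemma poly_cont q A : ccont_on A (fun z => q.[z]).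
Proof.
move=> z _ e e0; have [L L0 hL] := poly_lip q (nrm z + 1).
exists (Num.min 1 (e / L)) => [|w _]; first by rewrite lt_min ltr01 divr_gt0.
rewrite lt_min => /andP[h1 h2]; have := nrm_sub w z => h3.
apply: (le_lt_trans (hL w z _ _)); try lra.
by rewrite mulrC -ltr_pdivlMr.
Qed.

Lemma poly_cont_nrm q A : cont_on A (fun z => nrm q.[z]).
Proof.
move=> z Az e e0; have [d d0 hd] := poly_cont q Az e0; exists d => // w Aw /(hd w Aw).
have := nrm_sub q.[w] q.[z]; have := nrm_sub q.[z] q.[w].
rewrite (nrmB q.[z]) ltr_norml => h1 h2 h3; apply/andP; split; lra.
Qed.

Lemma poly_escape q : (1 < size q)%N ->
  forall M : R, exists2 r : R, 0 < r & forall z, r <= nrm z -> M < nrm q.[z].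
Proof.
move=> sq M; have [rs srs [hE _]] := nrm_factor q.
have [r0 r00 hr] : exists2 r : R, 0 <= r & forall a, a \in rs -> nrm a <= r.
  exists (\sum_(a <- rs) nrm a); first by apply: sumr_ge0 => a _; exact: nrm_ge0.
  elim: (rs) => // b s IH a; rewrite inE big_cons => /orP[/eqP ->|/IH h].
    by rewrite lerDl sumr_ge0 // => x _; exact: nrm_ge0.
  by apply: (le_trans h); rewrite lerDr nrm_ge0.
have l0 := nrm_lead_gt0 sq; set l := nrm (lead_coef q) in l0 hE.
pose t := 1 + `|M| / l + 1.
have t1 : 1 <= t by rewrite /t -addrA lerDl addr_ge0 // divr_ge0 // ltW.
exists (r0 + t) => [|z zr]; first by lra.
rewrite hE.
have tp : t <= \prod_(a <- rs) nrm (z - a).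
  have : (0 < size rs)%N by rewrite srs; case: (size q) sq => [|[]].
  elim: (rs) hr => // b s IH hr _; rewrite big_cons.
  have hb : t <= nrm (z - b).
    by have := hr b; rewrite inE eqxx => /(_ isT); have := nrm_sub z b; lra.
  case: s IH hr => [|c s] IH hr; first by rewrite big_nil mulr1.
  have : t <= \prod_(a <- c :: s) nrm (z - a).
    by apply: IH => // a h; apply: hr; rewrite inE h orbT.
  by move: (\prod_(_ <- _) _) => x tx; nra.
have h : M < l * t.
  rewrite /t !mulrDr mulr1 mulrCA divff ?gt_eqF // mulr1; have := ler_norm M; lra.
by apply: (lt_le_trans h); rewrite ler_wpM2l // ltW.
Qed.

(** Write [q] as [p * 'X] plus its constant term. Degree at least 2 makes [p] non-constant, so far
    out [p] exceeds 2 by enough to absorb that constant. *)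
Lemma poly_expand q : (2 < size q)%N ->
  exists2 r : R, 1 <= r & forall z, r <= nrm z -> 2 * nrm z <= nrm q.[z].
Proof.
move=> sq.
pose p := (q - (q.[0])%:P) %/ 'X.
have qE : q = p * 'X + (q.[0])%:P.
  rewrite /p divpK ?subrK //; have := dvdp_XsubCl (q - (q.[0])%:P) 0.
  by rewrite subr0 => ->; rewrite /root !hornerE subrr.
have sp : (1 < size p)%N.
  have := size_MXaddC p q.[0]; rewrite -qE; case: ifP => [_ h|_ h]; move: sq; rewrite h //.
have [r r0 hr] := poly_escape sp (2 + nrm q.[0]).
exists (Num.max 1 r) => [|z]; first by rewrite le_max lexx.
rewrite ge_max => /andP[z1 /hr h].
rewrite qE !hornerE.
have := nrm_sub (p.[z] * z) (- q.[0]); rewrite opprK nrmN nrmM.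
have := nrm_ge0 q.[0]; nra.
Qed.

Lemma closed_preim_le q (s : R) : closed [set z | nrm q.[z] <= s].
Proof.
apply/closedCP => z h /=; rewrite leNgt; apply/negP => sz.
have d0 : 0 < nrm q.[z] - s by lra.
have [d dd hd] := @poly_cont_nrm q setT z I _ d0.
have [w /= ws /(hd w I)] := h d dd; rewrite ltr_norml => /andP[]; lra.
Qed.

Lemma sublevel_cpt q (s : R) : (1 < size q)%N -> cpt [set z | nrm q.[z] <= s].
Proof.
move=> sq; split; first exact: closed_preim_le.
have [r r0 hr] := poly_escape sq s; exists r => z /= zs.
by rewrite leNgt; apply/negP => /ltW /hr; lra.
Qed.

End PolyBasics.

(** * Connectedness of sublevel and superlevel sets of polynomials *)

Section Lemniscate.
Variable R : realType.
Local Notation C := (Cplx R).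
Implicit Types (p q : {poly C}).

Lemma conn_split (X A B : set C) : conn X -> X `<=` A `|` B -> cpt A -> cpt B ->
  A `&` B = set0 -> X `&` A !=set0 -> X `&` B !=set0 -> False.
Proof.
move=> kX XAB cA cB AB [a [Xa Aa]] [b [Xb Bb]].
have [d d0 hd] := cpt_sep cA cB AB.
have nB z : A z -> ~ B z by move=> Az Bz; have : (A `&` B) z by []; rewrite AB.
apply: (nB b) => //; apply: (kX A _ a b) => // z Xz; exists d => // w Xw wz.
case: (XAB z Xz) => hz; case: (XAB w Xw) => hw; split=> // h; exfalso.
- by have := hd z w hz hw; rewrite nrmB; lra.
- by have := hd w z hw hz; lra.
- exact: (nB z h hz).
- exact: (nB w h hw).
Qed.

(** Minimum principle: at a minimum of the modulus on [A] with a non-zero value, openness gives a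
    nearby point whose value is shrunk towards 0. It is still in the sublevel set and too close to
    [a] to belong to [B]. *)
Lemma sublevel_has_root q (t : R) (A B : set C) : (1 < size q)%N -> 0 <= t ->
  cpt A -> cpt B -> A `&` B = set0 -> [set z | nrm q.[z] <= t] = A `|` B ->
  A !=set0 -> exists2 z, A z & q.[z] = 0.
Proof.
move=> sq t0 cA cB AB E A0.
have [a Aa ha] := cpt_min cA A0 (@poly_cont_nrm R q A).
have [q0|qn] := eqVneq q.[a] 0; first by exists a.
have Ba : ~ B a by move=> Ba; have : (A `&` B) a by []; rewrite AB.
have [e e0 he] := cpt_dist cB Ba.
have [d d0 hd] := poly_open a sq e0.
have q0 : 0 < nrm q.[a] by rewrite nrm_gt0.
pose s := Num.min (1 / 2) (d / (2 * nrm q.[a])).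
have s0 : 0 < s by rewrite lt_min !divr_gt0 ?mulr_gt0.
have s1 : s <= 1 / 2 by rewrite ge_min lexx.
have sd : s * nrm q.[a] < d.
  apply: (@le_lt_trans _ _ (d / 2)); last by lra.
  have -> : d / 2 = d / (2 * nrm q.[a]) * nrm q.[a] by field; rewrite gt_eqF.
  by rewrite ler_pM2r // ge_min lexx orbT.
have [|z' e1 h1] := hd (cr (1 - s) * q.[a]).
  have -> : cr (1 - s) * q.[a] - q.[a] = - (cr s * q.[a]).
    by rewrite /cr rmorphB rmorph1 /=; ring.
  by rewrite nrmN nrmM nrm_cr gtr0_norm.
have lt : nrm q.[z'] < nrm q.[a].
  by rewrite e1 nrmM nrm_cr gtr0_norm; nra.
have at_ : nrm q.[a] <= t.
  have : (A `|` B) a by left.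
  by rewrite -E.
have : (A `|` B) z'.
  by rewrite -E /=; apply: le_trans at_; exact: ltW.
by case=> [/ha|/he]; lra.
Qed.

Lemma sublevel_conn_large q : (1 < size q)%N ->
  exists2 T : R, 0 < T & forall t, T <= t -> conn [set z | nrm q.[z] <= t].
Proof.
move=> sq; have [r r0 hr] := poly_escape sq 0.
have [T T0 hT] := poly_bnd q r; exists T => // t Tt.
have t0 : 0 <= t by lra.
apply: conn_cptP; first exact: sublevel_cpt.
move=> A B cA cB AB E A0 B0.
have [a Aa qa] := sublevel_has_root sq t0 cA cB AB E A0.
have [b Bb qb] : exists2 z, B z & q.[z] = 0.
  by apply: (sublevel_has_root sq t0 cB cA) => //; [rewrite setIC|rewrite setUC].
have root_r z : q.[z] = 0 -> nrm z <= r.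
  by move=> qz; rewrite leNgt; apply/negP => /ltW /hr; rewrite qz nrm0 ltxx.
apply: (@conn_split [set z | nrm (z - 0) <= r] A B) => //.
- exact: conn_closed_dsk.
- by move=> z; rewrite -E /= subr0 => /hT h; exact: le_trans Tt.
- by exists a; split=> //=; rewrite subr0 root_r.
- by exists b; split=> //=; rewrite subr0 root_r.
Qed.

Lemma sublevel_conn_step q (s T : R) : (1 < size q)%N -> 0 < s -> s <= T ->
  (forall c, q^`().[c] = 0 -> nrm q.[c] < s) ->
  exists2 s0 : R, 0 < s0 & forall t' t, s <= t' -> t' <= t -> t <= T ->
    t - t' <= s0 -> conn [set z | nrm q.[z] <= t] -> conn [set z | nrm q.[z] <= t'].
Proof.
move=> sq s0 sT hc; have [cT [M hM]] := sublevel_cpt T sq.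
pose An := [set z : C | s <= nrm q.[z] <= T].
have cAn : cpt An.
  apply: (@cpt_closed_sub _ _ [set z | nrm q.[z] <= T]); last exact: sublevel_cpt.
    by move=> z /andP[].
  apply/closedCP => z h /=; apply/andP; split; last first.
    move/closedCP: cT; apply=> e /h[w /andP[_ wT] ?]; by exists w.
  rewrite leNgt; apply/negP => zs.
  have d0 : 0 < s - nrm q.[z] by lra.
  have [d dd hd] := @poly_cont_nrm R q setT z I _ d0.
  by have [w /= /andP[ws _] /(hd w I)] := h d dd; rewrite ltr_norml => /andP[]; lra.
have An0 : An !=set0.
  have [z ez] := poly_surj (cr s) sq; exists z; rewrite /An /= ez nrm_cr gtr0_norm //.
  by rewrite lexx.
have [z0 Az0 hz0] := cpt_min cAn An0 (@poly_cont_nrm R q^`() An).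
set m := nrm q^`().[z0] in hz0.
have m0 : 0 < m.
  rewrite nrm_gt0; apply/eqP => /hc; case/andP: Az0; lra.
have [K K0 hK] := poly_quad q M; have [L L0 hL] := poly_lip q M.
(* Within this distance the quadratic error is at most half of the linear term, whose size [m]
   bounds from below on the closed annulus between the levels; so [q] is injective there with an
   explicit constant. *)
pose e := m / (2 * K).
have e0 : 0 < e by rewrite divr_gt0 // mulr_gt0.
have inj y y1 : An y -> nrm q.[y1] <= T -> nrm (y1 - y) < e ->
    m / 2 * nrm (y1 - y) <= nrm (q.[y1] - q.[y]).
  move=> Ay Ty1 yy; have Ty : nrm q.[y] <= T by case/andP: Ay.
  have h1 := hK y1 y (hM _ Ty1) (hM _ Ty).
  have h2 := nrm_sub (q^`().[y] * (y1 - y)) (q.[y1] - q.[y]).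
  rewrite (nrmB (q.[y1] - q.[y])) in h1; rewrite nrmM in h2.
  have h3 := hz0 _ Ay; have n0 := nrm_ge0 (y1 - y).
  have h4 : K * nrm (y1 - y) <= m / 2.
    by move: (ltW yy); rewrite /e ler_pdivlMr ?mulr_gt0 //; lra.
  have h5 : K * nrm (y1 - y) ^+ 2 <= m / 2 * nrm (y1 - y).
    by rewrite expr2 mulrA ler_wpM2r.
  have h6 : m * nrm (y1 - y) <= nrm q^`().[y] * nrm (y1 - y) by rewrite ler_wpM2r.
  lra.
have l0 := nrm_lead_gt0 sq; set l := nrm (lead_coef q) in l0.
(* By [root_near_lt], a change of the value by at most this amount is matched by a root at distance
   at most [e / 4]. It does not depend on the levels [t] and [t']. *)
exists (l * (e / 4) ^+ (size q).-1).
  by rewrite mulr_gt0 // exprn_gt0 //; lra.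
move=> t' t st' t't tT tt kt.
have t'0 : 0 < t' by lra.
apply: conn_cptP; first exact: sublevel_cpt.
move=> A B cA cB AB E [a0 Aa0] [b0 Bb0].
have [d d0 hd] := cpt_sep cA cB AB.
have inAB y : (A `|` B) y -> nrm q.[y] <= t' by rewrite -E.
pose pr (w : C) := cr (t' / Num.max t' (nrm w)) * w.
have pr_in w : nrm w <= t' -> pr w = w.
  by move=> h; rewrite /pr max_l // divff ?gt_eqF // /cr rmorph1 mul1r.
have pr_out w : t' < nrm w -> nrm (pr w) = t' /\ nrm (w - pr w) = nrm w - t'.
  move=> h; rewrite /pr max_r ?ltW //; have w0 : 0 < nrm w by lra.
  split; first by rewrite nrmM nrm_cr ger0_norm ?divr_ge0 ?nrm_ge0 ?ltW // divfK // gt_eqF.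
  have -> : w - cr (t' / nrm w) * w = cr (1 - t' / nrm w) * w.
    by rewrite /cr rmorphB rmorph1 /=; ring.
  rewrite nrmM nrm_cr ger0_norm; last by rewrite subr_ge0 ler_pdivrMr ?mul1r ?ltW.
  by rewrite mulrBl mul1r divfK // gt_eqF.
(* [a] is a point of the lower sublevel set close to [z] and lying over the radial retraction of
   [q.[z]]. That such an [a] exists in [A] is a locally constant property of [z] on the upper
   sublevel set; at a point of [B] it would have to be that point itself. *)
pose near z a := [/\ nrm (z - a) <= e / 4, q.[a] = pr q.[z] & nrm q.[z] <= t' -> a = z].
have near_ex z : nrm q.[z] <= t -> exists2 y, (A `|` B) y & near z y.
  move=> zt; have [zt'|zt'] := leP (nrm q.[z]) t'.
    exists z; first by rewrite -E.
    by split=> //; rewrite ?subrr ?nrm0 ?pr_in //; lra.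
  have [pz1 pz2] := pr_out _ zt'.
  have [||y qy zy] := @root_near_lt _ q z (pr q.[z]) (e / 4) sq.
  - by lra.
  - by rewrite pz2 -/l; lra.
  exists y; first by rewrite -E /= qy pz1.
  by split => // /(lt_le_trans zt'); rewrite ltxx.
pose eta := Num.min d (Num.min (e / 4) (m / 2 * d / (4 * L))).
have eta0 : 0 < eta by rewrite !lt_min d0 !divr_gt0 ?mulr_gt0 ?divr_gt0.
have near_close z z1 y y1 : nrm q.[z] <= t -> nrm q.[z1] <= t -> nrm (z1 - z) < eta ->
    (A `|` B) y -> (A `|` B) y1 -> near z y -> near z1 y1 -> nrm (y1 - y) < d.
  wlog hw : z z1 y y1 / nrm q.[z1] <= nrm q.[z] => [hw|].
    have [/hw h|/ltW h] := leP (nrm q.[z1]) (nrm q.[z]); first exact: h.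
    by move=> *; rewrite nrmB; apply: (hw z1 z y1 y) => //; rewrite nrmB.
  move=> zt z1t; rewrite !lt_min => /and3P[zd ze zm] ABy ABy1 [zy qy zyE] [zy1 qy1 zy1E].
  have [zt'|zt'] := leP (nrm q.[z]) t'.
    by rewrite zyE // zy1E //; lra.
  have [pz1 _] := pr_out _ zt'.
  have Any : An y by rewrite /An /= qy pz1; apply/andP; split; lra.
  have y1T : nrm q.[y1] <= T by have := inAB _ ABy1; lra.
  have ye : nrm (y1 - y) < e.
    have := nrm_tri y1 z1 y; have := nrm_tri z1 z y; rewrite (nrmB y1 z1); lra.
  have := inj _ _ Any y1T ye; rewrite qy qy1 => h1.
  have h2 := retract_lipschitz q.[z] q.[z1] t'0.
  have h3 := hL z1 z (hM _ (le_trans z1t tT)) (hM _ (le_trans zt tT)).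
  have h4 : 4 * L * nrm (z1 - z) < m / 2 * d.
    by move: zm; rewrite ltr_pdivlMr ?mulr_gt0 // mulrC.
  rewrite -(ltr_pM2l (_ : 0 < m / 2)); last by lra.
  have h5 : 0 <= L * nrm (z1 - z) by rewrite mulr_ge0 ?nrm_ge0 ?ltW.
  move: h1 h2; rewrite /pr => h1 h2; lra.
have ABd y y1 : A y -> (A `|` B) y1 -> nrm (y1 - y) < d -> A y1.
  by move=> Ay [//|By1]; have := hd y y1 Ay By1; rewrite nrmB; lra.
pose P z := exists2 a, A a & near z a.
have nn a : nrm q.[a] <= t' -> near a a.
  by move=> h; split; rewrite ?subrr ?nrm0 ?pr_in //; lra.
have [a Aa [_ _ eb]] : P b0.
  apply: (kt P _ a0 b0) => [z zt|||].
  - exists eta => // w wt wz; split=> -[a Aa na].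
      have [y ABy ny] := near_ex w wt; exists y => //; apply: (ABd a) => //.
      by apply: (near_close z w a y) => //; left.
    have [y ABy ny] := near_ex z zt; exists y => //; apply: (ABd a) => //.
    by apply: (near_close w z a y) => //; [rewrite nrmB|left].
  - by apply: (le_trans (inAB a0 _)) => //; left.
  - by apply: (le_trans (inAB b0 _)) => //; right.
  - by exists a0 => //; apply: nn; apply: inAB; left.
have : (A `&` B) b0 by split=> //; rewrite -eb //; apply: inAB; right.
by rewrite AB.
Qed.

(* Large sublevel sets are connected since each piece contains a root; lowering the level
   by a fixed small amount moves points along nearest roots, as [q^`()] does not vanish. *)
Lemma sublevel_conn q (s : R) : (1 < size q)%N -> 0 < s ->
  (forall c, q^`().[c] = 0 -> nrm q.[c] < s) -> conn [set z | nrm q.[z] <= s].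
Proof.
move=> sq s0 hc; have [T0 T00 hT] := sublevel_conn_large sq.
pose T := Num.max s T0.
have sT : s <= T by rewrite le_max lexx.
have [d d0 hd] := sublevel_conn_step sq s0 sT hc.
have step n : conn [set z | nrm q.[z] <= Num.max s (T - n%:R * d)].
  elim: n => [|n IH].
    by apply: hT; rewrite mul0r subr0 !le_max lexx !orbT.
  have nd : n.+1%:R * d = n%:R * d + d by rewrite -natr1 mulrDl mul1r.
  have nd0 : 0 <= n%:R * d by rewrite mulr_ge0 // ltW.
  by apply: hd IH; rewrite ?nd /Num.max; do ?case: ltP => ?; lra.
have := step (Num.trunc (T / d)).+1; rewrite max_l //.
have := truncnS_gt (T / d); rewrite ltr_pdivrMr //; lra.
Qed.

(** Maximum principle: on a bounded component the modulus would attain its maximum over the closure,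
    necessarily inside, against openness of [q]. So all components are unbounded, and they join near
    infinity. *)
Lemma superlevel_conn q (s : R) : (1 < size q)%N -> 0 <= s ->
  exists2 r : R, 0 < r & [set z | r < nrm z] `<=` [set z | s < nrm q.[z]] /\
  conn [set z | s < nrm q.[z]].
Proof.
move=> sq s0; have [r r0 hr] := poly_escape sq s; exists r => //.
have rV : [set z | r < nrm z] `<=` [set z | s < nrm q.[z]] by move=> z /ltW /hr.
split=> //; have [z0 _ Mz0] := @outer_unb R 0 r.
set V := [set z | s < nrm q.[z]] in rV *.
have oV : open V.
  have -> : V = ~` [set z | nrm q.[z] <= s].
    by apply/seteqP; split => z; rewrite /V /= ltNge => /negP.
  by apply: closed_openC; exact: closed_preim_le.
apply: (@conn_pts R V z0) => z Vz.
pose W := cc V z; have Wz : W z by exact: cc_refl.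
have [bW|/nbnd_unb uW] := pselect (bnd W); last first.
  have [v Wv rv] := uW r; exists (W `|` [set z | r < nrm z]); split.
  - by apply: connU (@cc_conn _ V z) (@outer_conn R _ (ltW r0)) Wv rv.
  - by move=> w [/cc_sub|/rV].
  - by right.
  - by left.
exfalso.
have cW : cpt (closure W).
  split; first exact: closed_closure.
  have [N hN] := bW; exists (N + 1) => w /closureCP/(_ 1 ltr01)[v /hN vN wv].
  have := nrm_sub w v; rewrite nrmB; lra.
have [m Wm hm] := cpt_max cW (ex_intro _ z (subset_closure Wz)) (@poly_cont_nrm R q _).
have Vm : V m by rewrite /V /=; apply: lt_le_trans (hm z _) => //; exact: subset_closure.
have {}Wm : W m.
  apply: contrapT => nW; apply: (@bdry_cc _ V z oV m) Vm.
  by split=> // /interior_subset.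
have /openCP/(_ m Wm)[e e0 he] : open W by exact: cc_open.
have [d d0 hd] := poly_open m sq e0.
have qm : 0 < nrm q.[m] by move: Vm; rewrite /V /=; lra.
have [|z' e1 h1] := hd (cr (1 + d / (2 * nrm q.[m])) * q.[m]).
  have -> : cr (1 + d / (2 * nrm q.[m])) * q.[m] - q.[m] = cr (d / (2 * nrm q.[m])) * q.[m].
    by rewrite /cr rmorphD rmorph1 /=; ring.
  rewrite nrmM nrm_cr ger0_norm; last by rewrite ltW // divr_gt0 // mulr_gt0.
  have -> : d / (2 * nrm q.[m]) * nrm q.[m] = d / 2 by field; rewrite gt_eqF.
  lra.
have := hm z' (subset_closure (he _ h1)).
have p0 : 0 < d / (2 * nrm q.[m]) by rewrite divr_gt0 // mulr_gt0.
by rewrite e1 nrmM nrm_cr ger0_norm; nra.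
Qed.

End Lemniscate.

(** * Coefficient estimates and normal families *)

Section Fourier.
Variable R : realType.
Local Notation C := (Cplx R).
Implicit Types (p q : {poly C}).

Lemma prim_root_ex N : (0 < N)%N -> exists w : C, N.-primitive_root w.
Proof.
move=> N0; have [r Dp] := @closed_field_poly_normal (R[i]) ('X^N - 1).
rewrite (monicP _) ?monicXnsubC // scale1r in Dp.
have rn1 : all N.-unity_root r by apply/allP=> z; rewrite -root_prod_XsubC -Dp.
have sz_r : (N < (size r).+1)%N.
  by rewrite -(size_prod_XsubC r id) -Dp size_XnsubC.
have [|w] := hasP (has_prim_root N0 rn1 _ sz_r); last by exists w.
by rewrite -separable_prod_XsubC -Dp separable_Xn_sub_1 // pnatr_eq0 -lt0n.
Qed.

Lemma nrm_unity N (w : C) : (0 < N)%N -> w ^+ N = 1 -> nrm w = 1.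
Proof.
move=> N0 /(congr1 (@nrm R)); rewrite nrmX nrm1 => /eqP.
by rewrite pexpr_eq1 // ?nrm_ge0 // => /eqP.
Qed.

Lemma sum_unity N (w : C) (t : nat) : N.-primitive_root w ->
  \sum_(j < N) w ^+ (j * t) = if (N %| t)%N then N%:R else 0.
Proof.
move=> pw; have wN := prim_expr_order pw.
under eq_bigr => j _ do rewrite mulnC exprM.
case: ifP => [Nt|nNt].
  have -> : w ^+ t = 1 by apply/eqP; rewrite -(prim_order_dvd pw).
  by under eq_bigr => j _ do rewrite expr1n; rewrite sumr_const card_ord.
have wt : w ^+ t - 1 != 0 by rewrite subr_eq0 -(prim_order_dvd pw) nNt.
apply: (mulfI wt); rewrite -subrX1 mulr0 -exprM mulnC exprM wN expr1n subrr //.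
Qed.

Lemma fourier N (w : C) p (r : C) (t : nat) : N.-primitive_root w -> (size p <= N)%N ->
  \sum_(j < N) p.[r * w ^+ j] * w ^+ (j * t) =
  \sum_(m < N) (if (N %| m + t)%N then N%:R * p`_m * r ^+ m else 0).
Proof.
move=> pw sp.
under eq_bigr => j _ do rewrite (horner_coef_wide _ sp) big_distrl /=.
rewrite exchange_big; apply: eq_bigr => m _ /=.
have -> : (if (N %| m + t)%N then N%:R * p`_m * r ^+ m else 0) =
   p`_m * r ^+ m * (if (N %| m + t)%N then N%:R else 0).
  by case: ifP => _; ring.
rewrite -(sum_unity (m + t) pw) big_distrr /=; apply: eq_bigr => j _.
rewrite exprMn -exprM mulnDr exprD; ring.
Qed.

Lemma fourier_coef N (w : C) p (r : C) k : N.-primitive_root w -> (size p <= N)%N ->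
  (k < N)%N -> \sum_(j < N) p.[r * w ^+ j] * w ^+ (j * (N - k)) = N%:R * p`_k * r ^+ k.
Proof.
move=> pw sp kN; rewrite fourier // (bigD1 (Ordinal kN)) //= big1 ?addr0.
  by rewrite subnKC ?dvdnn // ltnW.
move=> m mk; case: ifP => // /dvdnP[[|[|d]]] e.
- by move: e (ltn_ord m); lia.
- by case/eqP: mk; apply: val_inj => /=; move: e; lia.
- by have := ltn_ord m; move: e; nia.
Qed.

Lemma nrm_circle N (w : C) (r : R) j : N.-primitive_root w -> 0 < r ->
  nrm (cr r * w ^+ j) = r.
Proof.
move=> pw r0; have w1 := nrm_unity (prim_order_gt0 pw) (prim_expr_order pw).
by rewrite nrmM nrmX w1 expr1n mulr1 nrm_cr gtr0_norm.
Qed.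

(** A discrete Cauchy formula: averaging over the N-th roots of unity is exact as soon as N exceeds
    both [k] and the degree, so no integral is involved. *)
Lemma cauchy p (r M : R) k : 0 < r -> (forall z, nrm z = r -> nrm p.[z] <= M) ->
  nrm p`_k * r ^+ k <= M.
Proof.
move=> r0 hM; pose N := (size p + k).+1.
have [w pw] := @prim_root_ex N isT.
have w1 := nrm_unity (prim_order_gt0 pw) (prim_expr_order pw).
have sp : (size p <= N)%N by rewrite /N; lia.
have kN : (k < N)%N by rewrite /N; lia.
have := congr1 (@nrm R) (fourier_coef (cr r) pw sp kN).
rewrite !nrmM nrmX nrm_nat nrm_cr gtr0_norm // => e.
have N0 : 0 < N%:R :> R by rewrite ltr0n.
rewrite -(ler_pM2l N0) mulrA -e; apply: (le_trans (nrm_sum _ _ _)).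
rewrite -[N%:R]/(N%:R) mulr_natl -[N in leRHS]card_ord -sumr_const.
apply: ler_sum => j _; rewrite nrmM nrmX w1 expr1n mulr1.
by apply: hM; exact: (nrm_circle _ pw).
Qed.

Let cj (z : C) : C := (conjc z).

Local Lemma cj_sum n (F : 'I_n -> C) : cj (\sum_(i < n) F i) = \sum_(i < n) cj (F i).
Proof. exact: (rmorph_sum (@conjc R)). Qed.
Local Lemma cjM (x y : C) : cj (x * y) = cj x * cj y.
Proof. exact: (rmorphM (@conjc R)). Qed.
Local Lemma cj_add (z : C) : z + cj z = cr (2 * complex.Re z).
Proof. by rewrite /cj; case: z => a b; rewrite /cr /=; congr Complex; ring. Qed.
Local Lemma cj_unit (x y : C) : x * y = 1 -> nrm x = 1 -> cj x = y.
Proof.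
move=> xy x1; have x0 : x != 0 by rewrite -nrm_gt0 x1.
have xx : x * cj x = 1.
  have := nrm_sqr x; rewrite x1 expr1n /cj; case: (x) => a b /= e.
  by congr Complex; [rewrite mulrN opprK -!expr2 -e|ring].
by apply: (mulfI x0); rewrite xx xy.
Qed.

Lemma Re_sum n (F : 'I_n -> C) : complex.Re (\sum_(i < n) F i) = \sum_(i < n) complex.Re (F i).
Proof. by apply: (big_morph (@complex.Re R)) => // -[? ?] [? ?]. Qed.

Lemma Re_nat n (z : C) : complex.Re (n%:R * z) = n%:R * complex.Re z.
Proof.
have -> : (n%:R : C) = cr n%:R by rewrite /cr rmorph_nat.
by case: z => a b; rewrite /cr /=; ring.
Qed.

(* Average [2 Re p] against [w ^ - k]: the conjugate half vanishes. *)
Lemma borel_car p (r : R) k : 0 < r -> (forall z, nrm z = r -> 0 <= complex.Re p.[z]) ->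
  (0 < k)%N -> nrm p`_k * r ^+ k <= 2 * complex.Re p`_0.
Proof.
(* As N exceeds [size p + k], it divides [m + k] only for [m] beyond the degree, where the
   coefficient is 0; this kills the average of the conjugate part. *)
move=> r0 hp k0; pose N := (size p + k + k).+1.
have [w pw] := @prim_root_ex N isT.
have w1 := nrm_unity (prim_order_gt0 pw) (prim_expr_order pw).
have sp : (size p <= N)%N by rewrite /N; lia.
have kN : (k < N)%N by rewrite /N; lia.
have N0 : 0 < N%:R :> R by rewrite ltr0n.
pose u j : C := cr r * w ^+ j.
have S1 := fourier_coef (cr r) pw sp kN.
have S2 : \sum_(j < N) cj p.[u j] * w ^+ (j * (N - k)) = 0.
  have e : \sum_(j < N) p.[u j] * w ^+ (j * k) = 0.
    rewrite fourier // big1 // => m _; case: ifP => // /dvdnP[[|d]] e.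
      by move: e k0; lia.
    have mN : (size p <= m)%N.
      have mN := ltn_ord m; case: d e => [|d]; first by rewrite mul1n /N; lia.
      have : (2 * N <= d.+2 * N)%N by rewrite leq_mul2r orbT.
      by move=> h1 h2; rewrite -h2 in h1; lia.
    by rewrite nth_default // mulr0 mul0r.
  have c0 : cj 0 = 0 by rewrite /cj rmorph0.
  have := congr1 cj e; rewrite cj_sum c0; apply: etrans.
  apply: eq_bigr => j _; rewrite cjM; congr (_ * _).
  symmetry; apply: cj_unit; last by rewrite nrmX w1 expr1n.
  by rewrite -exprD -mulnDr subnKC 1?ltnW // mulnC exprM (prim_expr_order pw) expr1n.
have S3 : \sum_(j < N) cr (2 * complex.Re p.[u j]) * w ^+ (j * (N - k)) =
    N%:R * p`_k * cr r ^+ k.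
  rewrite -S1 -[RHS]addr0 -[X in _ = _ + X]S2 -big_split; apply: eq_bigr => j _ /=.
  by rewrite -mulrDl cj_add.
have S0 : \sum_(j < N) complex.Re p.[u j] = N%:R * complex.Re p`_0.
  have := congr1 (@complex.Re R) (fourier_coef (cr r) pw sp (isT : (0 < N)%N)).
  rewrite expr0 mulr1 Re_sum Re_nat; apply: etrans.
  apply: eq_bigr => j _; rewrite subn0 mulnC exprM (prim_expr_order pw) expr1n mulr1 //.
have := congr1 (@nrm R) S3; rewrite !nrmM nrmX nrm_nat nrm_cr gtr0_norm // => e.
rewrite -(ler_pM2l N0) mulrA -e; apply: (le_trans (nrm_sum _ _ _)).
rewrite mulrCA -S0 big_distrr /=; apply: ler_sum => j _.
rewrite nrmM nrmX w1 expr1n mulr1 nrm_cr ger0_norm // mulr_ge0 //.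
by apply: hp; exact: (nrm_circle _ pw).
Qed.

End Fourier.

(** * Polynomial approximation of the logarithm, and bounded sequences of polynomials *)

Section LogApprox.
Variable R : realType.
Local Notation C := (Cplx R).

Lemma expr_small (q e : R) : 0 <= q < 1 -> 0 < e ->
  exists N, forall n, (N <= n)%N -> q ^+ n < e.
Proof.
move=> /andP[q0 q1] e0; have : `|q| < 1 by rewrite ger0_norm.
move=> /cvg_expr /cvgrPdist_lt /(_ e e0) [N _ hN]; exists N => n /hN /=.
by rewrite sub0r normrN ger0_norm // exprn_ge0.
Qed.

Lemma Re_mul_div (a b : C) : b != 0 ->
  complex.Re (a / b) = (complex.Re a * complex.Re b + complex.Im a * complex.Im b) / nrm b ^+ 2.
Proof.
rewrite nrm_sqr; case: a => x y; case: b => u v b0 /=.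
have n0 : u ^+ 2 + v ^+ 2 != 0.
  apply: contraNneq b0 => h; have : u ^+ 2 = 0 /\ v ^+ 2 = 0.
    by have := sqr_ge0 u; have := sqr_ge0 v; split; lra.
  by move=> [/eqP + /eqP]; rewrite !sqrf_eq0 => /eqP -> /eqP ->.
by field.
Qed.

Lemma ReD (z w : C) : complex.Re (z + w) = complex.Re z + complex.Re w.
Proof. by case: z; case: w. Qed.

Lemma ReZ (t : R) (z : C) : complex.Re (cr t * z) = t * complex.Re z.
Proof. by rewrite /cr; case: z => a b /=; ring. Qed.

(** [L] is the truncated series of the logarithm. Along the segment from 0 to [w], the derivative of
    the error is a geometric remainder of order [q ^+ K / (1 - q)], so the mean value theorem
    replaces any complex logarithm. *)
Lemma log_approx (q e : R) : 0 <= q < 1 -> 0 < e -> exists L : {poly C},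
  forall w, nrm w <= q -> `|ln (nrm (1 - w)) - complex.Re L.[w]| <= e.
Proof.
move=> q01 e0; have /andP[q0 q1] := q01.
have e1 : 0 < e * (1 - q) by rewrite mulr_gt0 //; lra.
have [K hK] := expr_small q01 e1.
exists (- \poly_(m < K.+1) (if m == 0%N then 0 else cr m%:R^-1)).
move=> w wq; have w1 : nrm w < 1 by lra.
have nz (t : R) : 0 <= t <= 1 -> 0 < nrm (1 - cr t * w).
  move=> /andP[t0 t1]; have := nrm_sub 1 (cr t * w); rewrite nrm1 nrmM nrm_cr ger0_norm //.
  by have := nrm_ge0 w; nra.
(* The squared modulus of [1 - t w] as a real polynomial in [t]; working with its logarithm accounts
   for the factors 2 below. *)
pose N : {poly R} := 1 - (2 * complex.Re w) *: 'X + (nrm w ^+ 2) *: 'X^2.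
have NE t : N.[t] = nrm (1 - cr t * w) ^+ 2.
  rewrite /N !(hornerD, hornerN, hornerZ, hornerX, hornerXn, hornerC) !nrm_sqr.
  by rewrite /cr; case: (w) => a b /=; ring.
pose S : {poly R} := \poly_(m < K.+1) (if m == 0%N then 0 else complex.Re (w ^+ m) / m%:R).
pose f : R -> R := (@ln R \o horner N) + horner (2 *: S).
have SE : complex.Re (- \poly_(m < K.+1) (if m == 0%N then 0 else cr m%:R^-1)).[w] = - S.[1].
  rewrite hornerN /S !horner_poly.
  have -> : complex.Re (- (\sum_(i < K.+1) (if i == 0 then 0 else cr i%:R^-1) * w ^+ i)) =
     - complex.Re (\sum_(i < K.+1) (if i == 0 :> nat then 0 else cr i%:R^-1) * w ^+ i).
    by case: (\sum_(i < _) _).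
  rewrite Re_sum; congr (- _); apply: eq_bigr => i _; rewrite expr1n mulr1.
  by case: ifP => _; [rewrite mul0r|rewrite ReZ mulrC].
have dS t : S^`().[t] = complex.Re (w * \sum_(m < K) (cr t * w) ^+ m).
  have -> : S^`() = \poly_(m < K) complex.Re (w ^+ m.+1).
    apply/polyP => i; rewrite coef_deriv !coef_poly ltnS; case: ifP => _; last by rewrite mul0rn.
    by rewrite /= -[LHS]mulr_natr divfK // pnatr_eq0.
  rewrite horner_poly big_distrr /= Re_sum; apply: eq_bigr => m _.
  have -> : w * (cr t * w) ^+ m = cr (t ^+ m) * w ^+ m.+1.
    by rewrite exprMn exprS /cr rmorphXn /=; ring.
  by rewrite ReZ mulrC.
have df (x : R) : 0 <= x <= 1 -> is_derive x 1 f (N^`().[x] / N.[x] + (2 *: S)^`().[x]).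
  move=> x01; apply: is_deriveD.
  have Nx : 0 < N.[x] by rewrite NE exprn_gt0 // nz.
  have dl := is_derive1_ln Nx.
  rewrite [N^`().[x] / _]mulrC.
  exact: (@is_derive1_comp _ (@ln R) (horner N) x _ _ dl (is_derive_poly N x)).
have cf : {within `[0, 1], continuous f}.
  by apply: derivable_within_continuous => x; rewrite in_itv /= => /df [].
have {}df (x : R) : x \in `]0, 1[ -> is_derive x 1 f (N^`().[x] / N.[x] + (2 *: S)^`().[x]).
  by rewrite in_itv /= => /andP[x0 x1]; apply: df; rewrite !ltW.
have [c /[!in_itv] /= c01 ec] := MVT_segment ler01 df cf.
have fE t : f t = ln N.[t] + 2 * S.[t] by rewrite /f fctE /= hornerZ.
have f1 : f 1 = 2 * (ln (nrm (1 - w)) - - S.[1]).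
  rewrite fE NE /cr rmorph1 mul1r lnXn; first by rewrite -mulr_natl; ring.
  by have := nz 1; rewrite /cr rmorph1 mul1r; apply; rewrite ler01 lexx.
have f0 : f 0 = 0.
  rewrite fE NE /cr rmorph0 mul0r subr0 nrm1 expr1n ln1 add0r.
  by rewrite /S horner_poly big1 ?mulr0 // => -[[|i] hi] _; rewrite /= ?mul0r // expr0n mulr0.
rewrite SE; move: ec; rewrite f1 f0 subr0 subr0 mulr1 => ec.
have dn : 1 - cr c * w != 0 by rewrite -nrm_gt0 nz.
have key : N^`().[c] / N.[c] + (2 *: S)^`().[c] =
    - 2 * complex.Re (w * (cr c * w) ^+ K / (1 - cr c * w)).
  have -> : w * (cr c * w) ^+ K / (1 - cr c * w) =
      w / (1 - cr c * w) - w * \sum_(m < K) (cr c * w) ^+ m.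
    have := subrX1 (cr c * w) K; move: (\sum_(i < K) _) => s h.
    have -> : (cr c * w) ^+ K = 1 + (cr c * w - 1) * s by rewrite -h; ring.
    by field.
  rewrite ReB -dS derivZ hornerZ.
  suff -> : N^`().[c] / N.[c] = - 2 * complex.Re (w / (1 - cr c * w)) by ring.
  rewrite Re_mul_div // -NE mulrA; congr (_ / _).
  rewrite /N !derivD derivN !derivZ derivX derivXn derivC.
  rewrite !(hornerD, hornerN, hornerZ, hornerX, hornerXn, hornerC, hornerMn) nrm_sqr.
  by rewrite /cr; case: (w) => a b /=; ring.
have b1 : nrm (w * (cr c * w) ^+ K / (1 - cr c * w)) <= q ^+ K / (1 - q).
  rewrite !nrmM nrmX nrmV nrmM nrm_cr; have /andP[c0 c1] := c01; rewrite ger0_norm //.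
  apply: ler_pM.
  - by rewrite mulr_ge0 ?nrm_ge0 // exprn_ge0 // mulr_ge0 ?nrm_ge0.
  - by rewrite invr_ge0 nrm_ge0.
  - have h : (c * nrm w) ^+ K <= q ^+ K.
      rewrite lerXn2r ?nnegrE ?mulr_ge0 ?nrm_ge0 //; have := nrm_ge0 w; nra.
    rewrite -[leRHS]mul1r; apply: ler_pM; rewrite ?nrm_ge0 ?exprn_ge0 ?mulr_ge0 ?nrm_ge0 //.
    exact: ltW.
  - rewrite lef_pV2 ?posrE ?nz //; last by lra.
    have := nrm_sub 1 (cr c * w); rewrite nrm1 nrmM nrm_cr ger0_norm //.
    by have := nrm_ge0 w; nra.
have b2 : q ^+ K / (1 - q) < e by rewrite ltr_pdivrMr ?subr_gt0 // hK.
have := Re_nrm (w * (cr c * w) ^+ K / (1 - cr c * w)).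
move: ec; rewrite key; move: (complex.Re (_ / _)) (nrm (_ / _)) b1 => x y.
move: (ln _ - _) (q ^+ K / _) b2 => u v vE yv /=.
by rewrite !ler_norml => uE /andP[]; rewrite ?ler_norml; lra.
Qed.

Lemma poly_shift (p : {poly C}) (x z : C) : (p \Po ('X + x%:P)).[z - x] = p.[z].
Proof. by rewrite horner_comp !hornerE subrK. Qed.

Lemma cauchy_at (p : {poly C}) (x : C) (r M : R) k : 0 < r ->
  (forall z, nrm (z - x) <= r -> nrm p.[z] <= M) ->
  nrm (p \Po ('X + x%:P))`_k * r ^+ k <= M.
Proof.
move=> r0 h; apply: cauchy => // z zr; rewrite horner_comp !hornerE.
by apply: h; rewrite addrK zr.
Qed.

Lemma geo_tail (a : nat -> R) (M : R) K S : 0 <= M ->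
  (forall k, a k <= M / 2 ^+ k) -> \sum_(K <= k < S) a k <= 2 * M / 2 ^+ K.
Proof.
move=> M0 ha; have t0 k : 0 <= 2 * M / 2 ^+ k by rewrite divr_ge0 ?mulr_ge0 ?exprn_ge0.
have [SK|KS] := leqP S K; first by rewrite big_geq.
suff h n : \sum_(K <= k < K + n) a k <= 2 * M / 2 ^+ K - 2 * M / 2 ^+ (K + n).
  by have := h (S - K)%N; rewrite subnKC ?(ltnW KS) //; have := t0 S; lra.
elim: n => [|n IH]; first by rewrite addn0 big_geq // subrr.
rewrite addnS big_nat_recr ?leq_addr //=; have := ha (K + n)%N.
have -> : 2 * M / 2 ^+ (K + n).+1 = M / 2 ^+ (K + n).
  by rewrite exprS; field; rewrite expf_neq0.
have e : 2 * M / 2 ^+ (K + n) = 2 * (M / 2 ^+ (K + n)) by rewrite mulrA.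
by rewrite e in IH; lra.
Qed.

(** Coefficients at [x] are bounded geometrically. On the half disc, two members whose first [K]
    coefficients are close to the ultrafilter limits differ by O(2^-K), whatever their degrees. The
    limit [F] is taken pointwise and is not asserted to be a power series. *)
Lemma montel (f : nat -> {poly C}) (x : C) (r M : R) : 0 < r ->
  (forall n z, nrm (z - x) <= r -> nrm (f n).[z] <= M) ->
  exists phi : nat -> nat, (forall m n, (m < n)%N -> (phi m < phi n)%N) /\
  exists F : C -> C, forall e : R, 0 < e -> exists N, forall n, (N <= n)%N ->
    forall z, nrm (z - x) <= r / 2 -> nrm ((f (phi n)).[z] - F z) < e.
Proof.
move=> r0 hM; have [U [UU hU]] := @ultra_nat; have FU : ProperFilter U by exact: ultra_proper.
have M0 : 0 <= M by have := hM 0%N x; rewrite subrr nrm0 => /(_ (ltW r0)); apply: le_trans; exact: nrm_ge0.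
pose g n := f n \Po ('X + x%:P).
have cg n k : nrm (g n)`_k <= M / r ^+ k.
  by rewrite ler_pdivlMr ?exprn_gt0 //; apply: cauchy_at => // z; exact: hM.
have /choice[l hl] : forall k, exists l : C, forall e : R, 0 < e -> U [set n | nrm ((g n)`_k - l) < e].
  by move=> k; exact: (ultra_lim UU (cg^~ k)).
have /choice[F hF] : forall z, exists l : C, nrm (z - x) <= r / 2 ->
    forall e : R, 0 < e -> U [set n | nrm ((f n).[z] - l) < e].
  move=> z; have [zr|zr] := leP (nrm (z - x)) (r / 2); last by exists 0.
  have [|l0 h0] := ultra_lim UU (u := fun n => (f n).[z]) (M := M).
    by move=> n; apply: hM; lra.
  by exists l0.
(* This tolerance makes the first [K] terms of a difference contribute at most [2 / 2 ^+ K] on the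
   half disc, in line with the geometric bound for the tail. *)
pose dl K := (2 ^+ K * \sum_(k < K) (r / 2) ^+ k + 1)^-1.
have dl0 K : 0 < dl K.
  rewrite invr_gt0 ltr_wpDl // mulr_ge0 ?exprn_ge0 // sumr_ge0 // => k _.
  by rewrite exprn_ge0 // divr_ge0 // ltW.
pose A K := [set n | forall k, (k < K)%N -> nrm ((g n)`_k - l k) < dl K].
have UA K : U (A K).
  have h d j : 0 < d -> U [set n | forall k, (k < j)%N -> nrm ((g n)`_k - l k) < d].
    move=> d0; elim: j => [|j IH].
      by apply: filterS (@filterT _ U _) => n _ k; rewrite ltn0.
    apply: filterS2 IH (hl j d d0) => n /= h1 h2 k.
    by rewrite ltnS leq_eqVlt => /orP[/eqP ->|/h1].
  exact: h.
have close K n n' z : A K n -> A K n' -> nrm (z - x) <= r / 2 ->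
    nrm ((f n).[z] - (f n').[z]) <= (2 + 4 * M) / 2 ^+ K.
  move=> An An' zr; rewrite -(poly_shift (f n) x) -(poly_shift (f n') x) -/(g n) -/(g n').
  set w := z - x in zr *.
  pose S := maxn K (maxn (size (g n)) (size (g n'))).
  rewrite (@horner_coef_wide _ S (g n)) ?(@horner_coef_wide _ S (g n')) ?leq_max ?leqnn ?orbT //.
  rewrite -sumrB; apply: (le_trans (nrm_sum _ _ _)).
  rewrite (eq_bigr (fun i : 'I_S => nrm ((g n)`_i - (g n')`_i) * nrm w ^+ i)); last first.
    by move=> i _; rewrite -mulrBl nrmM nrmX.
  rewrite -(big_mkord xpredT (fun i => nrm ((g n)`_i - (g n')`_i) * nrm w ^+ i)).
  rewrite (@big_cat_nat _ _ _ K) ?leq0n ?leq_max ?leqnn //=.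
  have h1 : \sum_(0 <= i < K) nrm ((g n)`_i - (g n')`_i) * nrm w ^+ i <= 2 / 2 ^+ K.
    rewrite big_mkord; apply: (@le_trans _ _ (\sum_(i < K) (2 * dl K) * (r / 2) ^+ i)).
      apply: ler_sum => i _; apply: ler_pM; rewrite ?exprn_ge0 ?nrm_ge0 //.
        have := nrm_tri (g n)`_i (l i) (g n')`_i; rewrite (nrmB (l i)).
        by have := An i (ltn_ord i); have := An' i (ltn_ord i); lra.
      by apply: lerXn2r; rewrite ?nnegrE ?nrm_ge0 //; apply: le_trans zr; exact: nrm_ge0.
    rewrite -big_distrr /= /dl; set s := \sum_(i < K) _.
    have s0 : 0 <= s by apply: sumr_ge0 => i _; rewrite exprn_ge0 // divr_ge0 // ltW.
    have p0 : 0 < 2 ^+ K :> R by rewrite exprn_gt0.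
    have ps : 0 < 2 ^+ K * s + 1 by rewrite ltr_wpDl // mulr_ge0 // ltW.
    rewrite -mulrA ler_pM2l // mulrC ler_pdivrMr //.
    have -> : (2 ^+ K)^-1 * (2 ^+ K * s + 1) = s + (2 ^+ K)^-1 by field; rewrite gt_eqF.
    by rewrite lerDl invr_ge0 ltW.
  have h2 : \sum_(K <= i < S) nrm ((g n)`_i - (g n')`_i) * nrm w ^+ i <= 2 * (2 * M) / 2 ^+ K.
    apply: geo_tail => [|k]; first by rewrite mulr_ge0.
    have rk : 0 < r ^+ k by rewrite exprn_gt0.
    apply: (@le_trans _ _ (2 * (M / r ^+ k) * (r / 2) ^+ k)).
      apply: ler_pM; rewrite ?exprn_ge0 ?nrm_ge0 //.
        have := nrmD (g n)`_k (- (g n')`_k); rewrite nrmN.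
        have := cg n k; have := cg n' k; lra.
      by apply: lerXn2r; rewrite ?nnegrE ?nrm_ge0 //; apply: le_trans zr; exact: nrm_ge0.
    have -> : 2 * (M / r ^+ k) * (r / 2) ^+ k = 2 * M / 2 ^+ k; last by [].
    by rewrite expr_div_n; field; rewrite !expf_neq0 ?gt_eqF.
  have -> : (2 + 4 * M) / 2 ^+ K = 2 / 2 ^+ K + 2 * (2 * M) / 2 ^+ K by rewrite -mulrDl; congr (_ / _); ring.
  exact: lerD.
have /choice[ph hph] : forall Km : nat * nat, exists n, A Km.1 n /\ (Km.2 < n)%N.
  move=> [K m]; have [n [/= h1 h2]] := filter_ex (filterI (UA K) (hU m.+1)).
  by exists n.
pose phi := fix phi n := if n is n'.+1 then ph (n, phi n') else ph (0%N, 0%N).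
exists phi; split.
  have step n : (phi n < phi n.+1)%N by have [_] := hph (n.+1, phi n).
  move=> m; elim=> // n IH; rewrite ltnS leq_eqVlt => /orP[/eqP ->|/IH h]; first exact: step.
  exact: ltn_trans h (step n).
have Aphi n : A n (phi n) by case: n => [|n]; [case: (hph (0, 0)%N)|case: (hph (n.+1, phi n))].
exists F => e e0.
have eM : 0 < e / (2 * (3 + 4 * M)) by rewrite divr_gt0 //; nra.
have h01 : 0 <= (2^-1 : R) < 1 by apply/andP; split; lra.
have [N hN] := expr_small h01 eM.
exists N => n Nn z zr.
have e2 : 0 < e / 2 by lra.
have [n' [/= h1 h2]] := filter_ex (filterI (UA n) (hF z zr (e / 2) e2)).
have := close n _ _ z (Aphi n) h1 zr.
have := hN n Nn; rewrite exprVn ltr_pdivlMr; last by nra.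
have := nrm_tri (f (phi n)).[z] (f n').[z] (F z).
have q0 : 0 < (2 ^+ n)^-1 :> R by rewrite invr_gt0 exprn_gt0.
move: ((2 ^+ n)^-1) q0 => q q0 h3 h4 h5; nra.
Qed.

End LogApprox.

(** * Harnack's inequality for [ln |p|] *)

Section Harnack.
Variable R : realType.
Local Notation C := (Cplx R).

Lemma ln_prod_nrm (rs : seq C) (f : C -> C) : (forall a, a \in rs -> 0 < nrm (f a)) ->
  ln (\prod_(a <- rs) nrm (f a)) = \sum_(a <- rs) ln (nrm (f a)) /\
  0 < \prod_(a <- rs) nrm (f a).
Proof.
elim: rs => [|b s IH] h; first by rewrite !big_nil ln1.
have [|e p0] := IH; first by move=> a as_; apply: h; rewrite inE as_ orbT.
have b0 : 0 < nrm (f b) by apply: h; rewrite inE eqxx.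
by rewrite !big_cons mulr_gt0 // lnM ?posrE // e.
Qed.

Lemma pow5_sum n : \sum_(1 <= k < n) (5%:R ^- k : R) <= 1 / 4.
Proof.
suff h m : \sum_(1 <= k < m.+1) (5%:R ^- k : R) = 1 / 4 - 1 / 4 * 5%:R ^- m.
  case: n => [|n]; first by rewrite big_geq //; lra.
  rewrite h; have : 0 <= 5%:R ^- n :> R by rewrite invr_ge0 exprn_ge0.
  lra.
elim: m => [|m IH]; first by rewrite big_geq // expr0 invr1 mulr1 subrr.
rewrite big_nat_recr //= IH exprS invfM; field.
by rewrite expf_neq0.
Qed.

(* [ln |P|] is approximated by the real part of a polynomial, whose coefficients are
   controlled by its positivity. *)
Lemma harnack_log (p : {poly C}) (r : R) : 0 < r ->
  (forall z, nrm z <= r -> 1 <= nrm p.[z]) ->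
  forall y, nrm y <= r / 6 ->
    `|ln (nrm p.[y]) - ln (nrm p.[0])| <= ln (nrm p.[0]) / 2.
Proof.
move=> r0 hp y yr; have [rs _ [hE _]] := nrm_factor p.
have p1 z : nrm z <= r -> 0 < nrm p.[z] by move=> /hp; lra.
have z0r : nrm (0 : C) <= r by rewrite nrm0 ltW.
have ar a : a \in rs -> r < nrm a.
  move=> ar; rewrite ltNge; apply/negP => /p1; rewrite hE => h.
  have : \prod_(b <- rs) nrm (a - b) = 0.
    by apply/eqP; rewrite prodf_seq_eq0; apply/hasP; exists a => //=; rewrite subrr nrm0.
  by move=> e; move: h; rewrite e mulr0 ltxx.
have a0 a : a \in rs -> a != 0 by move=> /ar; rewrite -nrm_gt0; lra.
have uE z : nrm z <= r -> ln (nrm p.[z]) = ln (nrm p.[0]) + \sum_(a <- rs) ln (nrm (1 - z / a)).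
  move=> zr.
  have e : nrm p.[z] = nrm p.[0] * \prod_(a <- rs) nrm (1 - z / a).
    rewrite !hE -mulrA; congr (_ * _); rewrite -big_split; apply: eq_big_seq => a /a0 an /=.
    rewrite -nrmM; congr nrm; field; exact: an.
  have [|<- pr0] := @ln_prod_nrm rs (fun a => 1 - z / a).
    move=> a ars; rewrite nrm_gt0 subr_eq0 eq_sym; apply/eqP => za.
    have : z = a by rewrite -[z](divfK (a0 a ars)) za mul1r.
    by move=> e2; have := ar a ars; rewrite -e2; lra.
  by rewrite e lnM ?posrE // p1.
have u0 : 0 <= ln (nrm p.[0]) by apply: ln_ge0; exact: hp.
set u := ln (nrm p.[0]) in u0 uE *.
apply/ler_addgt0Pr => eta eta0.
pose D : R := (size rs)%:R.
have D0 : 0 <= D by [].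
(* The approximation of each of the [D] logarithms costs [e], and [D * e] enters the final estimate
   three times: at [y], at 0 and through the shift of [Q]. *)
pose e := eta / (3 * D + 1).
have e0 : 0 < e by rewrite divr_gt0 //; lra.
have De : 3 * (D * e) <= eta.
  have : (3 * D + 1) * e = eta by rewrite /e mulrC divfK // gt_eqF //; lra.
  by move=> h; nra.
have q01 : 0 <= (5 / 6 : R) < 1 by apply/andP; split; lra.
have [L hL] := log_approx q01 e0.
pose Q : {poly C} := (cr u)%:P + \sum_(a <- rs) (L \Po (a^-1 *: 'X)).
have QE z : Q.[z] = cr u + \sum_(a <- rs) L.[z / a].
  rewrite /Q hornerD hornerC horner_sum; congr (_ + _); apply: eq_bigr => a _.
  by rewrite horner_comp hornerZ hornerX mulrC.
(* On this disc [z / a] has modulus at most 5/6 for every root [a], so the logarithms are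
   approximable; and [r / 6] is one fifth of it, which yields the geometric sum of [pow5_sum]. *)
pose s := 5 / 6 * r.
have s0 : 0 < s by rewrite /s; lra.
have app z : nrm z <= s -> `|ln (nrm p.[z]) - complex.Re Q.[z]| <= D * e.
  move=> zs; rewrite uE; last by move: zs; rewrite /s; lra.
  have ReS (t : seq C) (F : C -> C) : complex.Re (\sum_(a <- t) F a) = \sum_(a <- t) complex.Re (F a).
    by apply: (big_morph (@complex.Re R)) => // -[? ?] [? ?].
  have Rcr : complex.Re (cr u) = u by [].
  rewrite QE ReD ReS Rcr opprD addrACA subrr add0r -sumrB /D mulr_natl.
  apply: (le_trans (ler_norm_sum _ _ _)).
  rewrite big_seq; apply: (@le_trans _ _ (\sum_(a <- rs | a \in rs) e)); last first.
    by rewrite -big_seq big_const_seq count_predT iter_addr_0.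
  apply: ler_sum => a ars; apply: hL; rewrite nrmM nrmV.
  have h := ar a ars; rewrite ler_pdivrMr; last by lra.
  by move: zs; rewrite /s; lra.
(* The shift makes the real part non-negative, as [borel_car] demands; it affects only the constant
   coefficient. *)
pose Q' := Q + (cr (D * e))%:P.
have Q'k k : nrm Q'`_k.+1 * s ^+ k.+1 <= 2 * complex.Re Q'`_0.
  apply: borel_car => // z zs; rewrite /Q' hornerD hornerC ReD.
  have := app z (_ : nrm z <= s); rewrite zs lexx => /(_ isT); rewrite ler_norml => /andP[_ h].
  have : 0 <= ln (nrm p.[z]) by apply: ln_ge0; apply: hp; rewrite zs /s; lra.
  by rewrite /cr /=; lra.
have Q0 : complex.Re Q'`_0 <= u + 2 * (D * e).
  rewrite -horner_coef0 /Q' hornerD hornerC ReD.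
  have := app 0; rewrite nrm0 => /(_ (ltW s0)); rewrite -/u ler_norml => /andP[h _].
  by rewrite /cr /=; lra.
have Qk k : nrm Q`_k.+1 * s ^+ k.+1 <= 2 * (u + 2 * (D * e)).
  have := Q'k k; rewrite /Q' coefD coefC addr0; lra.
have ys : nrm y <= s by move: yr; rewrite /s; lra.
have dQ : `|complex.Re Q.[y] - complex.Re Q.[0]| <= 2 * (u + 2 * (D * e)) * (1 / 4).
  rewrite -ReB; apply: (le_trans (Re_nrm _)).
  rewrite horner_coef0 horner_coef.
  have -> : \sum_(i < size Q) Q`_i * y ^+ i - Q`_0 = \sum_(1 <= i < size Q) Q`_i * y ^+ i.
    rewrite -(big_mkord xpredT (fun i => Q`_i * y ^+ i)).
    case sQ: (size Q) => [|n]; last by rewrite big_ltn // expr0 mulr1 addrC addKr.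
    by rewrite !big_geq // nth_default ?sQ // subrr.
  apply: (le_trans (nrm_sum _ _ _)).
  set c := 2 * _ in Qk *.
  have c0 : 0 <= c by rewrite /c; have := mulr_ge0 D0 (ltW e0); lra.
  apply: (@le_trans _ _ (\sum_(1 <= i < size Q) c * 5%:R ^- i)); last first.
    by rewrite -big_distrr /= ler_wpM2l // pow5_sum.
  rewrite big_nat [leRHS]big_nat; apply: ler_sum => -[|i] //= _.
  rewrite nrmM nrmX.
  have h1 : nrm y ^+ i.+1 <= s ^+ i.+1 * 5%:R ^- i.+1.
    rewrite -exprVn -exprMn; apply: lerXn2r; rewrite ?nnegrE ?nrm_ge0 //.
      by rewrite mulr_ge0 // ltW.
    by move: yr; rewrite /s; lra.
  apply: (@le_trans _ _ (nrm Q`_i.+1 * (s ^+ i.+1 * 5%:R ^- i.+1))).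
    by rewrite ler_wpM2l ?nrm_ge0.
  by rewrite mulrA ler_wpM2r // invr_ge0 exprn_ge0.
have := app y ys; have := app 0; rewrite nrm0 -/u => /(_ (ltW s0)).
move: dQ; rewrite !ler_norml => /andP[? ?] /andP[? ?] /andP[? ?].
by apply/andP; split; lra.
Qed.

(** Since [ln |p|] varies by at most half of its value at the centre, it stays between 1/2 and 3/2
    of that value. Exponentiating and squaring gives the exponents 2 and 3. *)
Lemma harnack (p : {poly C}) (x : C) (r : R) : 0 < r ->
  (forall z, nrm (z - x) <= r -> 1 <= nrm p.[z]) ->
  forall y, nrm (y - x) <= r / 6 ->
    nrm p.[x] <= nrm p.[y] ^+ 2 /\ nrm p.[y] ^+ 2 <= nrm p.[x] ^+ 3.
Proof.
move=> r0 hp y yr.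
have h z : nrm z <= r -> 1 <= nrm (p \Po ('X + x%:P)).[z].
  by move=> zr; rewrite horner_comp !hornerE; apply: hp; rewrite addrK.
have := harnack_log r0 h yr; rewrite poly_shift -(subrr x) poly_shift ler_norml => /andP[h1 h2].
have px : 1 <= nrm p.[x] by apply: hp; rewrite subrr nrm0 ltW.
have py : 1 <= nrm p.[y] by apply: hp; lra.
have px0 : 0 < nrm p.[x] by lra.
have py0 : 0 < nrm p.[y] by lra.
have lnle (a b : R) : 0 < a -> 0 < b -> ln a <= ln b -> a <= b.
  by move=> a0 b0; rewrite ler_ln ?posrE.
split; apply: lnle; rewrite ?exprn_gt0 // !lnXn // !mulrS !mulr0n; lra.
Qed.

End Harnack.

(** * Filled Julia sets *)

Section Dynamics.
Variable R : realType.
Local Notation C := (Cplx R).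
Implicit Types (g h p q : {poly C}).

Definition itp h n : {poly C} := iter n (fun q => h \Po q) 'X.
Definition Kset h : set C := [set z | exists M : R, forall n, nrm (itp h n).[z] <= M].
Definition Eset h p : set C := [set z | Kset h p.[z]].

Lemma itpS h n z : (itp h n.+1).[z] = h.[(itp h n).[z]].
Proof. by rewrite /itp iterS horner_comp. Qed.
Lemma itp0 h z : (itp h 0).[z] = z.
Proof. by rewrite /itp /= hornerX. Qed.
Lemma itpD h m n z : (itp h (m + n)).[z] = (itp h m).[(itp h n).[z]].
Proof. by elim: m => [|m IH]; rewrite ?itp0 // addSn !itpS IH. Qed.
Lemma itpSr h n z : (itp h n.+1).[z] = (itp h n).[h.[z]].
Proof. by rewrite -addn1 itpD itpS itp0. Qed.

Lemma size_comp_gt1 p q : (1 < size p)%N -> (1 < size q)%N -> (1 < size (p \Po q))%N.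
Proof.
move=> sp sq; have := size_comp_poly p q.
by move: sp sq; case: (size p) => [|[|m]] //; case: (size q) => [|[|n]] //; case: (size _) => [|[|]].
Qed.

Lemma degM p q : (size (p \Po q)).-1 = ((size p).-1 * (size q).-1)%N.
Proof. exact: size_comp_poly. Qed.

Lemma size_itp h n : (1 < size h)%N -> (1 < size (itp h n))%N.
Proof.
by move=> sh; elim: n => [|n IH]; rewrite /itp ?iterS /= ?size_polyX //; apply: size_comp_gt1.
Qed.

Lemma deg_itp h n : (size (itp h n)).-1 = ((size h).-1 ^ n)%N.
Proof. by elim: n => [|n IH]; rewrite /itp ?iterS /= ?size_polyX // degM IH expnS. Qed.

Lemma Kset_pre h n z : Kset h (itp h n).[z] -> Kset h z.
Proof.
move=> [M hM]; elim: n z M hM => [|n IH] z M hM.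
  by exists M => k; have := hM k; rewrite itp0.
apply: (IH z (Num.max M (nrm (itp h n).[z]))) => -[|k]; first by rewrite itp0 le_max lexx orbT.
rewrite le_max itpSr -itpS; apply/orP; left; exact: hM.
Qed.

Lemma Kset_img h n z : Kset h z -> Kset h (itp h n).[z].
Proof. by move=> [M hM]; exists M => k; rewrite -itpD. Qed.

Lemma Kset_h h z : Kset h z <-> Kset h h.[z].
Proof.
have e : h.[z] = (itp h 1).[z] by rewrite itpS itp0.
by rewrite e; split; [exact: Kset_img|exact: Kset_pre].
Qed.

Lemma Eset_itp h n : Eset h (itp h n) = Kset h.
Proof. by apply/seteqP; split => z; [exact: Kset_pre|exact: Kset_img]. Qed.

Lemma Eset_comp h p q : Eset h (p \Po q) = [set z | Eset h p q.[z]].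
Proof. by apply/seteqP; split => z; rewrite /Eset /= horner_comp. Qed.

Definition escapes h (r : R) := 1 <= r /\ forall z, r <= nrm z -> 2 * nrm z <= nrm h.[z].

Lemma escapes_ex h : (2 < size h)%N -> exists r, escapes h r.
Proof. by move=> sh; have [r r1 hr] := poly_expand sh; exists r. Qed.

Lemma escapes_le h (r s : R) : escapes h r -> r <= s -> escapes h s.
Proof. by move=> [r1 hr] rs; split=> [|z sz]; [lra|apply: hr; lra]. Qed.

Lemma escapes_iter h (r : R) z : escapes h r -> r <= nrm z ->
  forall n, 2 ^+ n * nrm z <= nrm (itp h n).[z].
Proof.
move=> [r1 hr] rz; elim=> [|n IH]; first by rewrite itp0 expr0 mul1r.
have p1 : 1 <= 2 ^+ n :> R by apply: exprn_ege1; lra.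
have h1 : r <= nrm (itp h n).[z] by apply: le_trans IH; nra.
by rewrite itpS exprS -mulrA; have := hr _ h1; lra.
Qed.

Lemma pow2_ge n : n%:R <= 2 ^+ n :> R.
Proof. by rewrite -natrX ler_nat; apply: ltnW; exact: ltn_expl. Qed.

Lemma escapes_unb h (r : R) z (M : R) : escapes h r -> r <= nrm z ->
  exists N, forall n, (N <= n)%N -> M < nrm (itp h n).[z].
Proof.
move=> eh rz; have [r1 _] := eh; exists (Num.trunc `|M|).+1 => n Nn.
apply: lt_le_trans (escapes_iter eh rz n).
have h1 : M < n%:R.
  apply: (le_lt_trans (ler_norm M)); apply: (lt_le_trans (truncnS_gt _)).
  by rewrite ler_nat.
have := pow2_ge n; have : 0 <= 2 ^+ n :> R by rewrite exprn_ge0.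
by nra.
Qed.

Lemma KsetP h (r : R) z : escapes h r -> Kset h z <-> forall n, nrm (itp h n).[z] <= r.
Proof.
move=> eh; split=> [[M hM] n|h1]; last by exists r.
rewrite leNgt; apply/negP => /ltW rz.
have [N hN] := escapes_unb M eh rz; have := hN N (leqnn N).
by rewrite -itpD ltNge hM.
Qed.

Lemma escapes_down h (r : R) z : escapes h r -> nrm h.[z] <= r -> nrm z <= r.
Proof.
move=> [r1 hr] hz; rewrite leNgt; apply/negP => rz.
by have := hr z (ltW rz); lra.
Qed.

Lemma notK_escape h (r : R) z : escapes h r -> ~ Kset h z ->
  exists2 N, r < nrm (itp h N).[z] & forall n, (N <= n)%N -> r < nrm (itp h n).[z].
Proof.
move=> eh nK; have [N hN] : exists N, r < nrm (itp h N).[z].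
  apply: contrapT => h1; apply: nK; apply/(KsetP _ eh) => n.
  by rewrite leNgt; apply/negP => h2; apply: h1; exists n.
exists N => // n /subnK <-; elim: (n - N)%N => [|k IH] //.
rewrite addSn itpS; apply: (lt_le_trans IH); have [r1 hr] := eh.
by have := hr _ (ltW IH); have := nrm_ge0 (itp h (k + N)).[z]; lra.
Qed.

Lemma EsetE h p (r : R) : escapes h r ->
  Eset h p = [set z | forall n, nrm (itp h n \Po p).[z] <= r].
Proof.
move=> eh; apply/seteqP; split => z; rewrite /Eset /= => hz.
  by move=> n; rewrite horner_comp; apply: ((KsetP _ eh).1 hz).
by apply/(KsetP _ eh) => n; have := hz n; rewrite horner_comp.
Qed.

Lemma Eset_cpt h p : (2 < size h)%N -> (1 < size p)%N -> cpt (Eset h p).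
Proof.
move=> sh sp; have [r eh] := escapes_ex sh; rewrite (EsetE p eh); split.
  apply/closedCP => z hz n; have /closedCP cl := @closed_preim_le R (itp h n \Po p) r.
  by apply: cl => e /hz[w hw ?]; exists w => //; exact: hw.
have [_ b] := sublevel_cpt r sp; apply: bnd_sub b => z /(_ 0%N).
by rewrite horner_comp itp0.
Qed.

Lemma Eset_conn h p (r : R) : escapes h r -> (1 < size h)%N -> (1 < size p)%N ->
  (forall n c, (itp h n \Po p)^`().[c] = 0 -> nrm (itp h n \Po p).[c] < r) ->
  conn (Eset h p) /\ conn (~` Eset h p).
Proof.
move=> eh sh sp hc; have [r1 _] := eh.
have sn n : (1 < size (itp h n \Po p))%N by apply: size_comp_gt1 => //; exact: size_itp.
have r0 : 0 < r by lra.
have dec n z : nrm (itp h n.+1 \Po p).[z] <= r -> nrm (itp h n \Po p).[z] <= r.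
  by rewrite !horner_comp ?itpS; exact: escapes_down.
rewrite (EsetE p eh); split.
  apply: (@conn_nested R (fun n => [set z | nrm (itp h n \Po p).[z] <= r])) => n.
  - exact: sublevel_cpt.
  - exact: dec.
  - by apply: sublevel_conn => //; exact: hc.
pose V n := [set z | r < nrm (itp h n \Po p).[z]].
have [s s0 [sV _]] := superlevel_conn (sn 0%N) (ltW r0).
have Vin n : V n `<=` ~` [set z | forall n, nrm (itp h n \Po p).[z] <= r].
  by move=> z; rewrite /V /= => h1 /(_ n); rewrite leNgt h1.
have V0 n : V 0%N `<=` V n.
  elim: n => // n IH z /IH; rewrite /V /= => h1; rewrite ltNge; apply/negP => /dec.
  by rewrite leNgt h1.
have [z0 _ sz0] := @outer_unb R 0 s.
apply: (@conn_pts R _ z0) => z nz.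
have [n hn] : exists n, V n z.
  apply: contrapT => h1; apply: nz => n; rewrite leNgt; apply/negP => h2.
  by apply: h1; exists n.
have [_ _ [_ kV]] := superlevel_conn (sn n) (ltW r0).
by exists (V n); split => //; apply: V0; exact: sV.
Qed.

(** A fixed point [a] is one point. Either it has another preimage, or [h] is [a + c (z - a)^d], and
    then [c (z - a)^(d-1) = 1] gives another fixed point. *)
Lemma Kset_two h : (2 < size h)%N -> exists w1 w2, [/\ Kset h w1, Kset h w2 & w1 != w2].
Proof.
move=> sh.
have fixK z : h.[z] = z -> Kset h z.
  by move=> e; exists (nrm z); elim=> [|n IH]; rewrite ?itp0 // itpSr e.
have sX : (1 < size (h - 'X)%R)%N.
  by rewrite size_polyDl ?size_polyN ?size_polyX //; exact: ltn_trans sh.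
have [a ea] := poly_surj 0 sX.
have {}ea : h.[a] = a by move/eqP: ea; rewrite !hornerE subr_eq0 => /eqP.
have Ka := fixK _ ea.
have [[b hb ba]|hall] := pselect (exists2 b, h.[b] = a & b != a).
  exists a, b; split; rewrite 1?eq_sym //.
  by apply/Kset_h; rewrite hb.
pose q := h - a%:P.
have sq : size q = size h.
  by rewrite size_polyDl // size_polyN (leq_ltn_trans (size_polyC_leq1 a)) // ltnW.
have [rs srs e] := poly_factor q.
have lq : lead_coef q != 0 by rewrite lead_coef_eq0 -size_poly_eq0 sq; case: (size h) sh.
have rsa : all (pred1 a) rs.
  apply/allP => b brs /=; apply/eqP; apply: contrapT => /eqP ba; apply: hall.
  exists b => //; apply/eqP; rewrite -subr_eq0.
  have -> : h.[b] - a = q.[b] by rewrite /q !hornerE.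
  rewrite e hornerZ horner_prod mulf_eq0; apply/orP; right.
  rewrite prodf_seq_eq0; apply/hasP; exists b => //=.
  by rewrite hornerXsubC subrr.
have hE z : h.[z] = a + lead_coef q * (z - a) ^+ (size h).-1.
  have -> : h.[z] = a + q.[z] by rewrite /q hornerD hornerN hornerC addrC subrK.
  congr (_ + _); rewrite {1}e hornerZ horner_prod; congr (_ * _).
  rewrite -sq -srs (all_pred1P _ _ rsa) size_nseq big_nseq iter_mulr_1 //.
  by rewrite hornerXsubC.
pose p := lead_coef q *: ('X - a%:P) ^+ (size h).-2.
have sp : (1 < size p)%N.
  by rewrite size_scale // size_exp_XsubC; case: (size h) sh => [|[|[]]].
have [z ez] := poly_surj 1 sp.
rewrite /p hornerZ horner_exp hornerXsubC in ez.
exists a, z; split=> //.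
  apply: fixK; rewrite hE; have -> : (size h).-1 = (size h).-2.+1 by case: (size h) sh => [|[]].
  by rewrite exprSr mulrA ez mul1r addrC subrK.
apply/eqP => za; move: ez; rewrite za subrr expr0n.
case: (size h) sh => [|[|[|m]]] //= _; rewrite mulr0 => /eqP.
by rewrite eq_sym oner_eq0.
Qed.

Lemma Eset_surj h p w : (1 < size p)%N -> Kset h w -> exists2 z, Eset h p z & p.[z] = w.
Proof. by move=> sp Kw; have [z ez] := poly_surj w sp; exists z => //; rewrite /Eset /= ez. Qed.

Lemma Eset_two h p : (2 < size h)%N -> (1 < size p)%N ->
  exists w1 w2, [/\ Eset h p w1, Eset h p w2 & w1 != w2].
Proof.
move=> sh sp; have [w1 [w2 [K1 K2 w12]]] := Kset_two sh.
have [z1 E1 e1] := Eset_surj sp K1; have [z2 E2 e2] := Eset_surj sp K2.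
exists z1, z2; split=> //; apply: contraNneq w12 => z12.
by rewrite -e1 -e2 z12.
Qed.

(* If the roots of [p - w] lie to the left of [x], moving right from [x] pushes the value
   away from [w] exponentially in the degree. *)
Lemma push p (x w : C) (t D : R) : (1 < size p)%N -> 0 < D ->
  (forall z, p.[z] = w -> complex.Re z <= complex.Re x /\ nrm (z - x) <= D) -> 0 <= t ->
  (1 + (t / D) ^+ 2) ^+ (size p).-1 * nrm (p.[x] - w) ^+ 2 <= nrm (p.[x + cr t] - w) ^+ 2.
Proof.
move=> sp D0 hx t0; set c := 1 + (t / D) ^+ 2; pose q := p - w%:P.
have sq : size q = size p.
  by rewrite size_polyDl // size_polyN (leq_ltn_trans (size_polyC_leq1 w)).
have qE z : q.[z] = p.[z] - w by rewrite /q !hornerE.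
have [rs srs [hE hr]] := nrm_factor q; rewrite sq in srs hr.
have {}hr := hr sp; rewrite -!qE !hE !exprMn mulrCA.
apply: ler_wpM2l; first by rewrite exprn_ge0 ?nrm_ge0.
rewrite -srs.
have key a : a \in rs -> c * nrm (x - a) ^+ 2 <= nrm (x + cr t - a) ^+ 2.
  rewrite hr qE subr_eq0 => /eqP /hx[h1 h2].
  have h3 : (t / D) ^+ 2 * nrm (x - a) ^+ 2 <= t ^+ 2.
    rewrite -exprMn; apply: lerXn2r; rewrite ?nnegrE ?mulr_ge0 ?divr_ge0 ?nrm_ge0 ?(ltW D0) //.
      by rewrite invr_ge0 ltW.
    rewrite nrmB mulrAC ler_pdivrMr // ler_wpM2l //.
  rewrite /c mulrDl mul1r; move: h3; rewrite !nrm_sqr; move: (_ ^+ 2 * _) => u.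
  by move: h1; case: (x) => a1 b1; case: (a) => a2 b2; rewrite /cr /= => h1; nra.
have c0 : 0 <= c by rewrite addr_ge0 // sqr_ge0.
move: c c0 key => c c0 key.
elim: (rs) key => [|a s IH] key; first by rewrite !big_nil expr0 mul1r.
rewrite !big_cons (exprS c) !exprMn mulrACA; apply: ler_pM.
- by rewrite mulr_ge0 ?exprn_ge0 ?nrm_ge0.
- rewrite mulr_ge0 ?exprn_ge0 //.
  by apply: prodr_ge0 => b _; exact: nrm_ge0.
- by apply: key; rewrite inE eqxx.
- by apply: IH => b bs; apply: key; rewrite inE bs orbT.
Qed.

Lemma bernoulli (s : R) n : 0 <= s -> 1 + n%:R * s <= (1 + s) ^+ n.
Proof.
move=> s0; elim: n => [|n IH]; first by rewrite mul0r addr0 expr0.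
rewrite exprS -natr1; have : 0 <= n%:R * s * s by rewrite !mulr_ge0.
by move: (_ ^+ n) IH => y; nra.
Qed.

Lemma cpt_rightmost (E : set C) : cpt E -> E !=set0 ->
  exists2 x, E x & forall z, E z -> complex.Re z <= complex.Re x.
Proof. by move=> cE E0; exact: (cpt_max cE E0 (@cont_Re R E)). Qed.

Lemma cpt_diam (E : set C) x : cpt E -> exists2 D : R, 0 < D & forall z, E z -> nrm (z - x) <= D.
Proof.
move=> [_ [M hM]]; exists (`|M| + nrm x + 1); first by rewrite ltr_wpDl ?addr_ge0 ?nrm_ge0.
by move=> z /hM; have := nrmD z (- x); rewrite nrmN; have := ler_norm M; lra.
Qed.

Lemma far_of_two (w1 w2 y : C) : 
  nrm (w1 - w2) / 2 <= nrm (y - w1) \/ nrm (w1 - w2) / 2 <= nrm (y - w2).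
Proof.
have := nrm_tri w1 y w2; rewrite (nrmB w1 y).
by have [?|?] := leP (nrm (w1 - w2) / 2) (nrm (y - w1)); [left|right; lra].
Qed.

(** At the rightmost point [x] of [E], a small [t] keeps [x + t] in [Kset g], so its orbit is
    bounded. All preimages of [w1] and [w2] under the iterates lie in [E], hence to the left of [x],
    so by [push] the n-th iterate at [x + t] is exponentially far from whichever of the two is not
    close to its value at [x]. *)
Lemma noback g (E : set C) (w1 w2 : C) : (2 < size g)%N -> cpt E -> E `<=` (Kset g)^° ->
  w1 != w2 -> (forall n z, (itp g n).[z] = w1 \/ (itp g n).[z] = w2 -> E z) -> False.
Proof.
move=> sg cE EK w12 hE.
have E0 : E !=set0 by exists w1; apply: (hE 0%N); rewrite itp0; left.
have [x Ex hx] := cpt_rightmost cE E0; have [D D0 hD] := cpt_diam x cE.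
have /interiorCP[e e0 he] := EK x Ex.
pose t := e / 2; have t0 : 0 < t by rewrite /t; lra.
have [M hM] : Kset g (x + cr t).
  by apply: he; rewrite /dsk /= addrAC subrr add0r nrm_cr gtr0_norm // /t; lra.
pose d := nrm (w1 - w2) / 2.
have d0 : 0 < d by rewrite divr_gt0 // nrm_gt0 subr_eq0.
pose s := (t / D) ^+ 2; have s0 : 0 < s by rewrite exprn_gt0 // divr_gt0.
pose B := M + nrm w1 + nrm w2.
have key n : n%:R * s * d ^+ 2 <= B ^+ 2.
  have sn : (1 < size (itp g n))%N by apply: size_itp; exact: ltnW.
  have [w hw dw] : exists2 w, w = w1 \/ w = w2 & d <= nrm ((itp g n).[x] - w).
    by have [h|h] := far_of_two w1 w2 (itp g n).[x]; [exists w1|exists w2] => //; [left|right].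
  have := @push (itp g n) x w t D sn D0 _ (ltW t0); rewrite -/s => h.
  have {}h := h (fun z ez =>
    let Ez := hE n z (
      match hw with
      | or_introl e => or_introl (etrans ez e)
      | or_intror e => or_intror (etrans ez e)
      end) in conj (hx z Ez) (hD z Ez)).
  have h1 : nrm ((itp g n).[x + cr t] - w) <= B.
    have nw : nrm w <= nrm w1 + nrm w2.
      by case: hw => ->; rewrite ?lerDl ?lerDr nrm_ge0.
    apply: (le_trans (nrmD _ _)); rewrite nrmN /B -addrA; exact: lerD.
  have h2 : n%:R * s <= (1 + s) ^+ (size (itp g n)).-1.
    apply: (@le_trans _ _ ((1 + s) ^+ n)); first by apply: le_trans (bernoulli n (ltW s0)); rewrite lerDr ler01.
    apply: ler_weXn2l; first by rewrite lerDl ltW.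
    rewrite deg_itp; apply: ltnW; apply: ltn_expl.
    by case: (size g) sg => [|[|[]]].
  apply: (@le_trans _ _ (nrm ((itp g n).[x + cr t] - w) ^+ 2)); last first.
    by apply: lerXn2r; rewrite ?nnegrE ?nrm_ge0 //; apply: le_trans h1; exact: nrm_ge0.
  apply: le_trans h; apply: ler_pM => //.
  - by rewrite mulr_ge0 // ltW.
  - exact: sqr_ge0.
  - by apply: lerXn2r; rewrite ?nnegrE ?nrm_ge0 ?(ltW d0).
have c0 : 0 < s * d ^+ 2 by rewrite mulr_gt0 // exprn_gt0.
have := key (Num.trunc (B ^+ 2 / (s * d ^+ 2))).+1.
rewrite -mulrA -ler_pdivlMr // leNgt.
by rewrite truncnS_gt.
Qed.

Lemma fill_of_bdry (E : set C) : cpt E -> conn (~` E) -> fill (bdry E) = E.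
Proof.
move=> [cE bE] kC; apply/seteqP; split => z hz.
  apply: contrapT => nE.
  have uE : unb (~` E).
    apply: nbnd_unb => -[M hM]; have [N N0 hN] := cpt_bigdsk bE.
    have [w _ Mw] := @outer_unb R 0 (Num.max M N).
    have [Mw1 Mw2] : M < nrm w /\ N < nrm w by move: Mw; rewrite /= gt_max => /andP[].
    have : nrm w <= M by apply: hM => /hN; lra.
    lra.
  have [x [bx nx]] := hz _ kC uE nE.
  by apply: nx; exact: closed_bdry.
move=> T kT uT Tz; apply: contrapT => h.
have TE : T `&` bdry E = set0 by apply/seteqP; split => // w [Tw bw]; apply: h; exists w.
have := conn_bdry kT Tz hz TE => h1; apply: (unb_bnd uT).
by apply: bnd_sub bE => w /h1 /interior_subset.
Qed.

End Dynamics.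

(** * Fatou and Julia sets *)

Section JuliaFacts.
Variable R : realType.
Local Notation C := (Cplx R).
Implicit Types (g h p q f : {poly C}) (G : set {poly C}).

Lemma chord2_SS (z w : C) : chord2 (Some z) (Some w) =
  cr (4 * nrm (z - w) ^+ 2 / ((1 + nrm z ^+ 2) * (1 + nrm w ^+ 2))).
Proof.
have c4 : (4 : C) = cr 4 by rewrite /cr rmorph_nat.
have cD (x : R) : cr (1 + x) = 1 + cr x by rewrite /cr rmorphD rmorph1.
have cX (x : R) : cr (x ^+ 2) = cr x ^+ 2 by rewrite /cr rmorphXn.
rewrite /chord2 !nrmE c4 -!cX -!cD /cr.
by rewrite -!rmorphM -fmorphV -rmorphM.
Qed.

Lemma chord2_SN (z : C) : chord2 (Some z) None = cr (4 / (1 + nrm z ^+ 2)).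
Proof.
have c4 : (4 : C) = cr 4 by rewrite /cr rmorph_nat.
have cD (x : R) : cr (1 + x) = 1 + cr x by rewrite /cr rmorphD rmorph1.
have cX (x : R) : cr (x ^+ 2) = cr x ^+ 2 by rewrite /cr rmorphXn.
by rewrite /chord2 !nrmE c4 -!cX -!cD /cr -fmorphV -rmorphM.
Qed.

Lemma den_gt0 (z : C) : 0 < 1 + nrm z ^+ 2.
Proof. by rewrite ltr_wpDr // exprn_ge0 ?nrm_ge0. Qed.

Lemma chord2_lt (z w : C) (d e : R) : 0 < d -> nrm (z - w) < d -> 4 * d ^+ 2 <= e ->
  chord2 (Some z) (Some w) < cr e.
Proof.
move=> d0 zw de; rewrite chord2_SS cr_lt.
have h : nrm (z - w) ^+ 2 < d ^+ 2 by rewrite ltrXn2r ?nnegrE ?nrm_ge0 // ltW.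
rewrite ltr_pdivrMr ?mulr_gt0 ?den_gt0 //.
have h1 : 1 <= (1 + nrm z ^+ 2) * (1 + nrm w ^+ 2).
  have := exprn_ge0 2 (nrm_ge0 z); have := exprn_ge0 2 (nrm_ge0 w); nra.
have e0 : 0 <= e by apply: le_trans de; rewrite mulr_ge0 // exprn_ge0 // ltW.
by move: (_ * _) h1 => k k1; nra.
Qed.

Lemma chat_nbhs (z : C) (V : set (Chat R)) : nbhs (Some z : Chat R) V <->
  exists2 e : R, 0 < e & forall w, nrm (w - z) < e -> V (Some w).
Proof.
split=> [h|[e e0 h]].
  have /dsk_nbhs[e e0 he] : nbhs z (Some @^-1` V) by exact: h.
  by exists e.
by change (nbhs z (Some @^-1` V)); apply/dsk_nbhs; exists e.
Qed.

Lemma chat_open_dsk (z : C) (e : R) : open (Some @` dsk z e : set (Chat R)).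
Proof. by apply: one_point_compactification_open_some; exact: dsk_open. Qed.

(** The only place where normality is deduced in the chordal metric: on a Euclidean disc it suffices
    that a subsequence converges uniformly or diverges uniformly. *)
Lemma disc_Fatou G (x : C) (r : R) : 0 < r ->
  (forall f : nat -> {poly C}, (forall n, G (f n)) ->
    exists phi : nat -> nat, (forall m n, (m < n)%N -> (phi m < phi n)%N) /\
    ((exists F : C -> C, forall e : R, 0 < e -> exists N, forall n, (N <= n)%N ->
        forall y, nrm (y - x) < r -> nrm ((f (phi n)).[y] - F y) < e) \/
     (forall M : R, exists N, forall n, (N <= n)%N ->
        forall y, nrm (y - x) < r -> M < nrm (f (phi n)).[y]))) ->
  Fatou G (Some x).
Proof.
move=> r0 hG; exists (Some @` dsk x r); split.
- exact: chat_open_dsk.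
- by exists x => //; exact: dsk_center.
move=> f fG; have [phi [pi hphi]] := hG f fG; exists phi; split=> //.
have nbU y : nrm (y - x) < r -> nbhs (Some y : Chat R) (Some @` dsk x r).
  by move=> yr; apply: open_nbhs_nbhs; split; [exact: chat_open_dsk|exists y].
case: hphi => [[F hF]|hM].
  exists (fun x => if x is Some y then Some (F y) else None) => _ [y yr <-].
  exists (Some @` dsk x r); split; first exact: nbU.
  move=> _ /posC[e e0 ->].
  pose d := Num.min 1 (e / 4); have d0 : 0 < d by rewrite lt_min ltr01 divr_gt0.
  have de : 4 * d ^+ 2 <= e.
    have : d <= 1 by rewrite ge_min lexx.
    have : d <= e / 4 by rewrite ge_min lexx orbT.
    nra.
  have [N hN] := hF d d0; exists N => n Nn _ [w wr <-] _ /=.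
  by apply: chord2_lt de => //; exact: hN.
exists (fun _ => None) => _ [y yr <-].
exists (Some @` dsk x r); split; first exact: nbU.
move=> _ /posC[e e0 ->].
have [N hN] := hM (1 + 4 / e); exists N => n Nn _ [w wr <-] _.
have h := hN n Nn w wr; rewrite [ext _ _]/= chord2_SN cr_lt ltr_pdivrMr ?den_gt0 //.
have e4 : 0 < 4 / e by rewrite divr_gt0.
have h1 : 4 / e < 1 + nrm (f (phi n)).[w] ^+ 2 by nra.
by rewrite mulrC -ltr_pdivrMr.
Qed.

Lemma subseq_of_inf (P : nat -> Prop) : (forall N, exists2 n, (N <= n)%N & P n) ->
  exists phi : nat -> nat, (forall m n, (m < n)%N -> (phi m < phi n)%N) /\ forall n, P (phi n).
Proof.
move=> h; have /choice[u hu] : forall N, exists n, (N <= n)%N /\ P n.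
  by move=> N; have [n ? ?] := h N; exists n.
pose phi := fix phi n := if n is n'.+1 then u (phi n').+1 else u 0%N.
exists phi; split; last by case=> [|n]; [case: (hu 0%N)|case: (hu (phi n).+1)].
have step n : (phi n < phi n.+1)%N by have [] := hu (phi n).+1.
move=> m; elim=> // n IH; rewrite ltnS leq_eqVlt => /orP[/eqP ->|/IH k]; first exact: step.
exact: ltn_trans k (step n).
Qed.

(** The bound compares values at any two points of the disc. If the values at [x] are bounded
    infinitely often, [montel] applies to those members; otherwise they tend to infinity at [x],
    hence on the whole disc. The exponent 3 is the one produced by [harnack]. *)
Lemma control_Fatou G (x : C) (r c : R) : 0 < r -> 0 < c ->
  (forall f, G f -> forall y y', nrm (y - x) <= r -> nrm (y' - x) <= r ->
     nrm f.[y] <= c * (1 + nrm f.[y']) ^+ 3) -> Fatou G (Some x).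
Proof.
move=> r0 c0 hc; have r2 : 0 < r / 2 by lra.
have x0 : nrm (x - x) <= r by rewrite subrr nrm0 ltW.
apply: (disc_Fatou r2) => f fG.
have [[M hM]|hM] := pselect (exists M : R, forall N, exists2 n, (N <= n)%N & nrm (f n).[x] <= M).
  have [u [ui hu]] := subseq_of_inf hM.
  have [|v [vi [F hF]]] := @montel R (fun n => f (u n)) x r (c * (1 + M) ^+ 3) r0.
    move=> n z zr; apply: (le_trans (hc _ (fG (u n)) z x zr x0)).
    rewrite ler_wpM2l // ?(ltW c0) //; apply: lerXn2r.
    - by rewrite nnegrE addr_ge0 ?nrm_ge0.
    - by rewrite nnegrE addr_ge0 //; apply: le_trans (hu n); exact: nrm_ge0.
    - by rewrite lerD2l.
  exists (u \o v); split; first by move=> m n mn; apply/ui/vi.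
  left; exists F => e e0; have [N hN] := hF e e0; exists N => n Nn y yr.
  by apply: hN => //; exact: ltW.
exists id; split=> //; right=> M.
pose B := c * (1 + `|M|) ^+ 3.
have [N hN] : exists N, forall n, (N <= n)%N -> B < nrm (f n).[x].
  apply: contrapT => h; apply: hM; exists B => N; apply: contrapT => h1; apply: h.
  exists N => n Nn; rewrite ltNge; apply/negP => h2; apply: h1; by exists n.
exists N => n /hN h y yr; rewrite ltNge; apply/negP => yM.
have yr' : nrm (y - x) <= r by lra.
have := lt_le_trans h (hc _ (fG n) x y x0 yr'); rewrite ltNge => /negP; apply.
rewrite ler_wpM2l ?(ltW c0) //; apply: lerXn2r; rewrite ?nnegrE ?addr_ge0 ?nrm_ge0 // lerD2l.
by apply: (le_trans yM); exact: ler_norm.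
Qed.

Lemma Fatou_open G : open (Fatou G).
Proof.
rewrite openE => x [U [oU Ux nU]].
apply/(filterS _ (open_nbhs_nbhs (conj oU Ux))) => y Uy; by exists U.
Qed.

Lemma Julia_fin_closed G : closed (fin (Julia G)).
Proof.
have -> : fin (Julia G) = ~` [set z | Fatou G (Some z)] by [].
apply: open_closedC; apply/openCP => z Fz.
have /chat_nbhs[e e0 he] : nbhs (Some z : Chat R) (Fatou G).
  by apply: open_nbhs_nbhs; split => //; exact: Fatou_open.
by exists e.
Qed.

Lemma chord2_far (w b : C) (r : R) : 1 <= r -> 2 * nrm b <= r -> r <= nrm w ->
  chord2 (Some w) (Some b) < cr ((2 * (1 + nrm b ^+ 2))^-1) -> False.
Proof.
move=> r1 br rw; rewrite chord2_SS cr_lt => h.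
have b0 := nrm_ge0 b; have w0 : 0 < nrm w by lra.
have h1 := nrm_sub w b.
have h2 : nrm w ^+ 2 <= 4 * nrm (w - b) ^+ 2.
  have h3 : nrm w <= 2 * nrm (w - b) by lra.
  by have := nrm_ge0 (w - b); nra.
have kb := den_gt0 b; have kw := den_gt0 w.
move: h; rewrite ltr_pdivrMr ?mulr_gt0 // invfM.
have -> : 2^-1 * (1 + nrm b ^+ 2)^-1 * ((1 + nrm w ^+ 2) * (1 + nrm b ^+ 2)) = 2^-1 * (1 + nrm w ^+ 2).
  by field; rewrite gt_eqF.
have w1 : 1 <= nrm w by lra.
by nra.
Qed.

(** Points outside [Eset h p] escape, so a limit function is infinite at them. Near [z], uniformity
    makes one single composition larger than [r + 1] at all outside points, while it is at most [r]
    on [Eset h p]; continuity at the boundary point [z] forbids this. *)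
Lemma X_Julia G h p z : (2 < size h)%N -> (forall n, G (itp h n \Po p)) ->
  bdry (Eset h p) z -> Julia G (Some z).
Proof.
move=> sh hG /bdryCP bz [U [oU Uz nU]].
have [r eh] := escapes_ex sh; have [r1 hr] := eh.
have [phi [pi [H hH]]] := nU (fun n => itp h n \Po p) hG.
have [V [nV hV]] := hH _ Uz.
have /chat_nbhs[e e0 he] : nbhs (Some z : Chat R) (V `&` U).
  by apply: filterI => //; apply: open_nbhs_nbhs.
have phn n : (n <= phi n)%N.
  by elim: n => // n IH; apply: (leq_ltn_trans IH); exact: pi.
have HN y : nrm (y - z) < e -> ~ Eset h p y -> H (Some y) = None.
  move=> ye nE; case E: (H (Some y)) => [b|//]; exfalso.
  have [Vy Uy] := he y ye.
  have eh' : escapes h (Num.max r (2 * nrm b)) by apply: (escapes_le eh); rewrite le_max lexx.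
  have [N _ hN] := notK_escape eh' nE.
  have c0 : (0 : C) < cr ((2 * (1 + nrm b ^+ 2))^-1).
    by rewrite cr_gt0 invr_gt0 mulr_gt0 // den_gt0.
  have [N' hN'] := hV _ c0.
  have := hN' _ (leq_maxr N N') _ Vy Uy; rewrite E /= horner_comp.
  apply: (@chord2_far _ _ (Num.max r (2 * nrm b))).
  - by rewrite le_max r1.
  - by rewrite le_max lexx orbT.
  - by apply/ltW/hN; apply: leq_trans (phn _); exact: leq_maxl.
pose B := r + 1.
have c0 : (0 : C) < cr (4 / (1 + B ^+ 2)) by rewrite cr_gt0 divr_gt0 // ltr_wpDr // sqr_ge0.
have [N hN] := hV _ c0.
pose f := itp h (phi N) \Po p.
have far y : nrm (y - z) < e -> ~ Eset h p y -> B < nrm f.[y].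
  move=> ye nE; have [Vy Uy] := he y ye.
  have := hN N (leqnn N) _ Vy Uy; rewrite (HN y) // [ext _ _]/= chord2_SN cr_lt -/f.
  have B2 : 0 < 1 + B ^+ 2 by rewrite ltr_wpDr // sqr_ge0.
  rewrite ltr_pM2l // ltf_pV2 ?posrE ?den_gt0 // ltrD2l.
  have B0 : 0 <= B by rewrite /B; lra.
  by rewrite ltr_pXn2r ?nnegrE ?nrm_ge0.
have near_ y : Eset h p y -> nrm f.[y] <= r.
  by rewrite (EsetE p eh) => h1; exact: h1.
have half : 0 < 1 / 2 :> R by lra.
have [d d0 hd] := @poly_cont R f setT z I _ half.
have m0 : 0 < Num.min d e by rewrite lt_min d0.
have [[w Ew wz] [v nEv vz]] := bz _ m0.
move: wz vz; rewrite !lt_min => /andP[wd we] /andP[vd ve].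
have h1 := far v ve nEv; have h2 := near_ w Ew.
have h3 := hd v I vd; have h4 := hd w I wd.
have h5 := nrm_sub f.[v] f.[z]; have h6 := nrm_sub f.[z] f.[w].
rewrite (nrmB f.[z] f.[w]) in h6.
move: h1 h2 h3 h4 h5 h6; rewrite /B; move: (nrm _) (nrm _) (nrm _) (nrm _) (nrm _) => a1 a2 a3 a4 a5.
by clear; lra.
Qed.

(** A two-sided estimate of the escape rate (the Green function of the filled Julia set) at finite
    time: after taking the [(size h).-1 ^ l]-th root, the constants do not depend on [l]. *)
Lemma growth h : (2 < size h)%N -> exists A r : R, [/\ 1 <= A, escapes h r,
  (forall l w, nrm (itp h l).[w] <= (A * (1 + nrm w)) ^+ ((size h).-1 ^ l)) &
  (forall l w, r <= nrm w -> (nrm w / A) ^+ ((size h).-1 ^ l) <= nrm (itp h l).[w])].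
Proof.
move=> sh; have [r0 eh0] := escapes_ex sh.
set d := (size h).-1; have d2 : (2 <= d)%N by rewrite /d; case: (size h) sh => [|[|[]]].
have [rs srs [hE _]] := nrm_factor h; rewrite -/d in srs.
set L := nrm (lead_coef h) in hE.
have L0 : 0 < L by apply: nrm_lead_gt0; exact: ltnW.
have [S0 S00 hS] : exists2 r : R, 0 <= r & forall a, a \in rs -> nrm a <= r.
  exists (\sum_(a <- rs) nrm a); first by apply: sumr_ge0 => a _; exact: nrm_ge0.
  elim: (rs) => // b s IH a; rewrite inE big_cons => /orP[/eqP ->|/IH k].
    by rewrite lerDl sumr_ge0 // => x _; exact: nrm_ge0.
  by apply: (le_trans k); rewrite lerDr nrm_ge0.
pose m (w : C) := Num.max 1 (nrm w).
have m1 w : 1 <= m w by rewrite le_max lexx.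
pose A := Num.max 1 (Num.max (L * (1 + S0) ^+ d) (2 ^+ d / L)).
have A1 : 1 <= A by rewrite le_max lexx.
have AL : L * (1 + S0) ^+ d <= A by rewrite !le_max lexx orbT.
have AL' : 2 ^+ d / L <= A by rewrite !le_max lexx !orbT.
have prodle (t : R) (w : C) : 0 <= t -> (forall a, a \in rs -> nrm (w - a) <= t) ->
    \prod_(a <- rs) nrm (w - a) <= t ^+ d.
  move=> t0; rewrite -srs; elim: (rs) => [|b s IH] k; first by rewrite big_nil expr0.
  rewrite big_cons exprS; apply: ler_pM; rewrite ?nrm_ge0 //.
  - by apply: prodr_ge0 => a _; exact: nrm_ge0.
  - by apply: k; rewrite inE eqxx.
  - by apply: IH => a as_; apply: k; rewrite inE as_ orbT.
have prodge (t : R) (w : C) : 0 <= t -> (forall a, a \in rs -> t <= nrm (w - a)) ->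
    t ^+ d <= \prod_(a <- rs) nrm (w - a).
  move=> t0; rewrite -srs; elim: (rs) => [|b s IH] k; first by rewrite big_nil expr0.
  rewrite big_cons exprS; apply: ler_pM; rewrite ?exprn_ge0 //.
  - by apply: k; rewrite inE eqxx.
  - by apply: IH => a as_; apply: k; rewrite inE as_ orbT.
have up w : nrm h.[w] <= A * m w ^+ d.
  rewrite hE; apply: (@le_trans _ _ (L * (m w * (1 + S0)) ^+ d)).
    rewrite ler_wpM2l ?(ltW L0) //; apply: prodle.
      by apply: mulr_ge0; [have := m1 w|]; lra.
    move=> a /hS aS; have := nrmD w (- a); rewrite nrmN.
    have : nrm w <= m w by rewrite le_max lexx orbT.
    have := m1 w; move: (m w) (nrm (w - a)) (nrm w) => x y z; clear - aS S00; nra.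
  rewrite exprMn mulrCA mulrC ler_wpM2r // exprn_ge0 //; have := m1 w; lra.
have A0 : 0 < A by lra.
have AA : A * A <= A ^+ d by rewrite -expr2; apply: ler_weXn2l.
(* The factor [A] on the left makes the inequality iterate. It is absorbed because [A >= 1] and the
   degree is at least 2. *)
have upm w : A * m h.[w] <= (A * m w) ^+ d.
  have k1 : 1 <= A * m w ^+ d.
    by have := m1 w => /(exprn_ege1 d) k; have := A1; move: (_ ^+ d) k => x; clear; nra.
  have k2 : m h.[w] <= A * m w ^+ d by rewrite ge_max k1 up.
  rewrite exprMn; apply: (@le_trans _ _ (A * (A * m w ^+ d))); first by rewrite ler_wpM2l // ltW.
  by rewrite mulrA ler_wpM2r // exprn_ge0 //; have := m1 w; lra.
pose r := Num.max r0 (2 * S0).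
have eh : escapes h r by apply: (escapes_le eh0); rewrite le_max lexx.
have low w : r <= nrm w -> (nrm w / A) ^+ d <= nrm h.[w] / A.
  move=> rw; have Sw : 2 * S0 <= nrm w by apply: le_trans rw; rewrite le_max lexx orbT.
  have k1 : (nrm w / 2) ^+ d <= \prod_(a <- rs) nrm (w - a).
    apply: prodge; first by rewrite divr_ge0 ?nrm_ge0.
    by move=> a /hS aS; have k := nrm_sub w a; clear - aS S00 Sw k; lra.
  rewrite expr_div_n ler_pdivrMr ?exprn_gt0 // in k1.
  rewrite hE expr_div_n ler_pdivrMr ?exprn_gt0 //.
  have w0 : 0 <= nrm w ^+ d by rewrite exprn_ge0 ?nrm_ge0.
  move: k1; move: (\prod_(a <- rs) _) (nrm w ^+ d) w0 => P W W0 k1.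
  have k2 : 2 ^+ d <= A * L by rewrite -ler_pdivrMr.
  have P0 : 0 <= P.
    by have := exprn_gt0 d (ltr0n R 2); move: (_ ^+ d) k1 => T; clear - W0; nra.
  have k3 : W <= P * (A * L) by apply: (le_trans k1); rewrite ler_wpM2l.
  have k4 : P * (A * L) <= L * P / A * A ^+ d.
    have -> : P * (A * L) = L * P / A * (A * A) by field; rewrite gt_eqF.
    by rewrite ler_wpM2l // divr_ge0 ?mulr_ge0 ?(ltW L0) ?(ltW A0).
  exact: (le_trans k3 k4).
exists A, r; split=> // l w.
  have k : A * m (itp h l).[w] <= (A * m w) ^+ (d ^ l).
    elim: l => [|l IH]; first by rewrite itp0 expn0 expr1.
    rewrite itpS expnSr exprM; apply: (le_trans (upm _)); apply: lerXn2r => //;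
      rewrite nnegrE ?exprn_ge0 // mulr_ge0 ?(ltW A0) //; apply: le_trans (m1 _); exact: ler01.
  have k1 : nrm (itp h l).[w] <= A * m (itp h l).[w].
    have : nrm (itp h l).[w] <= m (itp h l).[w] by rewrite le_max lexx orbT.
    have := m1 (itp h l).[w]; move: (m _) (nrm _) => x y; clear - A1; nra.
  apply: (le_trans k1); apply: (le_trans k); apply: lerXn2r; rewrite ?nnegrE.
  - by apply: mulr_ge0; [exact: ltW|apply: le_trans (m1 _); exact: ler01].
  - by apply: mulr_ge0; [exact: ltW|rewrite addr_ge0 ?nrm_ge0].
  - by rewrite ler_wpM2l ?(ltW A0) // ge_max lerDl nrm_ge0 lerDr ler01.
move=> rw.
have k : (nrm w / A) ^+ (d ^ l) <= nrm (itp h l).[w] / A.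
  elim: l => [|l IH]; first by rewrite itp0 expn0 expr1.
  have rl : r <= nrm (itp h l).[w].
    apply: le_trans (escapes_iter eh rw l); rewrite -[leLHS]mul1r.
    have [r1 _] := eh; apply: ler_pM => //; first by apply: le_trans r1.
    by apply: exprn_ege1; rewrite ler1n.
  rewrite itpS expnSr exprM; apply: le_trans (low _ rl); apply: lerXn2r => //;
    by rewrite nnegrE ?exprn_ge0 // divr_ge0 ?nrm_ge0 // ltW.
by apply: (le_trans k); rewrite ler_pdivrMr // ler_peMr // nrm_ge0.
Qed.

(** If [f.[y]] is large for one [y], the disc misses [Eset h f] altogether, and by compactness some
    iterate [itp h l \Po f] has modulus at least 1 on a smaller disc. The index [l] depends on [f],
    but [growth] removes it from Harnack's inequality by a root extraction, leaving a bound uniform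
    over [G]. *)
Lemma density G h z (e : R) : (2 < size h)%N -> (forall f, G f -> (1 < size f)%N) ->
  Julia G (Some z) -> 0 < e -> exists2 p, G p & exists2 w, bdry (Eset h p) w & nrm (w - z) < e.
Proof.
move=> sh sG Jz e0; apply: contrapT => no; apply: Jz.
have [A [r [A1 eh up low]]] := growth sh; have [r1 _] := eh.
set d := (size h).-1 in up low.
have A0 : 0 < A by lra.
(* [r] serves the case of a value of modulus at most [r]; [A ^+ 5] collects [A ^+ 2] and [A ^+ 3]
   from the two bounds of [growth]. The radius [e / 24] puts [y] within a sixth of [e / 2] of
   [y']. *)
pose c := r + A ^+ 5; have c0 : 0 < c by rewrite /c ltr_wpDr ?exprn_ge0 ?ltW //; lra.
have e24 : 0 < e / 24 by lra.
apply: (control_Fatou e24 c0) => f Gf y y' ye y'e.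
have cge (t : R) : 0 <= t -> c <= c * (1 + t) ^+ 3.
  by move=> t0; rewrite -[leLHS]mulr1 ler_wpM2l ?(ltW c0) // exprn_ege1 // lerDl.
have [fr|rf] := leP (nrm f.[y]) r.
  apply: (le_trans fr); apply: le_trans (cge _ (nrm_ge0 _)).
  by rewrite /c lerDl exprn_ge0 // ltW.
have nb w : nrm (w - z) < e -> ~ bdry (Eset h f) w.
  by move=> we bw; apply: no; exists f => //; exists w.
have nE w : nrm (w - z) < e -> ~ Eset h f w.
  move=> we Ew.
  have Db : dsk z e `&` bdry (Eset h f) = set0 by apply/seteqP; split => // x [/nb].
  have /(_ y) := conn_bdry (@conn_dsk R z e) we Ew Db.
  have yz : dsk z e y by rewrite /dsk /=; lra.
  move=> /(_ yz) /interior_subset; rewrite (EsetE f eh) => /(_ 0%N).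
  by rewrite horner_comp itp0 leNgt rf.
pose D := [set w | nrm (w - y') <= e / 2].
have Dz w : D w -> nrm (w - z) < e.
  by rewrite /D /= => h1; have := nrm_tri w y' z; lra.
have [l hl] : exists l, forall w, D w -> 1 <= nrm (itp h l \Po f).[w].
  apply: contrapT => h1.
  have [w hw] : exists w, forall n, (D `&` [set w | nrm (itp h n \Po f).[w] <= r]) w.
    apply: (@cpt_nested R (fun n => D `&` [set w | nrm (itp h n \Po f).[w] <= r])).
    - apply: (cpt_closed_sub (B := D)); last exact: closed_dsk_cpt.
        by move=> ? [].
      by apply: closedI; [case: (closed_dsk_cpt y' (e / 2))|exact: closed_preim_le].
    - by move=> n; apply: closedI; [case: (closed_dsk_cpt y' (e / 2))|exact: closed_preim_le].
    - move=> n w [Dw]; rewrite /= !horner_comp ?itpS => h2; split=> //=.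
      exact: (escapes_down eh h2).
    - move=> n; apply: contrapT => h2; apply: h1; exists n => w Dw.
      rewrite leNgt; apply/negP => h3; apply: h2; exists w; split=> //=.
      by apply: ltW; apply: (lt_le_trans h3).
  apply: (nE w); first by apply: Dz; case: (hw 0%N).
  by rewrite (EsetE f eh) => n; case: (hw n).
have yy' : nrm (y - y') <= e / 2 / 6.
  by have := nrm_tri y z y'; rewrite (nrmB z y'); lra.
have e2 : 0 < e / 2 by lra.
have [_] := harnack e2 hl yy'; rewrite !horner_comp => hk.
have dl0 : (0 < d ^ l)%N by rewrite expn_gt0 /d; case: (size h) sh => [|[|[]]].
have k1 := low l _ (ltW rf); have k2 := up l f.[y'].
set a := nrm f.[y] / A in k1; set b := A * (1 + nrm f.[y']) in k2.
have a0 : 0 <= a by rewrite divr_ge0 ?nrm_ge0 // ltW.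
have b0 : 0 <= b by rewrite mulr_ge0 ?addr_ge0 ?nrm_ge0 // ltW.
have ab : a ^+ 2 <= b ^+ 3.
  rewrite -(@ler_pXn2r _ (d ^ l)) ?nnegrE ?exprn_ge0 // -!exprM ![(_ * d ^ l)%N]mulnC !exprM.
  apply: (@le_trans _ _ (nrm (itp h l).[f.[y]] ^+ 2)).
    by apply: lerXn2r; rewrite ?nnegrE ?exprn_ge0 ?nrm_ge0.
  apply: (le_trans hk).
  by apply: lerXn2r; rewrite ?nnegrE ?exprn_ge0 ?nrm_ge0.
have f1 : 1 <= nrm f.[y] by lra.
have k3 : nrm f.[y] ^+ 2 <= A ^+ 5 * (1 + nrm f.[y']) ^+ 3.
  move: ab; rewrite /a /b expr_div_n exprMn ler_pdivrMr ?exprn_gt0 //.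
  by rewrite mulrAC -exprD.
apply: (@le_trans _ _ (nrm f.[y] ^+ 2)).
  by rewrite expr2 ler_peMl // (le_trans _ f1).
apply: (le_trans k3); rewrite ler_wpM2r ?exprn_ge0 ?addr_ge0 ?nrm_ge0 //.
by rewrite /c lerDr; lra.
Qed.

(** A family omitting a fixed disc around [u]: [harnack] applies to [(f - u) / d], whose modulus is
    at least 1. *)
Lemma omit_Fatou G (x u : C) (r d : R) : 0 < r -> 0 < d ->
  (forall f, G f -> forall y, nrm (y - x) <= r -> d <= nrm (f.[y] - u)) -> Fatou G (Some x).
Proof.
move=> r0 d0 hG.
pose K := d * ((1 + nrm u) / d) ^+ 3; pose c := K + nrm u + 1.
have nu := nrm_ge0 u.
have q0 : 0 <= K.
  by rewrite /K mulr_ge0 ?exprn_ge0 ?divr_ge0 ?addr_ge0 // ltW.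
have c0 : 0 < c by rewrite /c; lra.
have r12 : 0 < r / 24 by lra.
apply: (control_Fatou r12 c0) => f Gf y y' yr y'r.
pose P := (cr d^-1) *: (f - u%:P).
have PE w : nrm P.[w] = nrm (f.[w] - u) / d.
  by rewrite /P hornerZ hornerD hornerN hornerC nrmM nrm_cr ger0_norm ?invr_ge0 ?(ltW d0) // mulrC.
have hP w : nrm (w - y') <= r / 2 -> 1 <= nrm P.[w].
  move=> wr; rewrite PE ler_pdivlMr // mul1r; apply: hG => //.
  by have := nrm_tri w y' x; lra.
have yy' : nrm (y - y') <= r / 2 / 6.
  by have := nrm_tri y x y'; rewrite (nrmB x y'); lra.
have r2 : 0 < r / 2 by lra.
have [_ hk] := harnack r2 hP yy'; rewrite !PE in hk.
have P1 : 1 <= nrm (f.[y] - u) / d.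
  by rewrite ler_pdivlMr // mul1r; apply: hG => //; lra.
have k1 : nrm (f.[y'] - u) <= (1 + nrm f.[y']) * (1 + nrm u).
  apply: (le_trans (nrmD _ _)); rewrite nrmN; have := nrm_ge0 f.[y'].
  by move: (nrm f.[y']) => t; clear - nu; nra.
set t := 1 + nrm f.[y'] in k1 *.
have t1 : 1 <= t by rewrite lerDl nrm_ge0.
have k2 : (nrm (f.[y] - u) / d) ^+ 2 <= t ^+ 3 * ((1 + nrm u) / d) ^+ 3.
  apply: (le_trans hk); rewrite -exprMn; apply: lerXn2r.
  - by rewrite nnegrE divr_ge0 ?nrm_ge0 // ltW.
  - rewrite nnegrE; apply: mulr_ge0; first by apply: le_trans t1.
    by apply: divr_ge0; [rewrite addr_ge0|exact: ltW].
  by rewrite mulrA ler_pM2r ?invr_gt0.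
have t3 : 1 <= t ^+ 3 by rewrite exprn_ege1.
have k3 : nrm f.[y] <= nrm (f.[y] - u) + nrm u.
  by have := nrmD (f.[y] - u) u; rewrite subrK.
have k4 : nrm (f.[y] - u) <= K * t ^+ 3.
  have -> : nrm (f.[y] - u) = d * (nrm (f.[y] - u) / d) by rewrite mulrC divfK ?gt_eqF.
  rewrite /K -mulrA ler_wpM2l ?(ltW d0) // [leRHS]mulrC; apply: le_trans k2.
  by rewrite expr2 ler_peMl // (le_trans _ P1).
apply: (le_trans k3); apply: (@le_trans _ _ (K * t ^+ 3 + nrm u * t ^+ 3)); last first.
  by rewrite /c !mulrDl lerDl mul1r; apply: le_trans t3.
by apply: lerD => //; rewrite ler_peMr.
Qed.

End JuliaFacts.

(** * Capacity bound for connected sets *)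

Section Capacity.
Variable R : realType.
Local Notation C := (Cplx R).
Implicit Types q : {poly C}.

Lemma conn_dist_value (E : set C) a b (v : R) : conn E -> E a -> E b ->
  0 <= v <= nrm (b - a) -> exists2 z, E z & nrm (z - a) = v.
Proof.
move=> kE Ea Eb /andP[v0 vb]; apply: contrapT => h.
have [v0'|vn] := eqVneq v 0; first by apply: h; exists a; rewrite // subrr nrm0.
have : nrm (b - a) < v; last by lra.
apply: (kE (fun z => nrm (z - a) < v) _ a b) => //; last by rewrite subrr nrm0 lt0r vn.
move=> z Ez; have zv : nrm (z - a) != v by apply/eqP => e; apply: h; exists z.
exists `|nrm (z - a) - v| => [|w Ew wz]; first by rewrite normr_gt0 subr_eq0.
have h1 := nrm_tri w z a; have h2 := nrm_tri z w a; rewrite (nrmB z w) in h2.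
move: wz; have [zv'|zv'] := ltP (nrm (z - a)) v.
  by rewrite ltr0_norm ?subr_lt0 // => wz; split=> // _; lra.
rewrite ger0_norm ?subr_ge0 // => wz; split=> // h3; exfalso; lra.
Qed.

Lemma lead_lagrange q (e : nat) (z : 'I_e.+1 -> C) : (size q <= e.+1)%N -> injective z ->
  q`_e = \sum_j q.[z j] / \prod_(m | m != j) (z j - z m).
Proof.
move=> sq iz.
pose B j : {poly C} := \prod_(m | m != j) ('X - (z m)%:P).
have sB j : size (B j) = e.+1.
  rewrite /B -big_filter size_prod_XsubC size_filter -sum1_count; congr S.
  by rewrite sum1_card (eq_card (B := predC1 j)) // cardC1 card_ord.
have BE j x : (B j).[x] = \prod_(m | m != j) (x - z m).
  by rewrite /B horner_prod; apply: eq_bigr => m _; rewrite hornerXsubC.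
have w0 j : \prod_(m | m != j) (z j - z m) != 0.
  by apply/prodf_neq0 => m mj; rewrite subr_eq0 (inj_eq iz) eq_sym.
pose P : {poly C} := \sum_j (q.[z j] / \prod_(m | m != j) (z j - z m)) *: B j.
have PE i : P.[z i] = q.[z i].
  rewrite /P horner_sum (bigD1 i) //= hornerZ BE divfK // big1 ?addr0 // => j ji.
  have b0 : (B j).[z i] = 0.
    by rewrite BE (bigD1 i) /= 1?eq_sym // subrr mul0r.
  by rewrite hornerZ b0 mulr0.
have sP : (size P <= e.+1)%N.
  by apply: (leq_trans (size_sum _ _ _)); apply/bigmax_leqP => j _; apply: leq_trans (size_scale_leq _ _) _; rewrite sB.
have qP : q = P.
  apply/eqP; rewrite -subr_eq0; apply/eqP.
  apply: (@roots_geq_poly_eq0 _ _ [seq z i | i <- enum 'I_e.+1]).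
  - by apply/allP => _ /mapP[i _ ->]; rewrite /root !hornerE PE subrr.
  - by rewrite map_inj_uniq // enum_uniq.
  - rewrite size_map size_enum_ord (leq_trans (size_polyD _ _)) // geq_max sq size_polyN //.
have lB j : (B j)`_e = 1.
  have : B j \is monic by apply: monic_prod_XsubC.
  by rewrite monicE lead_coefE sB => /eqP.
rewrite {1}qP /P coef_sum; apply: eq_bigr => j _.
by rewrite coefZ lB mulr1.
Qed.

Lemma prod_dist (e j : nat) : (j <= e)%N ->
  (\prod_(0 <= m < e.+1 | m != j) (maxn j m - minn j m) = j`! * (e - j)`!)%N.
Proof.
move=> je; rewrite (@big_cat_nat _ _ _ j) //=; last by rewrite ltnW.
congr (_ * _)%N.
  rewrite fact_prod big_add1 /= [RHS]big_nat_rev /= big_nat_cond [RHS]big_nat_cond.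
  apply: eq_big => [m|m /andP[/andP[_ mj] _]]; last by lia.
  by apply/idP/idP; lia.
rewrite big_ltn_cond // eqxx /= -{1}[j.+1]add0n -{1}(subnK je) -addnS big_addn addnK.
rewrite fact_prod big_add1 /= big_nat_cond [RHS]big_nat_cond.
apply: eq_big => [m|m _]; last by lia.
by apply/idP/idP; lia.
Qed.

(** [e ^ e] is at most the falling factorial of [2 * e] of length [e], which is [e]! times a central
    binomial coefficient, itself at most [2 ^ (2 * e)]. *)
Lemma pow_le_fact e : (e ^ e <= e`! * 4 ^ e)%N.
Proof.
have h1 : (e ^ e <= (2 * e) ^_ e)%N.
  rewrite ffact_prod -[in X in (X <= _)%N](card_ord e) -prod_nat_const.
  by apply: leq_prod => i _; have := ltn_ord i; rewrite ?card_ord; lia.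
apply: (leq_trans h1); rewrite -bin_ffact mulnC leq_mul2l; apply/orP; right.
have -> : (4 ^ e = (1 + 1) ^ (2 * e))%N by rewrite expnM.
rewrite expnDn; have e2 : (e < (2 * e).+1)%N by rewrite ltnS leq_pmull.
by rewrite (bigD1 (Ordinal e2)) //= !exp1n !muln1 leq_addr.
Qed.

(** Connectedness provides [e + 1] points of [E] at equally spaced distances from [a], where [e] is
    the degree. Lagrange interpolation at them expresses the leading coefficient; the node products
    are bounded below by factorials, whose reciprocals sum to [2 ^ e / e]!, and [pow_le_fact]
    contributes [4 ^ e], whence the 8. *)
Lemma cap_bound q (E : set C) (a b : C) (M : R) : (1 < size q)%N -> conn E -> E a -> E b ->
  a != b -> (forall z, E z -> nrm q.[z] <= M) ->
  nrm (lead_coef q) <= M * (8 / nrm (b - a)) ^+ (size q).-1.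
Proof.
move=> sq kE Ea Eb ab hM; set L := nrm (b - a).
have L0 : 0 < L by rewrite nrm_gt0 subr_eq0 eq_sym.
case sqe : (size q) sq => [|[|e']] // _; set e := e'.+1; rewrite /=.
have e0 : 0 < e%:R :> R by rewrite ltr0n.
pose s := L / e%:R; have s0 : 0 < s by rewrite divr_gt0.
have /choice[z hz] : forall j : 'I_e.+1, exists z, E z /\ nrm (z - a) = j%:R * s.
  move=> j; have [|z Ez ez] := @conn_dist_value E a b (j%:R * s) kE Ea Eb; last by exists z.
  rewrite mulr_ge0 ?(ltW s0) //= -/L /s mulrA ler_pdivrMr // mulrC ler_pM2l // ler_nat.
  by rewrite -ltnS.
have dist (j m : 'I_e.+1) : (maxn j m - minn j m)%N%:R * s <= nrm (z j - z m).
  have h1 := nrm_tri (z j) (z m) a; have h2 := nrm_tri (z m) (z j) a.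
  rewrite (nrmB (z m) (z j)) in h2; rewrite !(hz _).2 in h1 h2.
  rewrite natrB; last by lia.
  by rewrite mulrBl; case: (leqP j m) => jm; rewrite ?(maxn_idPr jm) ?(minn_idPl jm)
    ?(maxn_idPl (ltnW jm)) ?(minn_idPr (ltnW jm)); lra.
have iz : injective z.
  move=> j m zz; apply/val_inj/eqP; apply: contraT => jm.
  have := dist j m; rewrite zz subrr nrm0 leNgt mulr_gt0 // ltr0n.
  by move: jm; rewrite /=; lia.
have le := @lead_lagrange q e z; rewrite sqe in le.
have -> : lead_coef q = q`_e by rewrite lead_coefE sqe.
rewrite le //; apply: (le_trans (nrm_sum _ _ _)).
have M0 : 0 <= M by apply: le_trans (hM _ Ea); exact: nrm_ge0.
have den (j : 'I_e.+1) : (j`! * (e - j)`!)%N%:R * s ^+ e <= \prod_(m | m != j) nrm (z j - z m).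
  have -> : (j`! * (e - j)`!)%N%:R * s ^+ e =
      \prod_(m < e.+1 | m != j) ((maxn j m - minn j m)%N%:R * s).
    rewrite big_split /= -prod_dist -1?ltnS // natr_prod big_mkord; congr (_ * _).
    by rewrite prodr_const (eq_card (B := predC1 j)) // cardC1 card_ord.
  by apply: ler_prod => m _; rewrite dist mulr_ge0 // ltW.
apply: (@le_trans _ _ (\sum_(j < e.+1) M / ((j`! * (e - j)`!)%N%:R * s ^+ e))).
  apply: ler_sum => j _; rewrite nrmM nrmV nrm_prod.
  have p0 : 0 < (j`! * (e - j)`!)%N%:R * s ^+ e by rewrite mulr_gt0 ?exprn_gt0 // ltr0n muln_gt0 !fact_gt0.
  apply: ler_pM; rewrite ?nrm_ge0 ?invr_ge0 //.
  - by apply: prodr_ge0 => m _; exact: nrm_ge0.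
  - by apply: hM; case: (hz j).
  - by rewrite lef_pV2 ?posrE // (lt_le_trans p0).
have f0 k : (k`!)%:R != 0 :> R by rewrite pnatr_eq0 -lt0n fact_gt0.
have -> : \sum_(j < e.+1) M / ((j`! * (e - j)`!)%N%:R * s ^+ e) =
    M / s ^+ e * (2 ^ e)%N%:R / (e`!)%:R.
  have -> : (2 ^ e = \sum_(j < e.+1) 'C(e, j))%N.
    rewrite -[2%N]/(1 + 1)%N expnDn; apply: eq_bigr => j _.
    by rewrite !exp1n !muln1.
  rewrite natr_sum big_distrr big_distrl /=; apply: eq_bigr => j _.
  have je : (j <= e)%N by rewrite -ltnS.
  rewrite -(bin_fact je) !natrM; field.
  have c0 : 'C(e, j)%:R != 0 :> R by rewrite pnatr_eq0 -lt0n bin_gt0.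
  by rewrite ?f0 ?c0 ?expf_neq0 ?gt_eqF.
rewrite -!mulrA ler_wpM2l //.
have -> : (s ^+ e)^-1 = e%:R ^+ e / L ^+ e.
  by rewrite /s expr_div_n invfM invrK mulrC.
have -> : (8 / L) ^+ e = 2 ^+ e * 4 ^+ e / L ^+ e.
  by rewrite -exprMn -expr_div_n; congr ((_ / _) ^+ _); ring.
have k1 : e%:R ^+ e / (e`!)%:R <= 4 ^+ e :> R.
  rewrite ler_pdivrMr ?ltr0n ?fact_gt0 // mulrC -!natrX -natrM ler_nat.
  exact: pow_le_fact.
have -> : e%:R ^+ e / L ^+ e * ((2 ^ e)%N%:R / (e`!)%:R) = 2 ^+ e / L ^+ e * (e%:R ^+ e / (e`!)%:R) :> R.
  by rewrite natrX; ring.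
have -> : 2 ^+ e * 4 ^+ e / L ^+ e = 2 ^+ e / L ^+ e * 4 ^+ e by ring.
by rewrite ler_wpM2l // divr_ge0 ?exprn_ge0 // ltW.
Qed.

End Capacity.

(** * Postcritically bounded semigroups *)

Section Semigroup.
Variable R : realType.
Local Notation C := (Cplx R).
Implicit Types (g h p q : {poly C}) (G : set {poly C}).

(* [h] is a fixed element of [G]; all sets [Eset h p], [p] in [G], are then preimages of
   one filled Julia set, and their boundaries are dense in [J(G)]. *)
Definition pcb G h (r : R) := [/\ G h, forall p q, G p -> G q -> G (p \Po q),
  forall p, G p -> (2 < size p)%N, escapes h r &
  forall p c, G p -> p^`().[c] = 0 -> nrm p.[c] < r].

Variables (G : set {poly C}) (h : {poly C}) (r : R).
Hypothesis H : pcb G h r.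

Local Notation E := (Eset h).
Local Notation X p := (bdry (Eset h p)).
Local Notation S := (fin (Julia G)).

Lemma pcb_h : G h. Proof. by case: H. Qed.
Lemma pcb_comp p q : G p -> G q -> G (p \Po q). Proof. by case: H => _ + _ _ _; apply. Qed.
Lemma pcb_size p : G p -> (2 < size p)%N. Proof. by case: H => _ _ + _ _; apply. Qed.
Lemma pcb_size1 p : G p -> (1 < size p)%N. Proof. by move=> /pcb_size /ltnW. Qed.
Lemma pcb_esc : escapes h r. Proof. by case: H. Qed.
Lemma pcb_crit p c : G p -> p^`().[c] = 0 -> nrm p.[c] < r. Proof. by case: H => _ _ _ _; apply. Qed.

Lemma closure_sub_closed (A B : set C) : A `<=` B -> closed B -> closure A `<=` B.
Proof. by move=> AB cB z /(closure_subset AB); rewrite -(closure_id B).1. Qed.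

Lemma itp1 g : itp g 1 = g. Proof. by rewrite /itp /= comp_polyXr. Qed.

Lemma pcb_itp g n : G g -> G (itp g n.+1).
Proof.
move=> Gg; elim: n => [|n IH]; first by rewrite itp1.
by rewrite /itp iterS; exact: pcb_comp.
Qed.

Lemma itpS_comp g p n : itp g n.+1 \Po p = g \Po (itp g n \Po p).
Proof. by rewrite comp_polyA. Qed.

Lemma pcb_itp_comp g p n : G g -> G p -> G (itp g n \Po p).
Proof.
move=> Gg Gp; elim: n => [|n IH]; first by rewrite /itp /= comp_polyX.
by rewrite itpS_comp; exact: pcb_comp.
Qed.

Lemma E_cpt p : G p -> cpt (E p).
Proof. by move=> Gp; apply: Eset_cpt; [exact: pcb_size pcb_h|exact: pcb_size1]. Qed.

Lemma E_conn_compl p : G p -> conn (E p) /\ conn (~` E p).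
Proof.
move=> Gp; apply: (Eset_conn pcb_esc); [exact: pcb_size1 pcb_h|exact: pcb_size1|].
by move=> n c; apply: pcb_crit; apply: pcb_itp_comp => //; exact: pcb_h.
Qed.
Lemma E_conn p : G p -> conn (E p). Proof. by case/E_conn_compl. Qed.

Lemma E_closed p : G p -> closed (E p). Proof. by case/E_cpt. Qed.

Lemma X_conn p : G p -> conn (X p).
Proof. by move=> Gp; have [? ?] := E_conn_compl Gp; apply: bdry_conn => //; exact: E_cpt. Qed.

Lemma X_sub_E p : G p -> X p `<=` E p.
Proof. by move=> Gp; apply: closed_bdry; exact: E_closed. Qed.

Lemma X_cpt p : G p -> cpt (X p).
Proof.
by move=> Gp; apply: (cpt_closed_sub (X_sub_E Gp) _ (E_cpt Gp)); exact: bdry_closed.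
Qed.

Lemma fillX p : G p -> fill (X p) = E p.
Proof. by move=> Gp; apply: fill_of_bdry; [exact: E_cpt|case: (E_conn_compl Gp)]. Qed.

Lemma fillE p : G p -> fill (E p) = E p.
Proof.
move=> Gp; apply/seteqP; split; last exact: sub_fill.
by rewrite -{2}(fillX Gp); apply: fill_trans; rewrite fillX.
Qed.

Lemma X_S p : G p -> X p `<=` S.
Proof.
move=> Gp z; apply: X_Julia; first exact: pcb_size pcb_h.
by move=> n; apply: pcb_itp_comp => //; exact: pcb_h.
Qed.

Lemma E_two p : G p -> exists w1 w2, [/\ E p w1, E p w2 & w1 != w2].
Proof. by move=> Gp; apply: Eset_two; [exact: pcb_size pcb_h|exact: pcb_size1]. Qed.

Lemma X_ne p : G p -> X p !=set0.
Proof.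
move=> Gp; have [w [_ [Ew _ _]]] := E_two Gp; apply: contrapT => h0.
move: Ew; rewrite -(fillX Gp).
have -> : X p = set0 by apply/seteqP; split => // x hx; apply: h0; exists x.
by apply: far_notin_fill.
Qed.

Lemma dens z (e : R) : S z -> 0 < e -> exists2 p, G p & exists2 w, X p w & nrm (w - z) < e.
Proof. by move=> Sz; apply: density Sz; [exact: pcb_size pcb_h|exact: pcb_size1]. Qed.

Definition XX : set (set C) := [set X p | p in G].

Lemma dens_closure : S `<=` closure (\bigcup_(Y in XX) Y).
Proof.
move=> z Sz; apply/closureCP => e e0; have [p Gp [w Xw wz]] := dens Sz e0.
by exists w => //; exists (X p) => //; exists p.
Qed.

Lemma XX_conn Y : XX Y -> conn Y /\ Y `<=` S.
Proof. by case=> p Gp <-; split; [exact: X_conn|exact: X_S]. Qed.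

Lemma E_absorb p Y y : G p -> conn Y -> Y `&` X p = set0 -> Y y -> E p y -> Y `<=` (E p)^°.
Proof. by move=> Gp kY YX Yy Ey; exact: (conn_bdry kY Yy Ey YX). Qed.

Lemma X_sub_fill p F : G p -> X p `<=` F -> E p `<=` fill F.
Proof. by move=> Gp XF; rewrite -(fillX Gp); exact: fill_mono. Qed.

Lemma X_E_sub p q : G p -> G q -> X p `<=` E q -> E p `<=` E q.
Proof. by move=> Gp Gq /(X_sub_fill Gp); rewrite fillE. Qed.

Lemma Kset_E : Kset h = E h.
Proof. by rewrite -{3}(itp1 h) Eset_itp. Qed.

Lemma KhatE z : Khat G z <-> forall p, G p -> E p z.
Proof.
split=> [/bounded_setP[M hM] p Gp|hz].
  exists M => n; rewrite -horner_comp; apply: hM; exists (itp h n \Po p) => //.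
  by apply: pcb_itp_comp => //; exact: pcb_h.
apply/bounded_setP; exists r => _ [p Gp <-].
by have := (KsetP p.[z] pcb_esc).1 (hz p Gp) 0%N; rewrite itp0.
Qed.

(* The witness is a critical value of [h]. *)
Lemma Khat_ne : exists z, forall p, G p -> E p z.
Proof.
have sh := pcb_size pcb_h.
have [c hc] : exists c, h^`().[c] = 0.
  apply: poly_surj; rewrite ltnNge; apply/negP => sd.
  have : h^`()`_(size h).-2 = 0 by apply: nth_default; apply: (leq_trans sd); case: (size h) sh => [|[|[]]].
  rewrite coef_deriv => /eqP; rewrite mulrn_eq0 /=.
  have -> : (size h).-2.+1 = (size h).-1 by case: (size h) sh => [|[|]].
  by rewrite -lead_coefE lead_coef_eq0 -size_poly_eq0; case: (size h) sh.
exists h.[c]; apply/KhatE/bounded_setP; exists r => _ [p Gp <-].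
rewrite -horner_comp; apply/ltW/pcb_crit; first by apply: pcb_comp => //; exact: pcb_h.
by rewrite deriv_comp hornerM hc mulr0.
Qed.

(** If [Y] meets [F], it stays in [F] because [F] is clopen; if it only meets the filling, it cannot
    cross [F] to leave it. *)
Lemma clo_fill_dich F Y : clo S F -> cpt F -> conn Y -> Y `<=` S ->
  Y `<=` fill F \/ Y `&` fill F = set0.
Proof.
move=> cF kF kY YS; have [[y [Yy fy]]|no] := pselect (Y `&` fill F !=set0); last first.
  by right; apply/seteqP; split => // y hy; apply: no; exists y.
left; have [[x [Yx Fx]]|no] := pselect (Y `&` F !=set0).
  by move=> z Yz; apply: sub_fill; exact: (clo_conn cF kY YS Yx Fx).
apply: fill_cross Yy fy => //; apply/seteqP; split => // x hx; apply: no; by exists x.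
Qed.

Lemma clo_fill_compl_closed F : clo S F -> cpt F -> closed (S `\` fill F).
Proof.
move=> [FS cF cG] kF.
have -> : S `\` fill F = (S `\` F) `\` (fill F `\` F).
  apply/seteqP; split => z.
    by move=> [Sz nf]; split; [split=> // /sub_fill|move=> []].
  move=> [[Sz nF] h1]; split => // ff; apply: h1; by split.
rewrite setDE; apply: closedI => //; apply: open_closedC; exact: fill_open.
Qed.

End Semigroup.

(** * Boundedness of the finite Julia set *)

Section Bounded.
Variable R : realType.
Local Notation C := (Cplx R).
Implicit Types (g h p q : {poly C}) (G : set {poly C}).

Lemma itp_Sr h n : itp h n.+1 = itp h n \Po h.
Proof.
have iS k : itp h k.+1 = h \Po itp h k by [].
elim: n => [|n IH]; first by rewrite itp1 /itp /= comp_polyX.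
by rewrite (iS n.+1) {1}IH comp_polyA -iS.
Qed.

Lemma prod_le_pow (rs : seq C) (x : C) (t : R) : 0 <= t ->
  (forall a, a \in rs -> nrm (x - a) <= t) -> \prod_(a <- rs) nrm (x - a) <= t ^+ size rs.
Proof.
move=> t0; elim: rs => [|b s IH] k; first by rewrite big_nil expr0.
rewrite big_cons exprS; apply: ler_pM; rewrite ?nrm_ge0 //.
- by apply: prodr_ge0 => a _; exact: nrm_ge0.
- by apply: k; rewrite inE eqxx.
- by apply: IH => a as_; apply: k; rewrite inE as_ orbT.
Qed.

Lemma bound_by_lead p (x w : C) (D : R) : (1 < size p)%N -> 0 <= D ->
  (forall z, p.[z] = w -> nrm (x - z) <= D) ->
  nrm (p.[x] - w) <= nrm (lead_coef p) * D ^+ (size p).-1.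
Proof.
move=> sp D0 hD; pose q := p - w%:P.
have sq : size q = size p.
  by rewrite size_polyDl // size_polyN (leq_ltn_trans (size_polyC_leq1 w)).
have lq : lead_coef q = lead_coef p.
  by rewrite lead_coefDl // size_polyN (leq_ltn_trans (size_polyC_leq1 w)).
have qE z : q.[z] = p.[z] - w by rewrite /q !hornerE.
have [rs srs [hE hr]] := nrm_factor q; rewrite sq in srs hr.
rewrite -qE hE lq ler_wpM2l ?nrm_ge0 // -srs; apply: prod_le_pow => // a.
by rewrite (hr sp) qE subr_eq0 => /eqP /hD.
Qed.

(** The 15 is 4 + 6 + 4 + 1: for [t] at most 1, [(1 + t) ^+ 4] is at most [1 + 15 t]. *)
Lemma pow4_le (s : R) : 0 <= s -> (1 + Num.min 1 s / 15) ^+ 4 <= 1 + s.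
Proof.
move=> s0; set t := Num.min 1 s / 15.
have t0 : 0 <= t by rewrite divr_ge0 // le_min ler01.
have h1 : t <= 1 / 15 by rewrite ler_pM2r ?invr_gt0 // ge_min lexx.
have h2 : 15 * t <= s by rewrite mulrC divfK ?pnatr_eq0 // ge_min lexx orbT.
move: t t0 h1 h2 => t t0 h1 h2.
have a2 : t ^+ 2 <= t by rewrite expr2; nra.
have a3 : t ^+ 3 <= t by rewrite exprS; nra.
have a4 : t ^+ 4 <= t by rewrite exprS; nra.
have -> : (1 + t) ^+ 4 = 1 + 4 * t + 6 * t ^+ 2 + 4 * t ^+ 3 + t ^+ 4 by ring.
lra.
Qed.

Section Core.
Variables (G : set {poly C}) (h : {poly C}) (r : R).
Hypothesis H : pcb G h r.
Local Notation E := (Eset h).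
Local Notation X p := (bdry (Eset h p)).
Local Notation S := (fin (Julia G)).
Variable Q1 : set C.
Hypotheses (cQ : clo S Q1) (kQ : cpt Q1) (nQ : Q1 !=set0) (uS : ~ bnd S).

Let Q := fill Q1.
Let small p := G p /\ X p `<=` Q.
Let deg p := (size p).-1.

Local Lemma dich p : G p -> small p \/ X p `&` Q = set0.
Proof.
move=> Gp.
have [h1|h1] := clo_fill_dich cQ kQ (X_conn H Gp) (X_S H Gp); [left|right] => //.
Qed.

Local Lemma small_E p : small p -> E p `<=` Q.
Proof. by move=> [Gp Xp]; apply: subset_trans (X_sub_fill H Gp Xp) _; exact: fill_idem. Qed.

Let Y := closure (\bigcup_(p in small) E p).

Local Lemma kQf : cpt Q. Proof. exact: fill_cpt. Qed.

Local Lemma Y_Q : Y `<=` Q.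
Proof.
apply: closure_sub_closed; last by case: kQf.
by move=> z [p sp]; exact: small_E.
Qed.

Local Lemma small_Y p : small p -> E p `<=` Y.
Proof. by move=> sp z Ez; apply: subset_closure; exists p. Qed.

Local Lemma small_ex : exists p, small p.
Proof.
have [x Qx] := nQ.
have [Z [p Gp <-] [XQ _]] := dense_clo cQ Qx (XX_conn H) (@dens_closure R G h r H).
by exists p; split=> // z /XQ /sub_fill.
Qed.

(** [x] is the rightmost point of [Y]. A large [E p] contains every small one, as it shares the
    point [z0] with it and its boundary avoids [Q]; so it contains [x], and then a disc around [x]
    on which [S] stays inside [Q]. *)
Local Lemma geometry : exists x : C, exists t D : R, [/\ 0 < t, 1 <= D,
  forall z, Y z -> complex.Re z <= complex.Re x, forall z, Y z -> nrm (z - x) <= D &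
  forall p, G p -> X p `&` Q = set0 -> E p (x + cr t)].
Proof.
have cY : cpt Y by apply: (cpt_closed_sub Y_Q _ kQf); exact: closed_closure.
have [p0 sp0] := small_ex; have [z0 hz0] := Khat_ne H.
have Y0 : Y z0 by apply: (small_Y sp0); apply: hz0; case: sp0.
have [x Yx hx] := cpt_rightmost cY (ex_intro _ z0 Y0); have [D D0 hD] := cpt_diam x cY.
have [|e e0 he] := notin_closed (clo_fill_compl_closed cQ kQ) (z := x).
  by move=> [_]; apply; exact: Y_Q.
exists x, (e / 2), (Num.max 1 D); split=> //; first by lra.
- by rewrite le_max lexx.
- by move=> z /hD h1; rewrite le_max h1 orbT.
move=> p Gp XQ.
have Ex : E p x.
  apply: (closure_sub_closed _ (E_closed H Gp) Yx) => z [q sq Eqz].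
  have [Gq _] := sq.
  have EX : E q `&` X p = set0.
    by apply/seteqP; split => // w [/(small_E sq) Qw Xw]; have : (X p `&` Q) w by []; rewrite XQ.
  exact: interior_subset (E_absorb Gp (E_conn H Gq) EX (hz0 _ Gq) (hz0 _ Gp) Eqz).
have DX : dsk x e `&` X p = set0.
  apply/seteqP; split => // w [/he nw Xw]; apply: nw; split; first exact: (X_S H Gp).
  by move=> Qw; have : (X p `&` Q) w by []; rewrite XQ.
apply: (@interior_subset _ (E p)).
apply: (E_absorb Gp (@conn_dsk R x e) DX (dsk_center x e0) Ex).
by rewrite /dsk /= addrAC subrr add0r nrm_cr gtr0_norm; lra.
Qed.

Local Lemma E_unb (B : R) : exists2 q, G q & exists2 v, E q v & B < nrm v.
Proof.
apply: contrapT => h1; apply: uS; exists (B + 1) => s Ss; rewrite leNgt; apply/negP => Bs.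
have [q Gq [w Xw ws]] := dens H Ss ltr01.
apply: h1; exists q => //; exists w; first exact: (X_sub_E H Gq).
by have := nrm_sub s w; rewrite nrmB; lra.
Qed.

(* Between a large [q \o p] and the eventually small [q \o h^k \o p] there is a last large one:
   its connected filled set is long, which makes the leading coefficient tiny. *)
Local Lemma step x (t D : R) : 0 < t ->
  (forall z, Y z -> complex.Re z <= complex.Re x) ->
  (forall p, G p -> X p `&` Q = set0 -> E p (x + cr t)) ->
  forall p, small p -> exists q, [/\ G q, E q p.[x + cr t] & small (q \Po (h \Po p))].
Proof.
move=> t0 hx large p sp; have [Gp _] := sp; set y := x + cr t.
have [M M0 hM] := cpt_bigdsk kQf.2; have [B B0 hB] := poly_bnd p M.
have [q Gq [v Ev Bv]] := E_unb B.
pose f k := (q \Po itp h k) \Po p.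
have Gqk k : G (q \Po itp h k).
  case: k => [|k]; first by rewrite /itp /= comp_polyXr.
  by apply: (pcb_comp H) => //; apply: (pcb_itp H); exact: (pcb_h H).
have Gf k : G (f k) by apply: (pcb_comp H).
have f0 : ~ small (f 0%N).
  move=> /small_E sf; have [v' ev] := poly_surj v (pcb_size1 H Gp).
  have Ev' : E (f 0%N) v' by rewrite /f /itp /= comp_polyXr Eset_comp /= ev.
  have := hB v' (ltW (hM v' (sf _ Ev'))); rewrite ev; lra.
have [k nk sk] : exists2 k, ~ small (f k) & small (f k.+1).
  apply: contrapT => no.
  have all_ k : ~ small (f k).
    elim: k => [|k IH]; [exact: f0|move=> sk; apply: no].
    by exists k; [exact: IH|exact: sk].
  have Ey k : E (f k) y.
    by have [/all_ []|/(large _ (Gf k))] := dich (Gf k).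
  have [Mq hMq] := (E_cpt H Gq).2.
  have Epy : E p y.
    exists Mq => k; apply: hMq.
    by have := Ey k; rewrite /f Eset_comp Eset_comp.
  have := hx y (small_Y sp Epy); rewrite /y /cr.
  by case: (x) => a b /=; lra.
exists (q \Po itp h k); split; first exact: Gqk.
  by have [/nk []|/(large _ (Gf k))] := dich (Gf k); rewrite /f Eset_comp.
have <- : f k.+1 = (q \Po itp h k) \Po (h \Po p); last exact: sk.
by rewrite /f itp_Sr !comp_polyA.
Qed.

Local Lemma lead_comp p q : (1 < size q)%N ->
  nrm (lead_coef (p \Po q)) = nrm (lead_coef p) * nrm (lead_coef q) ^+ deg p.
Proof. by move=> sq; rewrite lead_coef_comp // nrmM nrmX. Qed.

Local Lemma size_gt_deg p : G p -> (1 < deg p)%N.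
Proof. by move=> /(pcb_size H); rewrite /deg; case: (size p) => [|[|[]]]. Qed.

(** The quantity [lam p], the logarithm of the leading coefficient divided by the degree, is bounded
    below on small [p]: all preimages of [w1] and [w2] are within [D] of [x], while one of the two
    is at least [dl] away from [p.[x]]. Passing from [p] to the small [q \Po (h \Po p)] given by
    [step] lowers [lam] by a fixed amount, because [E q] contains both [z0] and the remote value
    [p.[y]]. *)
Lemma julia_bounded : False.
Proof.
have [x [t [D [t0 D1 hx hD large]]]] := geometry.
have [z0 hz0] := Khat_ne H.
have [w1 [w2 [K1 K2 w12]]] := Kset_two (pcb_size H (pcb_h H)).
pose dl := nrm (w1 - w2) / 2.
have dl0 : 0 < dl by rewrite divr_gt0 // nrm_gt0 subr_eq0.
have D0 : 0 < D by lra.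
have rootY p w z : small p -> w = w1 \/ w = w2 -> p.[z] = w -> Y z.
  move=> sp hw ez; apply: (small_Y sp); rewrite /Eset /= ez.
  by case: hw => ->.
have farw (v : C) : exists2 w, w = w1 \/ w = w2 & dl <= nrm (v - w).
  by have [h1|h1] := far_of_two w1 w2 v; [exists w1|exists w2] => //; [left|right].
pose s := (t / D) ^+ 2; have s0 : 0 < s by rewrite exprn_gt0 // divr_gt0.
pose s' := Num.min 1 s / 15.
have s'0 : 0 < s' by rewrite divr_gt0 // lt_min ltr01.
(* [push] bounds a squared distance by the power of [1 + s]; with [th ^+ 4] below [1 + s], the
   distance itself grows like [U ^+ 2]. One factor [U] is kept, the other is spent on the
   constants. *)
pose th := 1 + s'.
have th1 : 1 < th by rewrite ltrDl.
have th4 : th ^+ 4 <= 1 + s.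
  by apply: pow4_le; first exact: ltW.
pose d := deg h; have d1 : (1 < d)%N by apply: size_gt_deg; exact: (pcb_h H).
pose a := nrm (lead_coef h).
have a0 : 0 < a by apply: nrm_lead_gt0; exact: (pcb_size1 H (pcb_h H)).
pose M := Num.max 1 r; have M1 : 1 <= M by rewrite le_max lexx.
pose W := nrm (w1 - z0) + nrm (w2 - z0).
(* [8 * M] comes from [cap_bound], and [a] cancels the leading coefficient of [h] in the
   composition. *)
pose ka := 8 * M * a; have ka0 : 0 < ka by rewrite !mulr_gt0 //; lra.
have W0 : 0 <= W by rewrite addr_ge0 ?nrm_ge0.
(* From this degree on, Bernoulli's inequality makes [U * dl] exceed [ka + W]. *)
pose N0 := (Num.trunc ((ka + W) / (s' * dl))).+1.
have step2 p : small p -> exists p', [/\ small p', (2 * deg p <= deg p')%N &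
    (N0 <= deg p)%N -> exists e, [/\ (0 < e)%N, deg p' = (e * (d * deg p))%N &
      nrm (lead_coef p') <= (nrm (lead_coef p) ^+ d / th ^+ deg p) ^+ e]].
  move=> sp; have [Gp _] := sp; have [q [Gq Eqy sq]] := step D t0 hx large sp.
  have sz := pcb_size1 H Gp; have Gh := pcb_h H.
  have Ghp := pcb_comp H Gh Gp; have shp := pcb_size1 H Ghp.
  have dE : deg (q \Po (h \Po p)) = (deg q * (d * deg p))%N by rewrite /deg !degM.
  have q1 := size_gt_deg Gq.
  exists (q \Po (h \Po p)); split=> //.
    rewrite dE; have := leq_mul (ltnW q1) (leq_mul d1 (leqnn (deg p))).
    by rewrite mul1n.
  move=> Np; exists (deg q); split=> //; first exact: ltnW.
  set e := deg q; set y := x + cr t in Eqy.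
  pose U := th ^+ deg p.
  have U1 : 1 <= U by apply: exprn_ege1; exact: ltW.
  have Ubig : ka + W <= U * dl.
    have h1 : 1 + (deg p)%:R * s' <= U by apply: bernoulli; exact: ltW.
    have h2 : (ka + W) / (s' * dl) < (deg p)%:R.
      by apply: (lt_le_trans (truncnS_gt _)); rewrite ler_nat.
    move: h2; rewrite (ltr_pdivrMr _ _ (mulr_gt0 s'0 dl0)) => h2.
    have h3 : (deg p)%:R * s' * dl <= U * dl by rewrite ler_wpM2r ?(ltW dl0) //; lra.
    rewrite mulrA in h2; lra.
  have [w hw wx] := farw p.[x].
  have py : U ^+ 2 * dl <= nrm (p.[y] - w).
    have Ud : 0 <= U ^+ 2 * dl by apply: mulr_ge0; [exact: sqr_ge0|exact: ltW].
    rewrite -(@ler_pXn2r _ 2) ?nnegrE ?nrm_ge0 //.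
    have h1 := @push R p x w t D sz D0
      (fun z ez => conj (hx z (rootY p w z sp hw ez)) (hD z (rootY p w z sp hw ez))) (ltW t0).
    apply: le_trans h1; rewrite exprMn; apply: ler_pM.
    - by rewrite !exprn_ge0 //; lra.
    - exact: sqr_ge0.
    - have -> : (U ^+ 2) ^+ 2 = (th ^+ 4) ^+ deg p.
        have e4 : (U ^+ 2) ^+ 2 = U ^+ 4 by rewrite -exprM.
        by rewrite e4 /U -[LHS]exprM -[RHS]exprM mulnC.
      apply: lerXn2r; [|rewrite nnegrE addr_ge0 ?(ltW s0) //|exact: th4].
      by rewrite nnegrE exprn_ge0 // ltW // (lt_trans _ th1).
    - by apply: lerXn2r; rewrite ?nnegrE ?nrm_ge0 ?(ltW dl0).
  set L := nrm (p.[y] - z0).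
  have LU : ka * U <= L.
    have h1 := nrm_tri p.[y] z0 w.
    have h2 : nrm (z0 - w) <= W.
      by rewrite nrmB /W; case: hw => ->; rewrite ?lerDl ?lerDr nrm_ge0.
    have h3 : U * (ka + W) <= U ^+ 2 * dl by rewrite expr2 -mulrA ler_wpM2l //; lra.
    have h4 : W <= U * W by rewrite ler_peMl.
    rewrite mulrDr (mulrC U ka) in h3; rewrite -/L in h1.
    rewrite -(lerD2r W); apply: (@le_trans _ _ (ka * U + U * W)); first by rewrite lerD2l.
    apply: (le_trans h3); apply: (le_trans py); apply: (le_trans h1).
    by rewrite lerD2l.
  have L0 : 0 < L by apply: lt_le_trans LU; rewrite mulr_gt0 //; lra.
  have yz : z0 != p.[y] by rewrite eq_sym -subr_eq0 -nrm_gt0.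
  have qM z : E q z -> nrm q.[z] <= M.
    move=> Eqz; have := (KsetP q.[z] (pcb_esc H)).1 Eqz 0%N; rewrite itp0 => h1.
    by apply: (le_trans h1); rewrite le_max lexx orbT.
  have := cap_bound (pcb_size1 H Gq) (E_conn H Gq) (hz0 _ Gq) Eqy yz qM.
  rewrite -/L -/(deg q) -/e => cap.
  have cap2 : nrm (lead_coef q) <= (a * U)^-1 ^+ e.
    apply: (le_trans cap).
    have h1 : M * (8 / L) ^+ e <= (M * (8 / L)) ^+ e.
      rewrite [leRHS]exprMn ler_wpM2r ?exprn_ge0 ?divr_ge0 ?(ltW L0) //.
      by rewrite -[leLHS]expr1; apply: ler_weXn2l => //; exact: ltnW.
    apply: (le_trans h1); apply: lerXn2r.
    - by rewrite nnegrE mulr_ge0 ?divr_ge0 ?(ltW L0) //; lra.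
    - by rewrite nnegrE invr_ge0 mulr_ge0 ?(ltW a0) //; lra.
    have aU : 0 < a * U by rewrite mulr_gt0 // (lt_le_trans _ U1).
    rewrite mulrA ler_pdivrMr // -(ler_pM2l aU) [leRHS]mulrA divff ?gt_eqF // mul1r.
    by apply: le_trans LU; rewrite /ka; have -> : a * U * (M * 8) = 8 * M * a * U by ring.
  rewrite lead_comp // lead_comp // -/a -/d -/U -/e.
  apply: (@le_trans _ _ ((a * U)^-1 ^+ e * (a * nrm (lead_coef p) ^+ d) ^+ e)).
    by rewrite ler_wpM2r // exprn_ge0 // mulr_ge0 ?(ltW a0) ?exprn_ge0 ?nrm_ge0.
  rewrite -exprMn; have -> : (a * U)^-1 * (a * nrm (lead_coef p) ^+ d) = nrm (lead_coef p) ^+ d / U.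
    by field; rewrite !gt_eqF //; lra.
  by [].
pose lam p := ln (nrm (lead_coef p)) / (deg p)%:R.
have dp0 p : small p -> 0 < (deg p)%:R :> R.
  by move=> [Gp _]; rewrite ltr0n; exact: ltnW (size_gt_deg Gp).
have lp0 p : small p -> 0 < nrm (lead_coef p).
  by move=> [Gp _]; apply: nrm_lead_gt0; exact: (pcb_size1 H Gp).
have low p : small p -> - `|ln dl| - ln D <= lam p.
  move=> sp; have [Gp _] := sp; have [w hw wx] := farw p.[x].
  have h1 := @bound_by_lead p x w D (pcb_size1 H Gp) (ltW D0).
  have {}h1 : nrm (p.[x] - w) <= nrm (lead_coef p) * D ^+ deg p.
    by apply: h1 => z ez; rewrite nrmB; apply: hD; exact: (rootY p w z).
  have h2 : ln dl <= ln (nrm (lead_coef p) * D ^+ deg p).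
    have q0 : 0 < nrm (lead_coef p) * D ^+ deg p by apply: mulr_gt0; [exact: lp0|exact: exprn_gt0].
    by rewrite ler_ln ?posrE //; exact: (le_trans wx h1).
  rewrite lnM ?posrE ?lp0 ?exprn_gt0 // lnXn // -mulr_natl in h2.
  have dp := dp0 _ sp; rewrite /lam ler_pdivlMr //.
  have dp1 : 1 <= (deg p)%:R :> R by rewrite ler1n; exact: ltnW (size_gt_deg Gp).
  have h3 : - `|ln dl| * (deg p)%:R <= - `|ln dl| by rewrite mulNr lerN2 ler_peMr.
  have h4 := ler_norm (- ln dl); rewrite normrN in h4.
  rewrite mulrBl (mulrC (ln D)) lerBlDr; apply: (le_trans h3); apply: le_trans h2.
  by rewrite lerNl.
(* The gain [th ^+ deg p] in the leading coefficient, raised to the power [e] and normalised by the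
   new degree [e * (d * deg p)], lowers [lam] by exactly this amount. *)
pose c := ln th / d%:R.
have c0 : 0 < c by rewrite divr_gt0 ?ln_gt0 // ltr0n ltnW.
have big n : exists2 p, small p & (n <= deg p)%N.
  have [p0 sp0] := small_ex.
  elim: n => [|n [p sp np]]; first by exists p0.
  have [p' [sp' dp' _]] := step2 p sp; exists p' => //; apply: leq_trans dp'.
  have [Gp _] := sp; have := size_gt_deg Gp; move: (deg p) np => k nk k1.
  by apply: (leq_ltn_trans nk); rewrite mul2n -addnn -[ltnLHS]addn0 ltn_add2l ltnW.
have [p1 sp1 Np1] := big N0.
have down n : exists p, [/\ small p, (N0 <= deg p)%N & lam p <= lam p1 - n%:R * c].
  elim: n => [|n [p [sp Np lp]]]; first by exists p1; rewrite mul0r subr0.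
  have [p' [sp' dp' hp']] := step2 p sp; have [e [e0 dE le]] := hp' Np.
  exists p'; split=> //.
    by apply: (leq_trans Np); apply: leq_trans dp'; rewrite leq_pmull.
  apply: (@le_trans _ _ (lam p - c)); last by rewrite -natr1 mulrDl mul1r opprD addrA lerD2r.
  have l0 := lp0 _ sp; have l0' := lp0 _ sp'; have q0 := dp0 _ sp.
  have thp : 0 < th by rewrite (lt_trans _ th1).
  have h1 : ln (nrm (lead_coef p')) <= e%:R * (d%:R * ln (nrm (lead_coef p)) - (deg p)%:R * ln th).
    have b0 : 0 < nrm (lead_coef p) ^+ d / th ^+ deg p by rewrite divr_gt0 ?exprn_gt0.
    apply: (@le_trans _ _ (ln ((nrm (lead_coef p) ^+ d / th ^+ deg p) ^+ e))).
      by rewrite ler_ln ?posrE ?exprn_gt0.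
    rewrite lnXn // -[leLHS]mulr_natl ler_wpM2l // lnM ?posrE ?invr_gt0 ?exprn_gt0 //.
    by rewrite lnV ?posrE ?exprn_gt0 // !lnXn // [d%:R * _]mulr_natl [_ * ln th]mulr_natl.
  have d0 : 0 < d%:R :> R by rewrite ltr0n ltnW.
  have er : 0 < e%:R :> R by rewrite ltr0n.
  rewrite {1}/lam dE ler_pdivrMr; last by rewrite !natrM !mulr_gt0.
  apply: (le_trans h1); rewrite /lam /c !natrM le_eqVlt; apply/orP; left; apply/eqP.
  by field; rewrite !gt_eqF.
pose B := `|ln dl| + ln D + lam p1.
have [p [sp _ lp]] := down (Num.trunc (B / c)).+1.
have := low p sp; have : B < (Num.trunc (B / c)).+1%:R * c.
  by rewrite -ltr_pdivrMr // truncnS_gt.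
rewrite /B => h1 h2; have h3 := le_trans h2 lp.
move: h3; rewrite leNgt => /negP; apply.
by move: h1; move: (`|ln dl|) (ln D) (lam p1) (_ * c) => b1 b2 b3 b4 ?; lra.
Qed.

End Core.
End Bounded.

(** * The order of the components *)

Section ComponentOrder.
Variable R : realType.
Local Notation C := (Cplx R).
Implicit Types (T M K F : set C).

Lemma comp_disj T x y : cc T x = cc T y \/ cc T x `&` cc T y = set0.
Proof.
have [[w [h1 h2]]|no] := pselect (cc T x `&` cc T y !=set0).
  by left; rewrite (cc_eq h1) (cc_eq h2).
by right; apply/seteqP; split => // w hw; apply: no; exists w.
Qed.

Lemma comp_total T x y z : cpt T -> T x -> T y -> fill (cc T x) z -> fill (cc T y) z ->
  cc T x `<=` fill (cc T y) \/ cc T y `<=` fill (cc T x).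
Proof.
move=> cT Tx Ty fx fy; have [->|dis] := comp_disj T x y; first by left; exact: sub_fill.
exact: (fill_nest (cc_cpt x cT) (cc_cpt y cT) (@cc_conn _ T x) (@cc_conn _ T y) dis fx fy).
Qed.

Lemma comp_antisym T x y : cpt T -> T x -> cc T x `<=` fill (cc T y) ->
  cc T y `<=` fill (cc T x) -> cc T x = cc T y.
Proof.
move=> cT Tx h1 h2; have [//|dis] := comp_disj T x y; exfalso.
apply: (fill_antisym (cc_cpt x cT) (cc_cpt y cT) _ dis h1 h2).
by exists x; exact: cc_refl.
Qed.

Lemma comp_surr T x y : cpt T -> T x -> surr (cc T x) (cc T y) <-> cc T x `<=` fill (cc T y).
Proof.
move=> cT Tx; split=> [/surr_fill[->|//]|h]; first exact: sub_fill.
have [->|dis] := comp_disj T x y; first by left.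
apply: fill_surr dis _ h; first exact: cc_conn.
  by exists x; exact: cc_refl.
exact: (cc_cpt y cT).2.
Qed.

(** The common point [z] makes the order total by [comp_total], so a minimal component is a least
    one. *)
Lemma minimal_least T M z : cpt T -> (forall x, T x -> fill (cc T x) z) -> minimal_comp T M ->
  exists2 x, T x & M = cc T x /\ forall y, T y -> cc T x `<=` fill (cc T y).
Proof.
move=> cT hz [[x Tx ->] hM]; exists x => //; split=> // y Ty.
have [//|h] := comp_total cT Tx Ty (hz x Tx) (hz y Ty).
have <- : cc T y = cc T x; last exact: sub_fill.
by apply: hM; [exists y|apply/(comp_surr _ cT Ty)].
Qed.

Lemma maximal_greatest T M z : cpt T -> (forall x, T x -> fill (cc T x) z) -> maximal_comp T M ->
  exists2 x, T x & M = cc T x /\ forall y, T y -> cc T y `<=` fill (cc T x).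
Proof.
move=> cT hz [[x Tx ->] hM]; exists x => //; split=> // y Ty.
have [//|h] := comp_total cT Ty Tx (hz y Ty) (hz x Tx).
have -> : cc T y = cc T x; last exact: sub_fill.
by apply: hM; [exists y|apply/(comp_surr _ cT Tx)].
Qed.

(** The component of a point [m] of [T] nearest to [z]. The segment from [z] to [m] meets [T] at [m]
    only, so any other component, which surrounds [z], surrounds [m] as well. *)
Lemma minimal_ex T z : cpt T -> T !=set0 -> (forall x, T x -> fill (cc T x) z) ->
  exists M, minimal_comp T M.
Proof.
move=> cT T0 hz; have [m Tm hm] := cpt_min cT T0 (@cont_nrmB R T z).
exists (cc T m); split; first by exists m.
move=> _ [y Ty ->] /(comp_surr _ cT Ty) h.
have [//|dis] := comp_disj T y m; apply: comp_antisym => //.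
have nm : ~ cc T y m.
  move=> ym; have : (cc T y `&` cc T m) m by split=> //; exact: cc_refl.
  by rewrite dis.
pose s := [set w | exists2 t : R, 0 <= t <= 1 & w = z + cr t * (m - z)].
have sK : s `&` cc T y = set0.
  apply/seteqP; split => // w [[t /andP[t0 t1] ew] yw].
  have := hm w (cc_sub yw); rewrite ew addrAC subrr add0r nrmM nrm_cr ger0_norm // => k.
  have [mz|mz] := eqVneq m z.
    by apply: nm; rewrite mz; move: yw; rewrite ew mz subrr mulr0 addr0.
  have p0 : 0 < nrm (m - z) by rewrite nrm_gt0 subr_eq0.
  have t1' : t = 1 by apply/eqP; rewrite eq_le t1 -(ler_pM2r p0) mul1r.
  by apply: nm; move: yw; rewrite ew t1' /cr rmorph1 mul1r addrC subrK.
have sz : s z by exists 0; rewrite ?lexx ?ler01 // /cr rmorph0 mul0r addr0.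
have sm : s m by exists 1; rewrite ?lexx ?ler01 // /cr rmorph1 mul1r addrC subrK.
have fm := fill_cross (@conn_segment R z m) sK sz (hz y Ty) sm.
apply: (fill_cross (@cc_conn _ T m) _ (cc_refl Tm) fm).
by rewrite setIC.
Qed.

Lemma maximal_ex T : cpt T -> T !=set0 -> exists M, maximal_comp T M.
Proof.
move=> cT T0; have [m Tm hm] := cpt_max cT T0 (@cont_nrmB R T 0).
exists (cc T m); split; first by exists m.
move=> _ [y Ty ->] /(comp_surr _ cT Tm) h.
have [//|dis] := comp_disj T y m; exfalso.
apply: (@far_notin_fill R (cc T y) m) (h m (cc_refl Tm)) => [w /cc_sub /hm|ym].
  by rewrite !subr0.
have : (cc T y `&` cc T m) m by split=> //; exact: cc_refl.
by rewrite dis.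
Qed.

Lemma clo_I T F F' : clo T F -> clo T F' -> clo T (F `&` F').
Proof.
move=> [FT cF cG] [FT' cF' cG']; split.
- by move=> x [/FT].
- exact: closedI.
by rewrite setDIr; exact: closedU.
Qed.

Lemma bdry_compl T : bdry (~` T) = bdry T.
Proof.
apply/seteqP; split => z /bdryCP h; apply/bdryCP => e /h[[w ? ?] [v ? ?]].
  by split; [exists v => //; apply: contrapT|exists w].
by split; [exists v|exists w => //; move=> k; exact: k].
Qed.

Lemma unb_cc T u : bnd T -> ~ bnd (cc (~` T) u) -> cc (~` T) u = ~` fill T.
Proof.
move=> bT /nbnd_unb uU; set U := cc (~` T) u in uU *.
have [N N0 hN] := cpt_bigdsk bT.
have outT : [set z | N < nrm z] `<=` ~` T by move=> z /= Nz /hN; lra.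
have [u1 Uu1 Nu1] := uU N.
have outU : [set z | N < nrm z] `<=` U.
  exact: (conn_cc (@outer_conn R N (ltW N0)) outT Nu1 Uu1).
apply/seteqP; split => z hz.
  move=> fz; have UT : U `&` T = set0 by apply/seteqP; split => // w [/cc_sub].
  have := fill_cross (@cc_conn _ (~` T) u) UT hz fz => UfT.
  by apply: (unb_bnd uU); exact: bnd_sub UfT (fill_bnd bT).
apply: contrapT => nU; apply: hz => L kL uL Lz; apply: contrapT => no; apply: nU.
have [v Lv Nv] := uL N.
apply: (conn_cc kL _ Lv (outU v Nv)) => // w Lw Tw; apply: no; by exists w.
Qed.

End ComponentOrder.

(** * The least and the greatest component of the Julia set *)

Section Clauses.
Variable R : realType.
Local Notation C := (Cplx R).
Implicit Types (p q : {poly C}) (F Y : set C).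

Variables (I : Type) (g : I -> {poly C}) (i0 : I) (r : R) (ri : I -> R).
Let G := gen_by g.
Let h := g i0.
Hypothesis H : pcb G h r.
Hypothesis Hi : forall i, pcb G (g i) (ri i).
Local Notation E := (Eset h).
Local Notation X p := (bdry (Eset h p)).
Local Notation S := (fin (Julia G)).
Let K i := Kset (g i).
Let A : set C := \bigcup_(i in [set: I]) bdry (K i).
Hypothesis kS : cpt S.

Local Lemma Gg i : G (g i). Proof. exact: gen_base. Qed.
(** The facts about the sets [Eset] hold for every choice of base generator. Taking [g i] itself as
    the base transfers them to [K i]. *)
Local Lemma KE i : K i = Eset (g i) (g i). Proof. exact: Kset_E. Qed.

Local Lemma K_conn i : conn (K i). Proof. by rewrite KE; apply: (E_conn (Hi i)); exact: Gg. Qed.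
Local Lemma XK_conn i : conn (bdry (K i)). Proof. by rewrite KE; apply: (X_conn (Hi i)); exact: Gg. Qed.
Local Lemma XK_cpt i : cpt (bdry (K i)). Proof. by rewrite KE; apply: (X_cpt (Hi i)); exact: Gg. Qed.
Local Lemma K_cpt i : cpt (K i). Proof. by rewrite KE; apply: (E_cpt (Hi i)); exact: Gg. Qed.
Local Lemma fillXK i : fill (bdry (K i)) = K i.
Proof. by rewrite KE; apply: (fillX (Hi i)); exact: Gg. Qed.
Local Lemma fillK i : fill (K i) = K i.
Proof. by rewrite KE; apply: (fillE (Hi i)); exact: Gg. Qed.
Local Lemma XK_S i : bdry (K i) `<=` S.
Proof. by rewrite KE; apply: (X_S (Hi i)); exact: Gg. Qed.
Local Lemma XK_ne i : bdry (K i) !=set0.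
Proof. by rewrite KE; apply: (X_ne (Hi i)); exact: Gg. Qed.
Local Lemma XK_K i : bdry (K i) `<=` K i.
Proof. by apply: closed_bdry; case: (K_cpt i). Qed.
Local Lemma K_int i z : K i z -> ~ bdry (K i) z -> (K i)^° z.
Proof. by move=> Kz nb; apply: contrapT => ni; apply: nb; split=> //; exact: subset_closure. Qed.
Local Lemma K_absorb i Y y : conn Y -> Y `&` bdry (K i) = set0 -> Y y -> K i y -> Y `<=` (K i)^°.
Proof. by move=> kY YX Yy Ky; exact: (conn_bdry kY Yy Ky YX). Qed.

Local Lemma clA_S : closure A `<=` S.
Proof. by apply: closure_sub_closed; [move=> z [i _ /XK_S]|exact: Julia_fin_closed]. Qed.
Local Lemma A_cl i : bdry (K i) `<=` closure A.
Proof. by move=> z bz; apply: subset_closure; exists i. Qed.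
Lemma kA : cpt (closure A).
Proof. by apply: (cpt_closed_sub clA_S _ kS); exact: closed_closure. Qed.
Local Lemma nA : closure A !=set0.
Proof. by have [x bx] := XK_ne i0; exists x; exact: (A_cl bx). Qed.

Let XA : set (set C) := [set bdry (K i) | i in [set: I]].
Local Lemma densA : closure A `<=` closure (\bigcup_(Y in XA) Y).
Proof.
apply: closure_subset => z [i _ bz]; exists (bdry (K i)) => //; by exists i.
Qed.
Local Lemma XA_conn Y : XA Y -> conn Y /\ Y `<=` closure A.
Proof. by case=> i _ <-; split; [exact: XK_conn|exact: A_cl]. Qed.

Let inK z := forall p, G p -> E p z.

Local Lemma inK_K z i : inK z -> K i z.
Proof.
move=> /(KhatE H) hz; rewrite KE; apply: ((KhatE (Hi i) z).1 hz); exact: Gg.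
Qed.

Lemma compA_fill z x : inK z -> closure A x -> fill (cc (closure A) x) z.
Proof.
move=> hz Ax; apply: (comp_fill kA Ax _ densA) => _ [i _ <-].
by split; [exact: XK_conn|exact: A_cl|rewrite fillXK; exact: inK_K].
Qed.

Local Lemma compS_fill z x : inK z -> S x -> fill (cc S x) z.
Proof.
move=> hz Sx; apply: (comp_fill kS Sx _ (dens_closure H)) => _ [p Gp <-].
by split; [exact: (X_conn H)|exact: (X_S H)|rewrite (fillX H) //; exact: hz].
Qed.

Lemma minA_ex : exists M, minimal_comp (closure A) M.
Proof.
have [z hz] := Khat_ne H.
by apply: (minimal_ex kA nA (z := z)) => x; exact: compA_fill.
Qed.

Lemma maxA_ex : exists M, maximal_comp (closure A) M.
Proof. exact: (maximal_ex kA nA). Qed.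

(* Composing on the right with a generator and starting from [h] reaches every element,
   since [E (h \Po q) = E q]. *)
Local Lemma word_ind (P : set C -> Prop) : P (K i0) ->
  (forall p i, G p -> P (E p) -> P (E (p \Po g i))) -> forall p, G p -> P (E p).
Proof.
move=> P0 Pg; have eh q : E (h \Po q) = E q by rewrite Eset_comp /K -(Kset_E h).
have Ph : P (E h) by rewrite -(Kset_E h).
have all q : G q -> forall p, G p -> P (E p) -> P (E (p \Po q)).
  elim=> [i p Gp Pp|q1 q2 G1 IH1 G2 IH2 p Gp Pp]; first exact: Pg.
  rewrite comp_polyA; apply: (IH2 _ (pcb_comp H Gp G1)); exact: (IH1 _ Gp Pp).
by move=> p Gp; rewrite -eh; apply: (all _ Gp _ (Gg i0) Ph).
Qed.

Local Lemma pre_E p q z : E (p \Po q) z <-> E p q.[z].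
Proof. by rewrite Eset_comp. Qed.

Local Lemma E_iter p i : G p -> forall k, G (p \Po itp (g i) k).
Proof.
move=> Gp [|k]; first by rewrite /itp /= comp_polyXr.
by apply: (pcb_comp H) => //; apply: (pcb_itp H); exact: Gg.
Qed.

Local Lemma itp_comp p i k : p \Po itp (g i) k.+1 = (p \Po itp (g i) k) \Po g i.
Proof. by rewrite itp_Sr comp_polyA. Qed.

(** * The region cut off around a point by the complement of a clopen piece *)

Section Around.
Variables (x0 : C) (F : set C).
Hypotheses (Kx0 : inK x0) (Sx0 : S x0) (cF : clo S F) (Fx0 : F x0).
Let V := cc (~` (S `\` F)) x0.

Local Lemma V_open : open V.
Proof. by apply: cc_open; apply: closed_openC; case: cF. Qed.
Local Lemma V_x0 : V x0. Proof. by apply: cc_refl => -[]. Qed.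
Local Lemma V_S : V `&` S `<=` F.
Proof.
by move=> z [/cc_sub nz Sz]; apply: contrapT => nF; apply: nz.
Qed.
(** A boundary that meets [V] does so in [F], hence lies in [F] and cannot leave [V]. One that
    misses [V] has [V] inside, because of [x0]. *)
Local Lemma V_dich p : G p -> X p `<=` V `&` F \/ V `<=` (E p)^°.
Proof.
move=> Gp; have [[w [Xw Vw]]|no] := pselect (X p `&` V !=set0).
  left; have Fw : F w by apply: V_S; split=> //; exact: (X_S H Gp).
  have XF := clo_conn cF (X_conn H Gp) (X_S H Gp) Xw Fw.
  move=> z Xz; split; last exact: XF.
  by apply: (conn_cc (X_conn H Gp) _ Xw Vw Xz) => v /XF Fv [].
right; apply: (E_absorb Gp (@cc_conn _ _ x0) _ V_x0 (Kx0 Gp)).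
by apply/seteqP; split => // z [Vz Xz]; apply: no; exists z.
Qed.
Local Lemma V_K i : F `&` bdry (K i) = set0 -> V `<=` (K i)^° /\ V `&` bdry (K i) = set0.
Proof.
move=> FK; have VK : V `&` bdry (K i) = set0.
  apply/seteqP; split => // z [Vz bz].
  have : (F `&` bdry (K i)) z by split=> //; apply: V_S; split=> //; exact: XK_S bz.
  by rewrite FK.
by split=> //; apply: (K_absorb (@cc_conn _ _ x0) VK V_x0); exact: inK_K.
Qed.
Local Lemma V_small_ex : exists2 p, G p & X p `<=` V `&` F.
Proof.
have /openCP/(_ _ V_x0)[e e0 he] := V_open.
have [p Gp [w Xw wx]] := dens H Sx0 e0; exists p => //.
have [//|VE] := V_dich Gp; have [_ []] := Xw; exact: VE (he w wx).
Qed.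
(** The boundary of the component [V] lies in [S \ F], so intersecting with [F] gives the same set
    for [V] as for its closure. *)
Local Lemma VF_cpt : cpt (V `&` F).
Proof.
have [FS clF clG] := cF.
have -> : V `&` F = closure V `&` F.
  apply/seteqP; split => z [Vz Fz]; split=> //; first exact: subset_closure.
  apply: contrapT => nV.
  have oG : open (~` (S `\` F)) by exact: closed_openC.
  by apply: (@bdry_cc _ _ x0 oG z) => [|[]//]; split=> // /interior_subset.
apply: (cpt_closed_sub _ _ kS) => [z [_ /FS]//|].
by apply: closedI => //; exact: closed_closure.
Qed.
Local Lemma V_comp : cc S x0 `<=` V.
Proof.
apply: cc_max; [exact: cc_conn|exact: cc_refl|].
move=> z Mz [_ nF]; apply: nF.
exact: (clo_conn cF (@cc_conn _ S x0) (@cc_sub _ S x0) (cc_refl Sx0) Fx0 Mz).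
Qed.
(** A boundary point of [K i] in the filling of [V] and [F] would draw the whole connected boundary
    into it. But that set lies in [K i], the filling of this boundary, against [fill_antisym]. *)
Local Lemma fillVF_int i : F `&` bdry (K i) = set0 -> fill (V `&` F) `<=` (K i)^°.
Proof.
move=> FK; have [VK VX] := V_K FK.
have BK : V `&` F `<=` K i by move=> z [/VK /interior_subset].
have fBK : fill (V `&` F) `<=` K i by move: (fill_mono BK); rewrite fillK.
move=> z fz; apply: K_int; first exact: fBK.
move=> bz.
have XB : bdry (K i) `&` (V `&` F) = set0.
  by apply/seteqP; split => // w [bw [Vw _]]; have : (V `&` bdry (K i)) w by []; rewrite VX.
have XfB := fill_cross (@XK_conn i) XB bz fz.
apply: (fill_antisym (XK_cpt i) VF_cpt (XK_ne i) XB XfB).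
by rewrite fillXK.
Qed.
End Around.

(** * The least component *)

Section Jmin.
Variable x0 : C.
Hypotheses (Kx0 : inK x0) (Sx0 : S x0).
Let Jm := cc S x0.

Lemma Jmin_least y : S y -> Jm `<=` fill (cc S y).
Proof.
move=> Sy; have [<-|dis] := comp_disj S x0 y; first exact: sub_fill.
exact: (fill_cross (@cc_conn _ S x0) dis (cc_refl Sx0) (compS_fill Kx0 Sy)).
Qed.

Lemma Jmin_meets : exists2 a, Jm a & closure A a.
Proof.
apply: contrapT => no.
have AJ : closure A `&` Jm = set0 by apply/seteqP; split => // z [Az Jz]; apply: no; exists z.
have [F [cF JF FA]] := sep_clopen kS Sx0 kA AJ.
have Fx0 : F x0 by apply: JF; exact: cc_refl.
have FK i : F `&` bdry (K i) = set0.
  by apply/seteqP; split => // z [Fz /A_cl Az]; have : (F `&` closure A) z by []; rewrite FA.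
pose V := cc (~` (S `\` F)) x0.
have VKi i := V_K Kx0 Fx0 (FK i).
have all p : G p -> V `<=` E p.
  apply: (@word_ind (fun B => V `<=` B)).
    by move=> z /((VKi i0).1) /interior_subset.
  move=> q i Gq VE.
  have Gqi := pcb_comp H Gq (Gg i).
  have [XV|VE'] := V_dich Kx0 cF Fx0 Gqi; last by move=> z /VE' /interior_subset.
  exfalso.
  have EE : E (q \Po g i) `<=` E q by apply: (X_E_sub H Gqi Gq) => z /XV[/VE].
  have EK : E (q \Po g i) `<=` (K i)^°.
    apply: subset_trans (fillVF_int Kx0 cF Fx0 (FK i)).
    by rewrite -(fillX H Gqi); exact: fill_mono.
  have [w1 [w2 [E1 E2 w12]]] := E_two H Gqi.
  (* [E (q \Po g i)] contains its preimages under [g i]: a point mapped into it is mapped into [E q]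
     by [EE], which means that it lies in it. *)
  have back n z : E (q \Po g i) (itp (g i) n).[z] -> E (q \Po g i) z.
    elim: n z => [|n IH] z; first by rewrite itp0.
    by rewrite itpSr => /IH /EE /pre_E.
  apply: (noback (pcb_size H (Gg i)) (E_cpt H Gqi) EK w12) => n z [e|e].
    by apply: (back n); rewrite e.
  by apply: (back n); rewrite e.
have [p Gp XV] := V_small_ex Kx0 Sx0 cF Fx0.
have [w Xw] := X_ne H Gp; have [Vw _] := XV w Xw.
have [_ ni] := Xw; apply: ni; apply/interiorCP.
have /openCP/(_ w Vw)[e e0 he] := @V_open x0 F cF.
by exists e => // v /he; exact: all.
Qed.

(** The component of [closure A] through a point of [Jm] lies in [Jm] and surrounds the least one.
    If the latter lay in another component of [S], that component and [Jm] would surround each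
    other. *)
Lemma min_sub m : closure A m ->
  (forall y, closure A y -> cc (closure A) m `<=` fill (cc (closure A) y)) ->
  cc (closure A) m `<=` Jm.
Proof.
move=> Am hm; have [a Ja Aa] := Jmin_meets.
have sub b : closure A b -> cc (closure A) b `<=` cc S b.
  move=> Ab; apply: cc_max; [exact: cc_conn|exact: cc_refl|].
  by move=> z /cc_sub; exact: clA_S.
have Sm := clA_S Am.
have [e|dis] := comp_disj S x0 m; first by rewrite /Jm e; exact: sub.
exfalso; apply: (fill_antisym (cc_cpt x0 kS) (cc_cpt m kS) _ dis (Jmin_least Sm)).
  by exists x0; exact: cc_refl.
have MaJ : cc (closure A) a `<=` Jm by rewrite /Jm (cc_eq Ja); exact: sub.
apply: subset_trans (fill_mono MaJ).
apply: (fill_cross (@cc_conn _ S m) _ (cc_refl Sm) (hm a Aa m (cc_refl Am))).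
apply/seteqP; split => // z [mz /MaJ Jz].
by have : (cc S x0 `&` cc S m) z by []; rewrite dis.
Qed.

Hypothesis JA : Jm `&` A = set0.
Let D := fill Jm.

(** If the image [w] leaves [D], some clopen [F] around [Jm] avoids [bdry (K i)] and does not
    surround [w]. Having its boundary in [V] and [F] then passes from [q] to [q \Po g i]: otherwise
    [E (q \Po g i)] contains [Jm], hence [y], and [E q] contains [w]. So all preimages of [E p]
    under the iterates of [g i] stay in a compact part of the interior of [K i], against
    [noback]. *)
Local Lemma D_inv i y : D y -> D (g i).[y].
Proof.
move=> Dy; apply: contrapT => nD; set w := (g i).[y] in nD.
have [F0 [cF0 JF0 nw]] := fill_clopen kS Sx0 nD.
have XJ : bdry (K i) `&` cc S x0 = set0.
  apply/seteqP; split => // z [bz Jz]; have : (Jm `&` A) z by split=> //; exists i.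
  by rewrite JA.
have [F1 [cF1 JF1 F1K]] := sep_clopen kS Sx0 (XK_cpt i) XJ.
pose F := F0 `&` F1; have cF : clo S F := clo_I cF0 cF1.
have Fx0 : F x0 by split; [apply: JF0|apply: JF1]; exact: cc_refl.
have FK : F `&` bdry (K i) = set0.
  by apply/seteqP; split => // z [[_ F1z] bz]; have : (F1 `&` bdry (K i)) z by []; rewrite F1K.
pose V := cc (~` (S `\` F)) x0.
have [p Gp XV] := V_small_ex Kx0 Sx0 cF Fx0.
have step q : G q -> X q `<=` V `&` F -> X (q \Po g i) `<=` V `&` F.
  move=> Gq Xq; have Gqi := pcb_comp H Gq (Gg i).
  have [//|VE] := V_dich Kx0 cF Fx0 Gqi; exfalso; apply: nw.
  have JE : Jm `<=` E (q \Po g i).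
    by move=> z /(V_comp Sx0 cF Fx0) /VE /interior_subset.
  have : E (q \Po g i) y by rewrite -(fillE H Gqi); exact: (fill_mono JE).
  move=> /pre_E; rewrite -/w -(fillX H Gq); apply: fill_mono => z /Xq[_ []//].
have Gk := E_iter i Gp.
have small n : X (p \Po itp (g i) n) `<=` V `&` F.
  elim: n => [|n IH]; first by rewrite /itp /= comp_polyXr.
  by rewrite itp_comp; apply: step.
have [w1 [w2 [E1 E2 w12]]] := E_two H Gp.
have kB := fill_cpt (VF_cpt x0 cF).
apply: (noback (pcb_size H (Gg i)) kB (fillVF_int Kx0 cF Fx0 FK) w12) => n z hz.
apply: (fill_mono (small n)); rewrite (fillX H (Gk n)); apply/pre_E.
by case: hz => ->.
Qed.

Local Lemma D_G p y : G p -> D y -> D p.[y].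
Proof.
move=> Gp; elim: Gp y => [i y|q1 q2 _ IH1 _ IH2 y Dy]; first exact: D_inv.
by rewrite horner_comp; apply/IH1/IH2.
Qed.

Local Lemma D_bnd : bnd D.
Proof. by apply: fill_bnd; case: (cc_cpt x0 kS). Qed.

Local Lemma D_K : D `<=` inK.
Proof.
move=> y Dy p Gp; have [M hM] := D_bnd; exists M => n.
by rewrite -horner_comp; apply/hM/D_G => //; apply: (pcb_itp_comp H) => //; exact: Gg.
Qed.

(** Near a point of [S] there are boundary points of some [E p], whereas [D] is contained in every
    [E p]. *)
Local Lemma D_int z : S z -> D^° z -> False.
Proof.
move=> Sz /interiorCP[e e0 he]; have [p Gp [w [_ ni] wz]] := dens H Sz e0.
apply: ni; have /openCP/(_ w wz)[d d0 hd] := @dsk_open R z e.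
by apply/interiorCP; exists d => // v /hd /he /D_K; apply.
Qed.

Lemma Jmin_bdry : Jm = bdry D.
Proof.
apply/seteqP; split => z; last by apply: fill_bdry; case: (cc_cpt x0 kS).
move=> Jz; split; first by apply: subset_closure; exact: sub_fill.
by apply: D_int; exact: cc_sub Jz.
Qed.

Lemma Jmin_outer u : ~ bnd (cc (~` Jm) u) -> Jm = bdry (cc (~` Jm) u).
Proof.
move=> nb; rewrite (unb_cc _ nb) ?bdry_compl; first exact: Jmin_bdry.
by case: (cc_cpt x0 kS).
Qed.

(** Every point of [Jm] is in [inK], so the least component of [closure A] surrounds it. A point of
    [Jm] outside that component would be interior to [D]. *)
Lemma Jmin_eq m : closure A m ->
  (forall y, closure A y -> cc (closure A) m `<=` fill (cc (closure A) y)) ->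
  Jm = cc (closure A) m.
Proof.
move=> Am hm; have MJ := min_sub Am hm; apply/seteqP; split => // z Jz.
apply: contrapT => nM.
have cM : closed (cc (closure A) m) by case: (cc_cpt m kA).
have fM : fill (cc (closure A) m) z.
  by apply: compA_fill => //; apply: D_K; exact: sub_fill.
apply: (@D_int z (cc_sub Jz)); apply/interiorCP.
have /openCP/(_ z)[|e e0 he] := fill_open cM; first by [].
by exists e => // v /he[/(fill_mono MJ)].
Qed.
End Jmin.

(** * The greatest component *)

Section Jmax.
Variables (x0 x1 : C).
Hypotheses (Kx0 : inK x0) (Sx0 : S x0) (Sx1 : S x1).
Hypothesis reach : forall F, F `<=` S -> cpt F -> ~ F x1 -> ~ fill F x1.
Let JM := cc S x1.

(** [reach] is the only trace of [x1] lying on the boundary of the unbounded Fatou component: no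
    compact part of [S] surrounds it without containing it. So another component cannot surround
    [JM]. *)
Lemma Jmax_greatest y : S y -> cc S y `<=` fill JM.
Proof.
move=> Sy; have [//|no] := comp_total kS Sy Sx1 (compS_fill Kx0 Sy) (compS_fill Kx0 Sx1).
have [e|dis] := comp_disj S x1 y; first by rewrite /JM -e; exact: sub_fill.
exfalso; apply: (reach (F := cc S y)); [exact: cc_sub|exact: cc_cpt| |].
  move=> yx1; have : (cc S x1 `&` cc S y) x1 by split=> //; exact: cc_refl.
  by rewrite dis.
by apply: no; exact: cc_refl.
Qed.

Section Far.
Variable F : set C.
Hypotheses (cF : clo S F) (Fx1 : F x1).
Let S1 := S `\` F.

Local Lemma S1_cpt : cpt S1.
Proof. by have [_ _ c1] := cF; apply: (cpt_closed_sub _ c1 kS) => z []. Qed.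
Local Lemma S1_x1 : ~ fill S1 x1.
Proof. by apply: reach; [move=> z []|exact: S1_cpt|case]. Qed.
Local Lemma far_dich p : G p -> E p `<=` fill S1 \/ X p `&` fill S1 = set0.
Proof.
move=> Gp; have [XQ|] := clo_fill_dich (clo_compl cF) S1_cpt (X_conn H Gp) (X_S H Gp).
  by left; apply: subset_trans (X_sub_fill H Gp XQ) _; exact: fill_idem.
by right.
Qed.
Local Lemma far_ex : exists2 p, G p & X p `&` fill S1 = set0.
Proof.
have cQ : closed (fill S1) by apply: fill_closed; case: S1_cpt.
have [e e0 he] := notin_closed cQ S1_x1.
have [p Gp [w Xw wx]] := dens H Sx1 e0; exists p => //.
have [EQ|//] := far_dich Gp; exfalso.
by apply: (he w wx); apply: EQ; exact: (X_sub_E H).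
Qed.
Local Lemma far_K i : F `&` bdry (K i) = set0 -> K i `<=` fill S1.
Proof.
move=> FK; rewrite -fillXK; apply: fill_mono => z bz; split; first exact: XK_S bz.
by move=> Fz; have : (F `&` bdry (K i)) z by []; rewrite FK.
Qed.
Local Lemma far_absorb p Y : G p -> X p `&` fill S1 = set0 -> conn Y -> Y x0 ->
  Y `<=` fill S1 -> Y `<=` (E p)^°.
Proof.
move=> Gp Xp kY Y0 YQ; apply: (E_absorb Gp kY _ Y0 (Kx0 Gp)).
apply/seteqP; split => // z [Yz Xz]; have : (X p `&` fill S1) z by split=> //; exact: YQ.
by rewrite Xp.
Qed.
End Far.

(** Otherwise, by induction on words, every [E p] stays in the filling of [S \ F], against [far_ex].
    If [E q] does and [E (q \Po g i)] does not, the latter contains [K i] and [E q] in its interior.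
    Then [g i] maps [E q] into itself, so [E q] and its preimage [E (q \Po g i)] lie in [K i], which
    would thus lie in its own interior. *)
Lemma Jmax_meets : exists2 a, JM a & closure A a.
Proof.
apply: contrapT => no.
have AJ : closure A `&` JM = set0 by apply/seteqP; split => // z [Az Jz]; apply: no; exists z.
have [F [cF JF FA]] := sep_clopen kS Sx1 kA AJ.
have Fx1 : F x1 by apply: JF; exact: cc_refl.
have FK i : F `&` bdry (K i) = set0.
  by apply/seteqP; split => // z [Fz /A_cl Az]; have : (F `&` closure A) z by []; rewrite FA.
have [p Gp Xp] := far_ex cF Fx1; have [w Xw] := X_ne H Gp.
have : (X p `&` fill (S `\` F)) w; last by rewrite Xp.
split=> //; move: (X_sub_E H Gp Xw); move: (p) (Gp) w {Xw Xp}.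
apply: (@word_ind (fun B => B `<=` fill (S `\` F))); first exact: far_K.
move=> q i Gq EQ; have Gqi := pcb_comp H Gq (Gg i).
have [//|Xqi] := far_dich cF Gqi; exfalso.
have KE1 : K i `<=` (E (q \Po g i))^°.
  by apply: (far_absorb Gqi Xqi (@K_conn i)); [exact: inK_K|exact: far_K].
have EE : E q `<=` (E (q \Po g i))^°.
  by apply: (far_absorb Gqi Xqi (E_conn H Gq)) => //; exact: Kx0.
have EK : E q `<=` K i.
  have [_ [M hM]] := E_cpt H Gq; move=> z Ez; exists M => n; apply: hM.
  elim: n z Ez => [|n IH] z Ez; first by rewrite itp0.
  by rewrite itpSr; apply: IH; apply/pre_E; exact: interior_subset (EE z Ez).
have EK' : E (q \Po g i) `<=` K i by move=> z /pre_E /EK Kz; apply/(Kset_h (g i)).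
have [b bb] := XK_ne i; have := KE1 b (XK_K bb); have [_ ni] := bb.
by move=> /(interiorS EK').
Qed.

Lemma max_sub m : closure A m ->
  (forall y, closure A y -> cc (closure A) y `<=` fill (cc (closure A) m)) ->
  cc (closure A) m `<=` JM.
Proof.
move=> Am hm; have [a Ja Aa] := Jmax_meets; have Sm := clA_S Am.
have sub : cc (closure A) m `<=` cc S m.
  apply: cc_max; [exact: cc_conn|exact: cc_refl|].
  by move=> z /cc_sub; exact: clA_S.
have [e|dis] := comp_disj S x1 m; first by rewrite /JM e.
exfalso; apply: (fill_antisym (cc_cpt x1 kS) (cc_cpt m kS) _ dis _ (Jmax_greatest Sm)).
  by exists x1; exact: cc_refl.
apply: (fill_cross (@cc_conn _ S x1) dis Ja).
by apply: (fill_mono sub); apply: (hm a Aa); exact: cc_refl.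
Qed.

Hypothesis JA : JM `&` A = set0.
Hypothesis nJ0 : ~ JM x0.
Let U := cc (~` JM) x0.

Local Lemma JM_K i : bdry (K i) `&` JM = set0.
Proof.
apply/seteqP; split => // z [bz Jz]; have : (JM `&` A) z by split=> //; exists i.
by rewrite JA.
Qed.

Local Lemma U_x0 : U x0. Proof. exact: cc_refl. Qed.

(** If [y] is outside [U] and its image [w] inside, a clopen [F] around [JM] avoids [bdry (K i)] and
    a connected set [T] joining [x0] to [w]. Having its boundary outside [Q] passes from [q] to
    [q \Po g i]: if not, [E q] absorbs [T], and [E (q \Po g i)] joins [x0] to [y]; either it avoids
    [JM], so that [y] is in [U], or it meets [JM] and [S \ F] surrounds [x1]. *)
Local Lemma U_inv i y : ~ U y -> ~ U (g i).[y].
Proof.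
move=> nUy Uw; set w := (g i).[y] in Uw.
have [F0 [T [cF0 JF0 kT [T0 Tw] TF0]]] := link kS Sx1 Uw.
have [F1 [cF1 JF1 F1K]] := sep_clopen kS Sx1 (XK_cpt i) (@JM_K i).
pose F := F0 `&` F1; have cF : clo S F := clo_I cF0 cF1.
have JF : JM `<=` F by move=> z Jz; split; [exact: JF0|exact: JF1].
have Fx1 : F x1 by apply: JF; exact: cc_refl.
have FK : F `&` bdry (K i) = set0.
  by apply/seteqP; split => // z [[_ F1z] bz]; have : (F1 `&` bdry (K i)) z by []; rewrite F1K.
have KQ := far_K FK.
pose Q := fill (S `\` F).
have [p Gp Xp] := far_ex cF Fx1.
have step q : G q -> X q `&` Q = set0 -> X (q \Po g i) `&` Q = set0.
  move=> Gq Xq; have Gqi := pcb_comp H Gq (Gg i).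
  have [EQ|//] := far_dich cF Gqi; exfalso.
  have XF z : X q z -> F0 z.
    move=> Xz; apply: contrapT => nz; have : (X q `&` Q) z; last by rewrite Xq.
    by split=> //; apply: sub_fill; split; [exact: (X_S H Gq)|case].
  have TX : T `&` X q = set0.
    apply/seteqP; split => // z [Tz /XF F0z]; have : (T `&` F0) z by [].
    by rewrite TF0.
  have Ew : E q w by apply: interior_subset; exact: (E_absorb Gq kT TX T0 (Kx0 Gq) Tw).
  have Ey : E (q \Po g i) y by apply/pre_E.
  have [[v [Ev Jv]]|no] := pselect (E (q \Po g i) `&` JM !=set0).
    apply: (S1_x1 cF Fx1).
    apply: (@fill_cross _ (S `\` F) JM v); [exact: cc_conn| |exact: Jv|exact: EQ|exact: cc_refl].
    by apply/seteqP; split => // z [/JF Fz [_]].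
  apply: nUy; apply: (cc_max (E_conn H Gqi) (Kx0 Gqi) _ Ey) => z Ez Jz.
  by apply: no; exists z.
have Gk := E_iter i Gp.
have far n : X (p \Po itp (g i) n) `&` Q = set0.
  elim: n => [|n IH]; first by rewrite /itp /= comp_polyXr.
  by rewrite itp_comp; apply: step.
(* All [E (p \Po itp (g i) n)] contain [K i] and a common disc around its rightmost point [x].
   Points of that disc therefore have bounded orbits, even those to the right of [K i]. *)
have [x Kx xmax] : exists2 x, K i x & forall z, K i z -> complex.Re z <= complex.Re x.
  by apply: cpt_rightmost; [exact: K_cpt|exists x0; exact: inK_K].
have c1 := clo_fill_compl_closed (clo_compl cF) (S1_cpt cF).
have [e e0 he] : exists2 e : R, 0 < e & dsk x e `<=` ~` (S `\` Q).
  by apply: notin_closed => // -[_]; apply; exact: KQ.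
have e2 : 0 < e / 2 by lra.
have : K i (x + cr (e / 2)).
  have [_ [M hM]] := E_cpt H Gp; exists M => n; apply: hM; apply/pre_E.
  have GG := Gk n.
  have Ex : E (p \Po itp (g i) n) x.
    by apply: interior_subset; apply: (far_absorb GG (far n) (@K_conn i) _ KQ Kx); exact: inK_K.
  have sub : dsk x e `<=` (E (p \Po itp (g i) n))^°.
    apply: (@E_absorb R G h _ (dsk x e) x GG (@conn_dsk R x e) _ (@dsk_center R x e e0) Ex).
    apply/seteqP; split => // z [/he zz Xz]; apply: zz; split; first exact: (X_S H GG).
    move=> Qz; have : (X (p \Po itp (g i) n) `&` Q) z by [].
    by rewrite far.
  apply: interior_subset; apply: sub.
  by rewrite /dsk /= addrC addKr nrm_cr gtr0_norm //; lra.
move=> /xmax; rewrite raddfD /=; lra.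
Qed.

Local Lemma U_G p y : G p -> ~ U y -> ~ U p.[y].
Proof.
move=> Gp; elim: Gp y => [i y|q1 q2 _ IH1 _ IH2 y Dy]; first exact: U_inv.
by rewrite horner_comp; apply/IH1/IH2.
Qed.

Local Lemma U_open : open U.
Proof. by apply: cc_open; apply: closed_openC; case: (cc_cpt x1 kS). Qed.

(** Near a point of [JM] that is not a limit of [U], all elements of [G] avoid [U], hence a fixed
    disc around [x0]. By [omit_Fatou] the point would be in the Fatou set. *)
Lemma Jmax_bdry : JM = bdry U.
Proof.
apply/seteqP; split => z.
  move=> Jz; split; last by move=> /interior_subset /cc_sub.
  apply/closureCP => e e0; apply: contrapT => no.
  have /openCP/(_ _ U_x0)[d d0 hd] := U_open.
  have e2 : 0 < e / 2 by lra.
  apply: (@cc_sub _ S x1 z Jz).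
  apply: (omit_Fatou e2 d0 (u := x0)) => f Gf y hy; rewrite leNgt; apply/negP => lt.
  apply: (U_G Gf _ (hd _ lt)) => Uy; apply: no; exists y => //.
  by apply: (le_lt_trans hy); lra.
have oJ : open (~` JM) by apply: closed_openC; case: (cc_cpt x1 kS).
by move=> /(bdry_cc oJ) /contrapT.
Qed.

Lemma Jmax_side : bnd U /\ cc S x0 `<=` U.
Proof.
have bJ : bnd JM by case: (cc_cpt x1 kS).
split; first by apply: (bnd_sub (fill_cc_bnd bJ nJ0 (compS_fill Kx0 Sx1))); exact: fill_bnd.
apply: cc_max; [exact: cc_conn|exact: cc_refl|] => z zx0 zx1; apply: nJ0.
by rewrite /JM (cc_eq zx1) -(cc_eq zx0); exact: cc_refl.
Qed.

(** It suffices that the complementary component of the greatest component around [x0] is no larger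
    than [U]; then both have the same boundary. Each of its points is joined to [x0] inside some
    [K i], and this connected set avoids [JM], since otherwise [bdry (K i)] would surround [x1]. *)
Lemma Jmax_eq m : closure A m ->
  (forall y, closure A y -> cc (closure A) y `<=` fill (cc (closure A) m)) ->
  JM = cc (closure A) m.
Proof.
move=> Am hm; have MJ := max_sub Am hm; apply/seteqP; split => //.
have cM : closed (cc (closure A) m) by case: (cc_cpt m kA).
suff WU : cc (~` cc (closure A) m) x0 `<=` U.
  have -> : JM = bdry (cc (~` cc (closure A) m) x0).
    rewrite Jmax_bdry; congr bdry; apply/seteqP; split=> //.
    apply: cc_max; [exact: cc_conn|exact: U_x0|].
    by move=> z /cc_sub nJ /MJ.
  by move=> z /(bdry_cc (closed_openC cM)) /contrapT.
move=> v Wv; apply: contrapT => nU.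
have [F [L [cF MF kL [L0 Lv] LF]]] := link kA Am Wv.
have Fm : F m by apply: MF; exact: cc_refl.
have [_ [i _ <-] [KF _]] := dense_clo cF Fm XA_conn densA.
have LK : L `<=` (K i)^°.
  apply: (K_absorb kL _ L0); last exact: inK_K.
  by apply/seteqP; split => // z [Lz /KF Fz]; have : (L `&` F) z by []; rewrite LF.
apply: nU; apply: (cc_max (@K_conn i)); [exact: inK_K| |exact: interior_subset (LK v Lv)].
move=> z Kz Jz.
have JK : JM `<=` (K i)^°.
  by apply: (K_absorb (@cc_conn _ S x1) _ Jz Kz); rewrite setIC; exact: JM_K.
have Kx1 : K i x1 by apply: interior_subset; apply: JK; exact: cc_refl.
apply: (@reach (bdry (K i)) (@XK_S i) (XK_cpt i)); last by rewrite fillXK.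
move=> bx; have : (bdry (K i) `&` JM) x1 by split=> //; exact: cc_refl.
by rewrite JM_K.
Qed.
End Jmax.
End Clauses.

(** * The Riemann sphere *)

Section Sphere.
Variable R : realType.
Local Notation C := (Cplx R).
Local Notation Chat := (Chat R).

Lemma chat_nbhs_inf (V : set Chat) : nbhs (None : Chat) V <->
  V None /\ exists M : R, forall z, M < nrm z -> V (Some z).
Proof.
split=> [[K [cK clK] KV]|[V0 [M hM]]].
  split; first by apply: KV; right.
  have [_ [M hM]] := compact_cpt cK clK; exists M => z hz; apply: KV; left.
  by exists z => // /hM; rewrite leNgt hz.
have [c1 c2] := closed_dsk_cpt (0 : C) M.
exists [set w | nrm (w - 0) <= M].
  by split=> //; exact: cpt_compact.
move=> _ [[z nz <-]|->] //; apply: hM; rewrite ltNge; apply/negP => h; apply: nz.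
by rewrite /= subr0.
Qed.

Lemma nbhs_open_not (V : set Chat) : (forall x, ~ V x -> nbhs x (~` V)) -> closed V.
Proof.
move=> h; rewrite -[V]setCK; apply: open_closedC; rewrite openE => x nVx; exact: h.
Qed.

Lemma closed_some (K : set C) : cpt K -> closed (Some @` K : set Chat).
Proof.
move=> [cK [M hM]]; apply: nbhs_open_not => -[z|] nz.
  have nK : ~ K z by move=> Kz; apply: nz; exists z.
  have [e e0 he] := notin_closed cK nK.
  by apply/chat_nbhs; exists e => // w hw [v Kv [vw]]; apply: (he w hw); rewrite -vw.
apply/chat_nbhs_inf; split; first by case.
by exists M => z hz [v /hM hv [vz]]; move: hv; rewrite vz leNgt hz.
Qed.

Lemma conn_some (Y : set C) : connected Y -> connected (Some @` Y : set Chat).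
Proof.
move=> cY; apply: connected_continuous_connected => //.
by apply: continuous_subspaceT; exact: one_point_compactification_some_continuous.
Qed.

(** The plane is open in the sphere, so relatively open sets transfer directly; for closed ones the
    missing point at infinity does no harm as it is not in [B]. *)
Lemma fin_conn (B : set Chat) : ~ B None -> connected B -> connected (fin B).
Proof.
move=> B0 cB B' [b Bb] [U oU eU] [D cD eD].
have eB : Some @` B' = B.
  apply: cB; first by exists (Some b), b.
    exists (Some @` U); first exact: one_point_compactification_open_some.
    rewrite eU; apply/seteqP; split=> [_ [z [Bz Uz] <-]|[z|] [Bz]]; last by case.
      by split=> //; exists z.
    by case=> v Uv [vz]; exists z => //; split=> //; rewrite -vz.
  exists (~` (Some @` (~` D))).
    apply: open_closedC; apply: one_point_compactification_open_some.
    exact: closed_openC.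
  rewrite eD; apply/seteqP; split=> [_ [z [Bz Dz] <-]|[z|] [Bz nz]]; last by case: B0.
    by split=> // -[v nD [vz]]; apply: nD; rewrite vz.
  by exists z => //; split=> //; apply: contrapT => nD; apply: nz; exists z.
apply/seteqP; split=> z; first by rewrite eU => -[].
by move=> Bz; have : B (Some z) by []; rewrite -eB => -[v B'v [<-]].
Qed.

Lemma fin_cc (B : set Chat) x : B (Some x) -> ~ connected_component B (Some x) None ->
  fin (connected_component B (Some x)) = cc (fin B) x.
Proof.
move=> Bx n0; apply/seteqP; split.
  apply: connected_component_max; first exact: connected_component_refl.
    by move=> z /connected_component_sub.
  by apply: fin_conn => //; exact: component_connected.
move=> z hz; apply: (@connected_component_max _ B (Some @` cc (fin B) x) (Some x)).
- by exists x => //; exact: cc_refl.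
- by move=> _ [v /cc_sub ? <-].
- by apply: conn_some; exact: component_connected.
- by exists z.
Qed.
End Sphere.

(** * From the definitions on the sphere to sets in the plane *)

Section Translation.
Variable R : realType.
Local Notation C := (Cplx R).
Variables (I : Type) (g : I -> {poly C}).
Local Notation G := (gen_by g).

Lemma pcb_ex i : in_calG g -> exists r, pcb G (g i) r.
Proof.
move=> [deg /bounded_setP[M hM]].
have [r hr] := escapes_ex (deg _ (gen_base g i)).
(* [M] bounds the finite part of the postcritical set; adding 1 makes the bound on critical values
   strict. *)
exists (Num.max r (M + 1)); split=> //.
- exact: gen_base.
- by move=> p q; exact: gen_comp.
- by apply: (escapes_le hr); rewrite le_max lexx.
- move=> p c Gp pc; apply: (@le_lt_trans _ _ M); last by rewrite lt_max ltrDl ltr01 orbT.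
  by apply: hM; apply: subset_closure; right; exists p, c.
Qed.

Lemma comp_itp (p : {poly C}) m n : itp p m \Po itp p n = itp p (m + n).
Proof.
elim: m => [|m IH]; first by rewrite /itp /= comp_polyX.
by rewrite addSn [RHS]/itp /= -/(itp p (m + n)) -IH comp_polyA.
Qed.

Lemma cyclic_itp (p f : {poly C}) : cyclic_sg p f -> exists n, f = itp p n.+1.
Proof.
elim=> [_|q1 q2 _ [m ->] _ [n ->]]; first by exists 0%N; rewrite itp1.
by exists (m + n.+1)%N; rewrite comp_itp addSn.
Qed.

(** With the polynomial itself as base, the filled sets of all its iterates coincide with [Kset p],
    so density says that the Julia set lies in the closed boundary of [Kset p]. *)
Lemma Julia_cyclic (p : {poly C}) : (2 < size p)%N -> fin (Julia (cyclic_sg p)) = bdry (Kset p).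
Proof.
move=> sp; apply/seteqP; split => z.
  move=> Jz; have := @bdry_closed R (Kset p); rewrite closedCP; apply => e e0.
  have s1 f : cyclic_sg p f -> (1 < size f)%N.
    by move=> /cyclic_itp[n ->]; apply: size_itp; exact: ltn_trans sp.
  have [f /cyclic_itp[n ->]] := density sp s1 Jz e0.
  by rewrite Eset_itp.
rewrite -(Eset_itp p 1) itp1; apply: X_Julia => // n.
rewrite -itp_Sr; elim: n => [|n IH]; first by rewrite itp1; exact: (gen_base (fun=> p) tt).
exact: (gen_comp (gen_base (fun=> p) tt) IH).
Qed.

Lemma unionJE : in_calG g -> unionJ g = \bigcup_(i in [set: I]) bdry (Kset (g i)).
Proof.
by move=> [deg _]; apply: eq_bigcupr => i _; apply: Julia_cyclic; apply: deg; exact: gen_base.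
Qed.

(** Without generators the semigroup is empty, normality holds vacuously everywhere, and the empty
    Julia set is connected. *)
Lemma dis_inhabited : in_calG_dis g -> exists i : I, True.
Proof.
move=> [_ nc]; apply: contrapT => no; apply: nc.
have nG f : ~ G f by elim=> // i; exfalso; apply: no; exists i.
have -> : Julia G = set0; last exact: connected0.
apply/seteqP; split => // x; apply; exists setT; split=> //; first exact: openT.
by move=> f hf; case: (nG _ (hf 0%N)).
Qed.

(** If the finite part were unbounded, infinity would be in the closed set [Julia G]. Of the two
    closed pieces into which that splits, the one without infinity is compact and clopen in the
    finite part, as [julia_bounded] requires. *)
Lemma dis_Julia_cpt : in_calG_dis g -> cpt (fin (Julia G)).
Proof.
move=> hg; have [hG nc] := hg; split; first exact: Julia_fin_closed.
apply: contrapT => nb.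
have [i _] := dis_inhabited hg; have [r H] := pcb_ex i hG.
have cJ : closed (Julia G) by apply: open_closedC; exact: Fatou_open.
have J0 : Julia G None.
  move=> F0; apply: nb.
  have /chat_nbhs_inf[_ [M hM]] : nbhs (None : Chat R) (Fatou G).
    by apply: open_nbhs_nbhs; split=> //; exact: Fatou_open.
  by exists M => z; apply: contra_notT; rewrite -ltNge; exact: hM.
have [E [nE eJ [sep1 sep2]]] := (connectedPn _).1 nc.
have cl b z : closure (E b) z -> ~ E (~~ b) z.
  move=> Ebz Enz; case: b Ebz Enz => h1 h2.
    by have : (E false `&` closure (E true)) z by []; rewrite sep2.
  by have : (closure (E false) `&` E true) z by []; rewrite sep1.
have JE b z : Julia G z <-> E b z \/ E (~~ b) z.
  by rewrite eJ; case: b => /=; split; case; by [left|right].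
have EJ b : E b `<=` Julia G by move=> z Ez; apply/(JE b); left.
have cE b : closed (E b).
  move=> z Ez; have Jz : Julia G z by apply: cJ; apply: (closure_subset (@EJ b)).
  by have [//|/(cl _ _ Ez)] := (JE b z).1 Jz.
have fcl b : closed (fin (E b)).
  move=> z hz; apply: cE => V /chat_nbhs[e e0 he].
  have [w Ew wz] := (closureCP _ _).1 hz e e0.
  by exists (Some w); split=> //; exact: he.
have [b nb0 b0] : exists2 b, ~ E b None & E (~~ b) None.
  have [h|h] := (JE true None).1 J0; last by exists true => // h'; exact: (cl true None (subset_closure h') h).
  by exists false => // h'; exact: (cl false None (subset_closure h') h).
apply: (@julia_bounded R G (g i) r H (fin (E b)) _ _ _ nb).
- split=> //; first by move=> z /EJ.
  have -> : fin (Julia G) `\` fin (E b) = fin (E (~~ b)).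
    apply/seteqP; split=> z; first by case=> /(JE b)[].
    move=> Ez; split; first exact: EJ Ez.
    by move=> h; exact: (cl b (Some z) (@subset_closure _ (E b) _ h) Ez).
  exact: fcl.
- split=> //; have /chat_nbhs_inf[_ [M hM]] : nbhs (None : Chat R) (~` E b).
    by apply: open_nbhs_nbhs; split=> //; exact: closed_openC.
  by exists M => z Ez; rewrite leNgt; apply/negP => /hM.
- by have [[z|] Ez] := nE b; [exists z|].
Qed.

(** The connected component of a point outside the set is empty by convention, and so is then its
    boundary; a boundary point therefore witnesses that infinity is in the Fatou set. *)
Lemma Uinf_Fatou (x : C) : fin (bdry (Uinf G)) x -> Fatou G None.
Proof.
move=> bx; have [u [Uu _]] : Uinf G `&` setT !=set0.
  by have [cx _] := bx; apply: cx; exact: filterT.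
by apply: contrapT => nF; move: Uu; rewrite /Uinf connected_component_out.
Qed.

(** If [F] surrounded [x], [Uinf G] would meet the open set of surrounded points. Since it avoids
    [F], it would be trapped there by connectedness, although it contains infinity. *)
Lemma Uinf_reach (x : C) F : fin (bdry (Uinf G)) x -> F `<=` fin (Julia G) -> cpt F ->
  ~ F x -> ~ fill F x.
Proof.
move=> bx FJ kF nFx fx; have F0 := Uinf_Fatou bx.
have [c1 _] := kF; have U0 : Uinf G None by exact: connected_component_refl.
have oV : open (Some @` (fill F `\` F) : set (Chat R)).
  by apply: one_point_compactification_open_some; exact: fill_open.
have cV := closed_some (fill_cpt kF).
have [u [Uu Vu]] : Uinf G `&` Some @` (fill F `\` F) !=set0.
  have [cx _] := bx; apply: cx; apply: open_nbhs_nbhs; split=> //.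
  by exists x.
have UF z : Uinf G (Some z) -> ~ F z by move=> /connected_component_sub Fz /FJ; apply.
have eU : Uinf G `&` Some @` (fill F `\` F) = Uinf G.
  apply: (@component_connected _ (Fatou G) None).
  - by exists u.
  - by exists (Some @` (fill F `\` F)).
  - exists (Some @` fill F) => //; apply/seteqP; split=> v [Uv [z fz vz]].
      by split=> //; exists z => //; case: fz.
    by split=> //; exists z => //; split=> //; apply: UF; rewrite vz.
by move: U0; rewrite -eU => -[_ [z]].
Qed.
End Translation.

(** * The components singled out by the boundaries of [Khat] and [Uinf] *)

Section Extremal.
Variable R : realType.
Local Notation C := (Cplx R).
Variables (I : Type) (g : I -> {poly C}).
Local Notation G := (gen_by g).

Lemma calJ_cc K x : calJ G K -> K x -> fin (Julia G) x /\ K = cc (fin (Julia G)) x.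
Proof.
move=> [y Jy [n0 ->]]; rewrite fin_cc // => hx; split; first exact: cc_sub hx.
exact: cc_eq.
Qed.

Lemma bdry_Khat h (r : R) x : pcb G h r -> bdry (Khat G) x -> forall p, G p -> Eset h p x.
Proof.
move=> H [cx _] p Gp; apply: (E_closed H Gp); apply: closure_subset cx => z /(KhatE H).
exact.
Qed.

(* Otherwise the least and the greatest component coincide, hence all of them. *)
Lemma min_ne_max i0 (r : R) x0 x1 : pcb G (g i0) r -> in_calG_dis g ->
  Fatou G None -> (forall p, G p -> Eset (g i0) p x0) ->
  fin (Julia G) x0 -> fin (Julia G) x1 ->
  (forall F, F `<=` fin (Julia G) -> cpt F -> ~ F x1 -> ~ fill F x1) ->
  ~ cc (fin (Julia G)) x1 x0.
Proof.
move=> H hg F0 K0 S0 S1 reach J10; have kS := dis_Julia_cpt hg.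
have [_ nc] := hg; apply: nc.
have eS : fin (Julia G) = cc (fin (Julia G)) x1.
  apply/seteqP; split; last exact: cc_sub.
  move=> y Sy; rewrite -(_ : cc (fin (Julia G)) y = cc (fin (Julia G)) x1); first exact: cc_refl.
  apply: (comp_antisym kS Sy (Jmax_greatest H kS K0 S1 reach Sy)).
  by rewrite (cc_eq J10); exact: (Jmin_least H kS K0 S0 Sy).
have -> : Julia G = Some @` fin (Julia G).
  apply/seteqP; split=> [[z|] Jz|_ [z Jz <-]] //; by exists z.
by rewrite eS; apply: conn_some; exact: component_connected.
Qed.
End Extremal.

Theorem theorem4p8 (R : realType) (Lambda : Type) (g : Lambda -> {poly Cplx R}) :
  in_calG_dis g ->
  let G := gen_by g in
  let A := unionJ g in
  (exists M', minimal_comp (closure A) M') /\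
  (exists M'', maximal_comp (closure A) M'') /\
  (forall Jmin Jmax M' M'',
     is_Jmin G Jmin -> is_Jmax G Jmax ->
     minimal_comp (closure A) M' -> maximal_comp (closure A) M'' ->
     [/\ M' `<=` Jmin, M'' `<=` Jmax,
         Jmin `&` closure A !=set0 /\ Jmax `&` closure A !=set0,
         (Jmin `&` A = set0 ->
            Jmin = M' /\
            forall U, is_component (~` Jmin) U -> ~ bounded_set U ->
              Jmin = bdry U) &
         (Jmax `&` A = set0 ->
            Jmax = M'' /\
            exists U, [/\ is_component (~` Jmax) U, bounded_set U,
                          Jmin `<=` U & Jmax = bdry U])]).
Proof.
move=> hg G A; have [i0 _] := dis_inhabited hg; have [hG _] := hg.
have /choice[ri Hi] i : exists r, pcb G (g i) r := pcb_ex i hG.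
have H := Hi i0; have kS := dis_Julia_cpt hg.
rewrite {}/A (unionJE hG).
split; first exact: (minA_ex H Hi kS).
split; first exact: (maxA_ex i0 Hi kS).
move=> Jmin Jmax M' M'' [cJ0 [x0 [Jx0 b0]]] [cJ1 [x1 [Jx1 b1]]] hM' hM''.
have [S0 ->] := calJ_cc cJ0 Jx0; have [S1 ->] := calJ_cc cJ1 Jx1.
(* Only two consequences of the choice of the components are used: [x0] lies in every filled set,
   and [x1] is not surrounded by a compact part of the Julia set that omits it. *)
have K0 := bdry_Khat H b0.
have reach F := Uinf_reach b1 (F := F).
have nJ := min_ne_max H hg (Uinf_Fatou b1) K0 S0 S1 reach.
have kA' := kA Hi kS.
have fillA x := compA_fill H Hi kS (x := x) K0.
have [m' Am' [-> least]] := minimal_least kA' fillA hM'.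
have [m'' Am'' [-> great]] := maximal_greatest kA' fillA hM''.
split.
- exact: (min_sub H Hi kS K0 S0 Am' least).
- exact: (max_sub H Hi kS K0 S1 reach Am'' great).
- have [a Ja Aa] := Jmin_meets H Hi kS K0 S0.
  have [b Jb Ab] := Jmax_meets H Hi kS K0 S1 reach.
  by split; [exists a|exists b].
- move=> JA; split; first exact: (Jmin_eq H Hi kS K0 S0 JA Am' least).
  move=> _ [u nu ->] ub; apply: (Jmin_outer H Hi kS K0 S0 JA) => bu.
  by apply: ub; apply/bounded_setP.
- move=> JA; split; first exact: (Jmax_eq H Hi kS K0 S1 reach JA nJ Am'' great).
  have [bU JU] := Jmax_side H kS K0 S0 S1 nJ.
  exists (cc (~` cc (fin (Julia G)) x1) x0); split=> //; first by exists x0.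
    exact/bounded_setP.
  exact: (Jmax_bdry H Hi kS K0 S1 reach JA nJ).
Qed.
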